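(* Let $\omega>\omega_0\geq0$, $p\in[1,2]$ and $q\in[2,\infty)$. Then there exists a constant $C\geq0$ such that the following holds. Let $X$ be a Banach space with type $p$ and cotype $q$, and let $-iA$ generate a $C_0$-group $(U(s))_{s\in\mathbb{R}}\subseteq\mathcal{L}(X)$ such that $\|U(s)\|_{\mathcal{L}(X)}\leq M\cosh(\omega_0s)$ for all $s\in\mathbb{R}$ and some $M\geq1$. Then $$\Big\|\int_{\mathbb{R}}U(s)x\,\mu(ds)\Big\|_X\leq C\,\tau_{p,X}\,c_{q,X}\,M^2\,\|\mathcal{F}\mu_\omega\|_{L^\infty(\mathbb{R})}\,\|x\|_{D_A(\frac1p-\frac1q,1)}$$ for all $\mu\in\mathcal{M}_\omega(\mathbb{R})$ and all $x\in D_A(\tfrac1p-\tfrac1q,1)$.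
   Context: All Banach spaces are complex and nonzero; $\mathcal{L}(X)$ is the space of bounded operators on $X$. Type and cotype: let $(\gamma_k)_{k\in\mathbb{N}}$ be independent standard complex Gaussian random variables. $X$ has type $p\in[1,2]$ if there is $C$ with $(\mathbb{E}\|\sum_{k=1}^n\gamma_kx_k\|^2)^{1/2}\leq C(\sum_{k=1}^n\|x_k\|^p)^{1/p}$ for all $n$ and $x_1,\dots,x_n\in X$, and the minimal such $C$ is $\tau_{p,X}$; $X$ has cotype $q\in[2,\infty)$ if there is $C$ with $(\sum_{k=1}^n\|x_k\|^q)^{1/q}\leq C(\mathbb{E}\|\sum_{k=1}^n\gamma_kx_k\|^2)^{1/2}$ for all $n$ and $x_1,\dots,x_n\in X$, and the minimal such $C$ is $c_{q,X}$. Measures: $\mathcal{M}(\mathbb{R})$ is the space of complex Borel measures on $\mathbb{R}$, and $\mathcal{M}_\omega(\mathbb{R})$ is the set of $\mu\in\mathcal{M}(\mathbb{R})$ of the form $\mu(ds)=e^{-\omega|s|}\nu(ds)$ for some $\nu\in\mathcal{M}(\mathbb{R})$. For $\mu\in\mathcal{M}_\omega(\mathbb{R})$, $\mu_\omega\in\mathcal{M}(\mathbb{R})$ is given by $\mu_\omega(ds):=\cosh(\omega s)\mu(ds)$. The Fourier transform is $\mathcal{F}\mu(z)=\int_{\mathbb{R}}e^{-izs}\mu(ds)$. Real interpolation: $D_A(\theta,r):=(X,D(A))_{\theta,r}$ is the real interpolation space (K-method) between $X$ and $D(A)$ with graph norm $\|x\|_X+\|Ax\|_X$; in particular $D_A(0,1)=\{0\}$.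 *)

(* Defs.v *)
From mathcomp Require Export all_boot all_order all_algebra.
From mathcomp Require Export finmap.
From mathcomp Require Export all_classical all_reals all_analysis.
From mathcomp Require Export complex.
Export Order.TTheory GRing.Theory Num.Theory.
Export numFieldNormedType.Exports.

Set Implicit Arguments.
Unset Strict Implicit.
Unset Printing Implicit Defensive.

Local Open Scope classical_set_scope.
Local Open Scope complex_scope.
Local Open Scope ring_scope.

(* In a normed module over [R[i]] the library norm takes (real) values in
   [R[i]]; [rnorm] is the same norm read in [R]. *)
Definition rnorm (R : realType) (X : normedModType R[i]) (x : X) : R :=
  complex.Re `|x|.

Definition opnorm (R : realType) (X : normedModType R[i]) (T : X -> X) : R :=
  sup [set rnorm (T x) | x in [set x : X | rnorm x <= 1]].

Definition cosh (R : realType) (x : R) : R := (expR x + expR (- x)) / 2.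

Section ComplexMeasures.
Context (d : measure_display) (T : measurableType d) (R : realType).

(* Values on non-measurable sets are irrelevant.  Taking [F] constantly empty
   forces [mu set0 = 0]. *)
Definition complex_measure (mu : set T -> R[i]^o) : Prop :=
  forall F : nat -> set T,
    (forall k, measurable (F k)) -> trivIset setT F ->
    (fun n => \sum_(0 <= k < n) mu (F k)) @ \oo --> mu (\bigcup_k F k).

Definition total_variation (mu : set T -> R[i]^o) (E : set T) : \bar R :=
  ereal_sup [set (\sum_(0 <= k <oo) (rnorm (mu (F k)))%:E)%E | F in
    [set F : nat -> set T | [/\ forall k, measurable (F k),
                             trivIset setT F & \bigcup_k F k = E]]].

Section Bochner.
Variable X : normedModType R[i].

Definition is_simple (g : T -> X) : Prop :=
  finite_set (range g) /\ forall v, measurable (g @^-1` [set v]).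

Definition simple_integral (mu : set T -> R[i]^o) (g : T -> X) : X :=
  \sum_(v \in range g) (mu (g @^-1` [set v]) *: v).

Definition is_bochner_integral
    (mu : set T -> R[i]^o) (f : T -> X) (y : X) : Prop :=
  exists g : nat -> T -> X,
    [/\ forall n, is_simple (g n),
        forall t, (fun n => g n t) @ \oo --> f t,
        (fun n => \int[total_variation mu]_t (rnorm (f t - g n t))%:E)%E
          @ \oo --> (0 : \bar R)%E
      & (fun n => simple_integral mu (g n)) @ \oo --> y].

(* The value is [0] when [f] is not Bochner integrable. *)
Definition bochner (mu : set T -> R[i]^o) (f : T -> X) : X :=
  xget 0 [set y | is_bochner_integral mu f y].

End Bochner.

(* The set function [h(s) mu(ds)]. *)
Definition weighted (h : T -> R[i]^o) (mu : set T -> R[i]^o) (B : set T)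
    : R[i]^o :=
  bochner mu (fun s => if s \in B then h s else 0).

End ComplexMeasures.

Definition in_M_omega (R : realType) (omega : R) (mu : set R -> R[i]^o) : Prop :=
  complex_measure mu /\
  exists2 nu : set R -> R[i]^o, complex_measure nu &
    forall B : set R, measurable B ->
      mu B = weighted (fun s : R => (expR (- (omega * `|s|)))%:C) nu B.

Definition mu_weight (R : realType) (omega : R) (mu : set R -> R[i]^o)
    : set R -> R[i]^o :=
  weighted (fun s : R => (cosh (omega * s))%:C) mu.

(* [cos (z s) - i sin (z s)] is [exp (- i z s)]; only real [z] is needed. *)
Definition fourier (R : realType) (mu : set R -> R[i]^o) (z : R) : R[i]^o :=
  bochner mu (fun s : R => (cos (z * s) +i* - sin (z * s) : R[i]^o)).

Definition Linfty_norm (R : realType) (f : R -> R[i]^o) : \bar R :=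
  Lnorm (@lebesgue_measure R) +oo%E (fun z => (rnorm (f z))%:E).

Section Gaussians.
Context (R : realType) (d : measure_display) (Om : measurableType d).
Variable P : probability Om R.

Definition mutually_independent (I : choiceType) (xi : I -> Om -> R) : Prop :=
  forall (J : {fset I}) (B : I -> set R), (forall i, measurable (B i)) ->
    P (\bigcap_(i in [set` J]) (xi i @^-1` B i)) =
    (\prod_(i <- J) fine (P (xi i @^-1` B i)))%:E.

Definition re_im (gam : nat -> Om -> R[i]) (i : nat * bool) (w : Om) : R :=
  if i.2 then complex.Im (gam i.1 w) else complex.Re (gam i.1 w).

(* Normalised by E|gam k|^2 = 1: the real and imaginary parts are
   independent centred normal variables of variance 1/2 ([normal_prob] takes
   the standard deviation).  Joint independence of all real and imaginary
   parts also expresses the independence of the [gam k]. *)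
Definition standard_complex_gaussians (gam : nat -> Om -> R[i]) : Prop :=
  [/\ forall i, measurable_fun setT (re_im gam i),
      forall i (B : set R), measurable B ->
        P (re_im gam i @^-1` B) = normal_prob 0 (Num.sqrt 2)^-1 B
    & mutually_independent (re_im gam)].

Section TypeCotype.
Variables (gam : nat -> Om -> R[i]) (X : normedModType R[i]).

Definition gauss_norm (n : nat) (x : 'I_n -> X) : \bar R :=
  ('E_P[fun w => (rnorm (\sum_(k < n) gam k w *: x k) ^+ 2)%R] `^ 2^-1)%E.

Definition lp_norm (p : R) (n : nat) (x : 'I_n -> X) : R :=
  (\sum_(k < n) rnorm (x k) `^ p) `^ p^-1.

Definition type_bound (p C : R) : Prop :=
  forall (n : nat) (x : 'I_n -> X),
    (gauss_norm x <= (C * lp_norm p x)%:E)%E.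

Definition cotype_bound (q C : R) : Prop :=
  forall (n : nat) (x : 'I_n -> X),
    ((lp_norm q x)%:E <= C%:E * gauss_norm x)%E.

Definition has_type (p : R) : Prop := exists C, type_bound p C.
Definition has_cotype (q : R) : Prop := exists C, cotype_bound q C.

Definition type_const (p : R) : R := inf [set C | type_bound p C].
Definition cotype_const (q : R) : R := inf [set C | cotype_bound q C].

End TypeCotype.
End Gaussians.

Section Groups.
Context (R : realType) (X : normedModType R[i]).

Definition is_C0_group (U : R -> {linear X -> X}) : Prop :=
  [/\ forall s, continuous (U s),
      forall x, U 0 x = x,
      forall s t x, U (s + t) x = U s (U t x)
    & forall x, continuous (fun s => U s x)].

(* An unbounded operator is a domain [D] together with a map [G] whose values
   outside [D] are irrelevant. *)
Definition generates (D : set X) (G : X -> X) (U : R -> {linear X -> X})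
    : Prop :=
  forall x y : X,
    (D x /\ G x = y) <->
    (fun h : R => (h^-1)%:C *: (U h x - x)) @ 0^' --> y.

Section Interpolation.
Variables (D : set X) (A : X -> X).

Definition graph_norm (x : X) : R := rnorm x + rnorm (A x).

Definition K_functional (t : R) (x : X) : R :=
  inf [set rnorm ab.1 + t * graph_norm ab.2 | ab in
        [set ab : X * X | D ab.2 /\ x = ab.1 + ab.2]].

(* Real interpolation between [X] and [D(A)] for finite [r]; the norm is
   [+oo] off the interpolation space.  All of [X] is the ambient sum space. *)
Definition interp_norm (theta r : R) (x : X) : \bar R :=
  ((\int[@lebesgue_measure R]_(t in `]0%R, +oo[)
      ((t `^ (- theta) * K_functional t x) `^ r / t)%:E) `^ r^-1)%E.

Definition interp_space (theta r : R) : set X :=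
  [set x | (interp_norm theta r x < +oo)%E].

End Interpolation.
End Groups.

(* Main.v *)
Require Import Defs.
From HB Require Import structures.
From mathcomp Require Import measurable_realfun ess_sup_inf ring lra zify.
Set Implicit Arguments.
Unset Strict Implicit.
Unset Printing Implicit Defensive.
Local Open Scope classical_set_scope.
Local Open Scope complex_scope.
Local Open Scope ring_scope.

(** Write [U s = cosh (omega s) W s] with [W s = U s / cosh (omega s)] and replace
    the integral by a sum [\sum_m beta_m W (m h) x] over the grid of step
    [h = 2^-J], where the symbol [\sum_m beta_m e^{- i m xi}] is bounded by the
    sup norm of the Fourier transform of [cosh (omega s) mu(ds)] up to [o(1)].

    Gaussian energies [E |\sum_k gamma_k x_k|^2] are invariant under unitary
    matrices, in particular under the discrete Fourier transform.  Hence
    convolution on Z/n with a kernel of symbol at most [N] maps [l^p] to [l^q]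
    with norm at most [c_q * N * tau_p].  Since [U] is a group, every weight [v]
    of the form [v = phi * a^|.|] transfers this bound to the sum
    [\sum_m beta_m v_m U (m h) z], which is [O(h^-theta)] for the weight
    [1 / cosh] and [O(h^(1 - theta))] for its increments.

    Passing from step [h] to step [2 h] changes the sum by second differences at
    the odd grid points, hence by [O(h^-theta K(h, x))], and these errors add up
    over all dyadic scales to the norm of the interpolation space. *)

(** * Norms with real values *)

(** The obstacle is the factor [h^-theta] in transference. Hoelder and the [l^p] sum over about
    [1/h] grid points per unit length cost [h^(-1-theta)], and the density of the weight returns
    only one [h]; so for [theta > 0] a direct limit in [h] with a fixed vector gives nothing. Small
    steps are therefore used only for differences between consecutive scales, where an increment of
    the weight or of the orbit brings in [K(h, x)]; the exponent 1 of the interpolation space is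
    exactly what sums these terms. Two operations must not lose any constant. Coarsening, which is
    iterated, replaces a symbol by convex combinations of its values. Discretisation replaces a
    character by a positive definite interpolant, so that the symbol is, up to a small error, a
    convex combination of values of the Fourier transform. The weight [1 / cosh] is convenient
    because its density against [a^|.|] is a product of three translates of itself: one absorbs the
    growth of the group, one decays, one is left for increments. Of the factors in [M^2], one comes
    from the outer operators [V k], the other from the orbit of the vector. *)

Section rnorm_theory.
Context (R : realType) (X : normedModType R[i]).
Implicit Types x y : X.

Lemma normE x : `|x| = (rnorm x)%:C.
Proof. by rewrite /rnorm RRe_real; [|exact: normr_real]. Qed.

Lemma rnorm_ge0 x : 0 <= rnorm x.
Proof. by rewrite -ler0c -normE normr_ge0. Qed.

Lemma rnorm_eq0 x : (rnorm x == 0) = (x == 0).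
Proof. by rewrite -(inj_eq (@complexI R)) -normE normr_eq0. Qed.

Lemma rnorm0 : rnorm (0 : X) = 0.
Proof. by apply/eqP; rewrite rnorm_eq0. Qed.

Lemma rnormD x y : rnorm (x + y) <= rnorm x + rnorm y.
Proof. by rewrite -lecR rmorphD/= -!normE ler_normD. Qed.

Lemma rnormN x : rnorm (- x) = rnorm x.
Proof. by rewrite /rnorm normrN. Qed.

Lemma rnormB x y : rnorm (x - y) <= rnorm x + rnorm y.
Proof. by rewrite -(rnormN y) rnormD. Qed.

Lemma rdistC x y : rnorm (x - y) = rnorm (y - x).
Proof. by rewrite -opprB rnormN. Qed.

Lemma rnorm_triangle x y z : rnorm (x - z) <= rnorm (x - y) + rnorm (y - z).
Proof. by rewrite -(subrKA y) rnormD. Qed.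

Lemma ler_rdist_dist x y : `|rnorm x - rnorm y| <= rnorm (x - y).
Proof.
rewrite ler_norml; apply/andP; split.
  by rewrite lerNl opprB lerBlDr -(rdistC y) -{1}(subrK x y) rnormD.
by rewrite lerBlDr -{1}(subrK y x) rnormD.
Qed.

Lemma rnorm_sum (I : Type) (r : seq I) (P : pred I) (F : I -> X) :
  rnorm (\sum_(i <- r | P i) F i) <= \sum_(i <- r | P i) rnorm (F i).
Proof.
elim/big_ind2 : _ => //; first by rewrite rnorm0.
move=> x1 x2 y1 y2 h1 h2; apply: (le_trans (rnormD _ _)); exact: lerD.
Qed.

(** Neighbourhoods in [X] are measured by radii in [R[i]]; a positive radius is real, and this
    transfers every limit to one in [R]. *)
Lemma cvg_rnormP (F : set_system X) (FF : Filter F) y :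
  F --> y <-> (fun x => rnorm (y - x)) @ F --> (0 : R).
Proof.
split=> [/cvgrPdist_lt h|/cvgrPdist_lt h].
  apply/cvgrPdist_lt => e e0; near=> x.
  rewrite sub0r normrN ger0_norm ?rnorm_ge0// -ltcR -normE.
  by near: x; apply: h; rewrite ltcR.
apply/cvgrPdist_lt => e e0; have ee : e = (complex.Re e)%:C.
  by rewrite RRe_real// gtr0_real.
near=> x; rewrite normE ee ltcR.
have : `|0 - rnorm (y - x)| < complex.Re e.
  by near: x; apply: h; rewrite -ltcR -ee.
by rewrite sub0r normrN ger0_norm ?rnorm_ge0.
Unshelve. all: by end_near. Qed.

Lemma continuous_rnorm : continuous (@rnorm R X).
Proof.
move=> x; apply/cvgrPdist_lt => e e0; near=> t.
apply: le_lt_trans (ler_rdist_dist _ _) _; rewrite -ltcR -normE.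
by near: t; apply: cvgr_dist_lt; [exact: cvg_id|rewrite ltcR].
Unshelve. all: by end_near. Qed.

Lemma cvg_rnorm (T : Type) (F : set_system T) (FF : Filter F) (f : T -> X) y :
  f @ F --> y -> rnorm (f x) @[x --> F] --> rnorm y.
Proof. by move=> fy; apply: continuous_cvg => //; exact: continuous_rnorm. Qed.

End rnorm_theory.

Lemma rnormCE (R : realType) (c : R[i]^o) :
  rnorm c = Num.sqrt (complex.Re c ^+ 2 + complex.Im c ^+ 2).
Proof. by rewrite /rnorm normc_def. Qed.

Lemma rnormZ (R : realType) (X : normedModType R[i]) (c : R[i]) (x : X) :
  rnorm (c *: x) = rnorm (c : R[i]^o) * rnorm x.
Proof.
by apply: (@complexI R); rewrite rmorphM/= -!normE normrZ.
Qed.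

Lemma rnormM (R : realType) (c d : R[i]^o) : rnorm (c * d : R[i]^o) = rnorm c * rnorm d.
Proof. exact: (@rnormZ R R[i]^o). Qed.

Lemma rnormR (R : realType) (c : R) : rnorm (c%:C : R[i]^o) = `|c|.
Proof. by rewrite rnormCE/= expr0n/= addr0 sqrtr_sqr. Qed.

Lemma rnorm_real (R : realType) (X : normedModType R[i]) (c : R) (x : X) :
  rnorm (c%:C *: x) = `|c| * rnorm x.
Proof. by rewrite rnormZ rnormR. Qed.

Lemma ler_Re_rnorm (R : realType) (c : R[i]^o) : `|complex.Re c| <= rnorm c.
Proof. by rewrite rnormCE -[leLHS]sqrtr_sqr ler_wsqrtr// lerDl sqr_ge0. Qed.

Lemma ler_Im_rnorm (R : realType) (c : R[i]^o) : `|complex.Im c| <= rnorm c.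
Proof. by rewrite rnormCE -[leLHS]sqrtr_sqr ler_wsqrtr// lerDr sqr_ge0. Qed.

Lemma rnorm_leD (R : realType) (c : R[i]^o) :
  rnorm c <= `|complex.Re c| + `|complex.Im c|.
Proof.
rewrite rnormCE -[leRHS]ger0_norm ?addr_ge0// -[leRHS]sqrtr_sqr ler_wsqrtr//.
rewrite sqrrD !real_normK ?num_real// -addrA lerD2l lerDr.
by rewrite mulrn_wge0// mulr_ge0.
Qed.

Lemma cvg_complexP (R : realType) (T : Type) (F : set_system T) (FF : Filter F)
    (f : T -> R[i]^o) (y : R[i]^o) :
  f @ F --> y <->
  (complex.Re (f x) @[x --> F] --> complex.Re y /\
   complex.Im (f x) @[x --> F] --> complex.Im y).
Proof.
split=> [/cvg_rnormP/cvgrPdist_lt h|[/cvgrPdist_lt h1 /cvgrPdist_lt h2]].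
  split; apply/cvgrPdist_lt => e e0; near=> x;
    have : `|0 - rnorm (y - f x)| < e by [near: x; exact: h];
    rewrite sub0r normrN ger0_norm ?rnorm_ge0//; apply: le_lt_trans.
  - by apply: le_trans (ler_Re_rnorm _); rewrite raddfB.
  - by apply: le_trans (ler_Im_rnorm _); rewrite raddfB.
apply/cvg_rnormP/cvgrPdist_lt => e e0; near=> x.
rewrite sub0r normrN ger0_norm ?rnorm_ge0//.
apply: (le_lt_trans (rnorm_leD _)); rewrite (splitr e) !raddfB/=.
by rewrite ltrD//; near: x; [apply: h1|apply: h2]; rewrite divr_gt0.
Unshelve. all: by end_near. Qed.

Lemma cvg_cst_eq (R : realType) (V : normedModType R[i]) (u : nat -> V) (c l : V) :
  u @ \oo --> l -> (forall n, u n = c) -> l = c.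
Proof.
move=> ul uc; have /funext e : u =1 cst c by [].
by rewrite e in ul; move/cvg_lim : ul => <- //; rewrite lim_cst.
Qed.

Lemma ReD (R : realType) (x y : R[i]) : complex.Re (x + y) = complex.Re x + complex.Re y.
Proof. by case: x; case: y. Qed.

Lemma ImD (R : realType) (x y : R[i]) : complex.Im (x + y) = complex.Im x + complex.Im y.
Proof. by case: x; case: y. Qed.

Lemma Re_sum (R : realType) (I : Type) (r : seq I) (P : pred I) (F : I -> R[i]) :
  complex.Re (\sum_(i <- r | P i) F i) = \sum_(i <- r | P i) complex.Re (F i).
Proof. by rewrite (big_morph _ (@ReD R) (erefl _)). Qed.

Lemma Im_sum (R : realType) (I : Type) (r : seq I) (P : pred I) (F : I -> R[i]) :
  complex.Im (\sum_(i <- r | P i) F i) = \sum_(i <- r | P i) complex.Im (F i).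
Proof. by rewrite (big_morph _ (@ImD R) (erefl _)). Qed.

Lemma cvgE (R : realType) (T : Type) (F : set_system T) (FF : Filter F) (u : T -> R) (l : R) :
  u @ F --> l <-> (u x)%:E @[x --> F] --> l%:E.
Proof.
split=> h; first by apply: cvg_EFin; [exact: nearW|exact: h].
by move/fine_cvgP : h => [_ h]; exact: h.
Qed.

(** * Complex measures and the Bochner integral *)

Section le_integral_set_function.
Local Open Scope ereal_scope.
Context d (T : measurableType d) (R : realType).
Implicit Types m : set T -> \bar R.

Import HBNNSimple.

Let sintegral_range m (f : {nnsfun T >-> R}) : m set0 = 0 ->
  sintegral m f = \sum_(x \in range f) x%:E * m (f @^-1` [set x]).
Proof.
move=> m0; rewrite /sintegral (fsbig_widen (range f) setT)//= => x [_ Nfx] /=.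
by rewrite preimage10// m0 mule0.
Qed.

Let ge0_integral_sup m (f : T -> \bar R) : m set0 = 0 ->
  (forall A, measurable A -> 0 <= m A) -> (forall x, 0 <= f x) ->
  \int[m]_x f x = ereal_sup [set sintegral m h |
    h in [set h : {nnsfun T >-> R} | forall x, (h x)%:E <= f x]].
Proof.
move=> m0 mge f0; rewrite /integral patch_setT.
rewrite (_ : f ^\+ = f); last by apply/funext => x; rewrite unlock max_l.
rewrite (_ : f ^\- = cst 0); last by apply/funext => x; rewrite unlock max_r// leeNl oppe0.
set S := ereal_sup _; set S0 := ereal_sup _.
suff -> : S0 = 0 by rewrite sube0.
have s0 : sintegral m (@nnsfun0 _ T R) = 0.
  by rewrite sintegral_range// fsbig1// => _ [x _ <-] /=; rewrite mul0e.
apply/eqP; rewrite eq_le; apply/andP; split; last first.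
  by apply/ereal_sup_ubound; exists nnsfun0.
apply/ge_ereal_sup => /= x [g /= g0 <-].
rewrite (eq_sintegral (@nnsfun0 _ T R)) ?s0// => y /=.
by apply/eqP; rewrite eq_le -2!lee_fin g0 //= lee_fin.
Qed.

(** [total_variation] enters the definition of the Bochner integral as a mere set function. The
    comparison is made term by term in the integrals of simple functions, where only the values on
    measurable sets and at [set0] count. *)
Lemma le_integral_set_function m1 m2 (r : R) (f : T -> \bar R) :
  (0 <= r)%R -> m1 set0 = 0 -> m2 set0 = 0 ->
  (forall A, measurable A -> 0 <= m1 A) -> (forall A, measurable A -> 0 <= m2 A) ->
  (forall A, measurable A -> m1 A <= r%:E * m2 A) -> (forall x, 0 <= f x) ->
  \int[m1]_x f x <= r%:E * \int[m2]_x f x.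
Proof.
move=> r0 m10 m20 m1ge m2ge m12 f0; rewrite !ge0_integral_sup//.
apply/ge_ereal_sup => /= _ [h hf <-].
apply: (@le_trans _ _ (r%:E * sintegral m2 h)); last first.
  by rewrite lee_wpmul2l ?lee_fin//; apply/ereal_sup_ubound; exists h.
rewrite !sintegral_range// !fsbig_finite//= !big_seq.
rewrite ge0_sume_distrr; last first.
  move=> x; rewrite in_fset_set// inE => -[t _ <-].
  by rewrite mule_ge0 ?lee_fin ?fun_ge0// m2ge.
apply: lee_sum => x; rewrite in_fset_set// inE => -[t _ <-].
rewrite muleCA; apply: lee_wpmul2l; first by rewrite lee_fin fun_ge0.
exact: m12.
Qed.

End le_integral_set_function.

Section complex_measure_theory.
Context d (T : measurableType d) (R : realType).
Variable mu : set T -> R[i]^o.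
Hypothesis hmu : complex_measure mu.

(** Consecutive partial sums for the constant sequence [set0] differ by [mu set0], and convergence
    sends these differences to 0. *)
Lemma cmeasure0 : mu set0 = 0.
Proof.
have h : (fun n => \sum_(0 <= k < n) mu set0) @ \oo --> mu set0.
  have := @hmu (fun=> set0) (fun=> measurable0) (@trivIset_set0 _ _ _).
  by rewrite bigcup0.
have h1 : (fun n => \sum_(0 <= k < n.+1) mu set0) @ \oo --> mu set0.
  by rewrite (cvg_shiftS (fun n => \sum_(0 <= k < n) mu set0)).
have h2 : (fun n => \sum_(0 <= k < n.+1) mu set0 - \sum_(0 <= k < n) mu set0)
    @ \oo --> mu set0 - mu set0 by exact: cvgB.
rewrite subrr in h2; move/cvg_lim : h2 => <- //.
rewrite (_ : (fun n => _) = cst (mu set0)) ?lim_cst//.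
by apply/funext => n /=; rewrite !sumr_const_nat !subn0 mulrS addrK.
Qed.

Lemma cmeasureU A B : measurable A -> measurable B -> A `&` B = set0 ->
  mu (A `|` B) = mu A + mu B.
Proof.
move=> mA mB AB0.
have m2 k : measurable (bigcup2 A B k) by case: k => [|[|k]] //=; exact: measurable0.
have t2 : trivIset setT (bigcup2 A B). by rewrite -trivIset_bigcup2; exact: AB0.
have h := hmu m2 t2; rewrite bigcup2E in h.
have h2 := cvg_comp _ _ (@cvg_addnr 2) h.
apply: (cvg_cst_eq h2) => n /=.
rewrite addn2 big_ltn// big_ltn//= big_nat big1 ?addr0// => i.
by case: i => [|[|i]]//= _; exact: cmeasure0.
Qed.

End complex_measure_theory.

Section charge_parts.
Context d (T : measurableType d) (R : realType).
Implicit Types mu : set T -> R[i]^o.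

(* The proof argument is a phantom that carries the charge structure. *)
Definition Re_charge mu (hmu : complex_measure mu) (A : set T) : \bar R :=
  (complex.Re (mu A))%:E.
Definition Im_charge mu (hmu : complex_measure mu) (A : set T) : \bar R :=
  (complex.Im (mu A))%:E.

Section instances.
Variables (mu : set T -> R[i]^o) (hmu : complex_measure mu).

Let Re0 : Re_charge hmu set0 = 0%E.
Proof. by rewrite /Re_charge cmeasure0. Qed.
Let Ref A : measurable A -> Re_charge hmu A \is a fin_num.
Proof. by []. Qed.
Let Res : semi_sigma_additive (Re_charge hmu).
Proof.
move=> F mF tF _; have /cvg_complexP[h _] := hmu mF tF.
rewrite /Re_charge (_ : (fun n => _) =
    EFin \o (fun n => complex.Re (\sum_(0 <= k < n) mu (F k)))); last first.
  by apply/funext => n /=; rewrite sumEFin Re_sum.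
by apply/cvgE.
Qed.
HB.instance Definition _ := isCharge.Build _ _ _ (Re_charge hmu) Re0 Ref Res.

Let Im0 : Im_charge hmu set0 = 0%E.
Proof. by rewrite /Im_charge cmeasure0. Qed.
Let Imf A : measurable A -> Im_charge hmu A \is a fin_num.
Proof. by []. Qed.
Let Ims : semi_sigma_additive (Im_charge hmu).
Proof.
move=> F mF tF _; have /cvg_complexP[_ h] := hmu mF tF.
rewrite /Im_charge (_ : (fun n => _) =
    EFin \o (fun n => complex.Im (\sum_(0 <= k < n) mu (F k)))); last first.
  by apply/funext => n /=; rewrite sumEFin Im_sum.
by apply/cvgE.
Qed.
HB.instance Definition _ := isCharge.Build _ _ _ (Im_charge hmu) Im0 Imf Ims.

End instances.
End charge_parts.

Section finite_measure_add.
Local Open Scope ereal_scope.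
Context d (T : measurableType d) (R : realType).
Variables m1 m2 : {finite_measure set T -> \bar R}.

Definition finite_measure_add : set T -> \bar R := measure_add m1 m2.

HB.instance Definition _ := Measure.on finite_measure_add.

Let finite_measure_add_fin : fin_num_fun finite_measure_add.
Proof.
move=> A mA; rewrite /finite_measure_add measure_addE fin_numD.
by rewrite !fin_num_measure.
Qed.

HB.instance Definition _ :=
  @Measure_isFinite.Build _ _ _ finite_measure_add finite_measure_add_fin.

Lemma finite_measure_addE A : finite_measure_add A = m1 A + m2 A.
Proof. exact: measure_addE. Qed.

End finite_measure_add.

Section dominating_measure.
Local Open Scope ereal_scope.
Context d (T : measurableType d) (R : realType).
Variables (mu : set T -> R[i]^o) (hmu : complex_measure mu).

Lemma total_variation_ge A B : measurable A -> measurable B -> B `<=` A ->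
  (rnorm (mu B))%:E <= total_variation mu A.
Proof.
move=> mA mB BA.
apply: (@le_trans _ _ (\sum_(0 <= k <oo) (rnorm (mu (bigcup2 B (A `\` B) k)))%:E)).
  apply: le_trans (@nneseries_lim_ge _ _ xpredT 0%N 1%N _); last first.
    by move=> n _ _; rewrite lee_fin rnorm_ge0.
  by rewrite big_nat1.
apply: ereal_sup_ubound; exists (bigcup2 B (A `\` B)) => //=; split.
- by case=> [|[|k]] //=; exact: measurableD.
- by rewrite -trivIset_bigcup2 setDE setICA setICr setI0.
- by rewrite bigcup2E setDUK.
Qed.

Lemma total_variation_le (m : {measure set T -> \bar R}) A : measurable A ->
  (forall B, measurable B -> B `<=` A -> (rnorm (mu B))%:E <= m B) ->
  total_variation mu A <= m A.
Proof.
move=> mA le; apply: ge_ereal_sup => _ [F [mF tF FA] <-].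
rewrite -[in leRHS]FA measure_semi_bigcup//; last exact: bigcup_measurable.
apply: lee_nneseries => [k _ _|k _].
  by rewrite lee_fin rnorm_ge0.
by apply: le; [exact: mF|rewrite -FA => t Fkt; exists k].
Qed.

(** [k] is the sum of the four Jordan parts of [Re mu] and [Im mu]. Each part evaluates [mu] on a
    subset up to sign, so it is at most the total variation, whence the 4. A genuine finite measure
    comparable with the total variation gives access to dominated convergence. *)
Lemma dominating_measure_ex : exists k : {finite_measure set T -> \bar R},
  (forall A, measurable A -> (rnorm (mu A))%:E <= k A) /\
  (forall A, measurable A -> k A <= 4%:E * total_variation mu A).
Proof.
have [P1 [N1 h1]] := Hahn_decomposition (Re_charge hmu).
have [P2 [N2 h2]] := Hahn_decomposition (Im_charge hmu).
have kE A : finite_measure_add (finite_measure_add (jordan_pos h1) (jordan_neg h1))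
    (finite_measure_add (jordan_pos h2) (jordan_neg h2)) A =
    jordan_pos h1 A + jordan_neg h1 A + (jordan_pos h2 A + jordan_neg h2 A).
  by rewrite finite_measure_addE; congr (_ + _); exact: finite_measure_addE.
pose k := finite_measure_add (finite_measure_add (jordan_pos h1) (jordan_neg h1))
  (finite_measure_add (jordan_pos h2) (jordan_neg h2)).
suff : (forall A, measurable A -> (rnorm (mu A))%:E <= k A) /\
  (forall A, measurable A -> k A <= 4%:E * total_variation mu A).
  by move=> [k1 k2]; eexists; split; [exact: k1|exact: k2].
rewrite /k; split => A mA.
  have a1 : (`|complex.Re (mu A)|)%:E <= jordan_pos h1 A + jordan_neg h1 A :=
    abse_charge_variation h1 mA.
  have a2 : (`|complex.Im (mu A)|)%:E <= jordan_pos h2 A + jordan_neg h2 A :=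
    abse_charge_variation h2 mA.
  by rewrite kE; apply: (le_trans _ (leeD a1 a2)); rewrite -EFinD lee_fin rnorm_leD.
have [[mP1 _] [mN1 _] _ _] := h1; have [[mP2 _] [mN2 _] _ _] := h2.
have tv B : measurable B -> (`|complex.Re (mu (A `&` B))|)%:E <= total_variation mu A
    /\ (`|complex.Im (mu (A `&` B))|)%:E <= total_variation mu A.
  move=> mB; have h := @total_variation_ge A (A `&` B) mA (measurableI _ _ mA mB) (@subIsetl _ _ _).
  by split; apply: (le_trans _ h); rewrite lee_fin ?ler_Re_rnorm ?ler_Im_rnorm.
have j1 : jordan_pos h1 A <= total_variation mu A.
  rewrite jordan_posE cjordan_posE /crestr0 mem_set// /crestr.
  by apply: (le_trans _ (tv P1 mP1).1); rewrite lee_fin ler_norm.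
have j2 : jordan_neg h1 A <= total_variation mu A.
  rewrite jordan_negE cjordan_negE /crestr0 mem_set// /crestr.
  by apply: (le_trans _ (tv N1 mN1).1); rewrite lee_fin -normrN ler_norm.
have j3 : jordan_pos h2 A <= total_variation mu A.
  rewrite jordan_posE cjordan_posE /crestr0 mem_set// /crestr.
  by apply: (le_trans _ (tv P2 mP2).2); rewrite lee_fin ler_norm.
have j4 : jordan_neg h2 A <= total_variation mu A.
  rewrite jordan_negE cjordan_negE /crestr0 mem_set// /crestr.
  by apply: (le_trans _ (tv N2 mN2).2); rewrite lee_fin -normrN ler_norm.
have t0 : 0 <= total_variation mu A.
  by apply: (le_trans _ (tv A mA).1); rewrite lee_fin.
rewrite kE.
rewrite (_ : 4%R = (1 + 1 + (1 + 1))%R); last by ring.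
by rewrite !EFinD !ge0_muleDl ?mul1e ?leeD ?adde_ge0 ?lee01.
Qed.

End dominating_measure.

Section simple_functions.
Context d (T : measurableType d).

(** [is_simple] for values in any choice type, so that a pair of simple functions qualifies; the
    pair is the common refinement on which sums are compared. *)
Definition finite_valued (Y : choiceType) (g : T -> Y) :=
  finite_set (range g) /\ forall y, measurable (g @^-1` [set y]).

Lemma finite_valued_seq (Y : choiceType) (g : T -> Y) : finite_valued g ->
  exists2 r : seq Y, uniq r & forall t, g t \in r.
Proof.
move=> [/finite_seqP[r re] _]; exists (undup r); first exact: undup_uniq.
move=> t; rewrite mem_undup.
by have : range g (g t) by []; rewrite re.
Qed.

Lemma finite_valued_preimage (Y : choiceType) (g : T -> Y) (B : set Y) :
  finite_valued g -> measurable (g @^-1` B).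
Proof.
move=> gs; have [r _ gr] := finite_valued_seq gs.
rewrite (_ : _ @^-1` B = \bigcup_(y in [set` r] `&` B) (g @^-1` [set y])); last first.
  apply/seteqP; split => [t Bt|t [y [_ By] yt]].
    by exists (g t) => //; split => //; exact: gr.
  by rewrite /= in yt; rewrite /= yt.
apply: fin_bigcup_measurable; first exact: finite_setIl.
by move=> y _; exact: gs.2.
Qed.

Lemma finite_valued_comp (Y Z : choiceType) (g : T -> Y) (h : Y -> Z) :
  finite_valued g -> finite_valued (fun t => h (g t)).
Proof.
move=> gs; split.
  have -> : range (fun t => h (g t)) = h @` range g by rewrite image_comp.
  exact/finite_image/gs.1.
move=> z; rewrite (_ : _ @^-1` _ = g @^-1` (h @^-1` [set z]))//.
exact: finite_valued_preimage.
Qed.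

Lemma finite_valued_pair (Y Z : choiceType) (g : T -> Y) (h : T -> Z) :
  finite_valued g -> finite_valued h -> finite_valued (fun t => (g t, h t)).
Proof.
move=> gs hs; split.
  apply: (@sub_finite_set _ _ (range g `*` range h)).
    by move=> _ [t _ <-]; split => /=; exists t.
  by apply: finite_setX; [exact: gs.1|exact: hs.1].
move=> [y z].
rewrite (_ : _ @^-1` _ = g @^-1` [set y] `&` h @^-1` [set z]).
  by apply: measurableI; [exact: gs.2|exact: hs.2].
by apply/seteqP; split => t /= [-> ->].
Qed.

Lemma finite_valued_measurable (R : realType) (Y : choiceType) (g : T -> Y)
    (h : Y -> R) :
  finite_valued g -> measurable_fun setT (fun t => h (g t)).
Proof.
move=> gs _ B _; rewrite setTI.
exact: (@finite_valued_preimage _ _ (h @^-1` B)).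
Qed.

End simple_functions.

Section simple_integral_theory.
Context d (T : measurableType d) (R : realType).
Variables (mu : set T -> R[i]^o) (hmu : complex_measure mu).

Lemma cmeasure_fibers (Y : choiceType) (g : T -> Y) (r : seq Y) (P : pred Y) :
  finite_valued g -> uniq r ->
  mu (g @^-1` [set y | (y \in r) && P y]) = \sum_(y <- r | P y) mu (g @^-1` [set y]).
Proof.
move=> gs; elim: r => [_|y r ih /= /andP[yr ur]].
  by rewrite big_nil (_ : _ @^-1` _ = set0) ?(cmeasure0 hmu)//; apply/seteqP; split.
rewrite big_cons -(ih ur); case: ifPn => Py.
  rewrite -(cmeasureU hmu); [|exact: gs.2|exact: finite_valued_preimage|].
    congr (mu _); apply/seteqP; split => t /=.
      by rewrite inE => /andP[/orP[/eqP|] gr Pt]; [left|right; rewrite gr].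
    by case=> [->|/andP[gr ->]]; rewrite ?mem_head// inE gr orbT.
  by apply/seteqP; split => t //= [-> /andP[]]; rewrite (negbTE yr).
congr (mu _); apply/seteqP; split => t /=; rewrite inE.
  by move=> /andP[/orP[/eqP ->|->]//]; rewrite (negbTE Py).
by move=> /andP[-> ->]; rewrite orbT.
Qed.

Context (X : normedModType R[i]).

(** [F] may identify values of [g]; grouping the fibres of [g] by the value of [F] shows that the
    finer partition gives the same sum. Linearity follows by taking a pair for [g]. *)
Lemma simple_integral_comp (Y : choiceType) (g : T -> Y) (r : seq Y) (F : Y -> X) :
  finite_valued g -> uniq r -> (forall t, g t \in r) ->
  simple_integral mu (fun t => F (g t)) = \sum_(y <- r) mu (g @^-1` [set y]) *: F y.
Proof.
move=> gs ur gr; rewrite /simple_integral.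
pose s := undup (map F r).
have us : uniq s by exact: undup_uniq.
rewrite (fsbig_widen _ [set` s]); last 2 first.
- by move=> _ [t _ <-] /=; rewrite mem_undup map_f.
- move=> v [_ nv] /=; rewrite preimage10// ?(cmeasure0 hmu) ?scale0r//.
rewrite -fsbig_seq//.
transitivity (\sum_(v <- s) \sum_(y <- r | F y == v) mu (g @^-1` [set y]) *: F y).
  apply: eq_bigr => v _.
  transitivity (mu (g @^-1` [set y | (y \in r) && (F y == v)]) *: v).
    congr (mu _ *: _); apply/seteqP; split => t /=.
      by move=> <-; rewrite gr eqxx.
    by move=> /andP[_ /eqP].
  rewrite cmeasure_fibers// scaler_suml; apply: eq_bigr => y /eqP ->//.
rewrite (exchange_big_dep xpredT)//= big_seq [RHS]big_seq.
apply: eq_bigr => y yr.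
rewrite big_mkcond (bigD1_seq (F y))//=; last by rewrite mem_undup map_f.
by rewrite eqxx big1 ?addr0// => v; rewrite eq_sym => /negbTE ->.
Qed.

Lemma simple_integral_lin (a b : R[i]) (g1 g2 : T -> X) :
  is_simple g1 -> is_simple g2 ->
  simple_integral mu (fun t => a *: g1 t + b *: g2 t) =
  a *: simple_integral mu g1 + b *: simple_integral mu g2.
Proof.
move=> s1 s2; have s12 := finite_valued_pair s1 s2.
have [r ur rP] := finite_valued_seq s12.
rewrite (simple_integral_comp (fun x => a *: x.1 + b *: x.2) s12 ur rP).
rewrite (simple_integral_comp (fun x => x.1) s12 ur rP).
rewrite (simple_integral_comp (fun x => x.2) s12 ur rP).
rewrite !scaler_sumr -big_split/=; apply: eq_bigr => y _.
by rewrite scalerDr !scalerA; congr (_ *: _ + _ *: _); rewrite mulrC.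
Qed.

Lemma simple_integralZr (g : T -> R[i]^o) (v : X) : is_simple g ->
  simple_integral mu (fun t => g t *: v) = simple_integral mu g *: v.
Proof.
move=> gs; have [r ur rP] := finite_valued_seq gs.
rewrite (simple_integral_comp (fun c => c *: v) gs ur rP).
rewrite /simple_integral (fsbig_widen _ [set` r]); last 2 first.
- by move=> _ [t _ <-] /=; exact: rP.
- by move=> c [_ nc] /=; rewrite preimage10// (cmeasure0 hmu) scale0r.
by rewrite -fsbig_seq// scaler_suml; apply: eq_bigr => c _; rewrite scalerA.
Qed.

Lemma simple_integral_bound (k : {measure set T -> \bar R}) (g : T -> X) :
  (forall A, measurable A -> ((rnorm (mu A))%:E <= k A)%E) ->
  is_simple g ->
  ((rnorm (simple_integral mu g))%:E <= \int[k]_t (rnorm (g t))%:E)%E.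
Proof.
move=> muk gs; have [r ur rP] := finite_valued_seq gs.
have -> : (\int[k]_t (rnorm (g t))%:E =
    \sum_(v <- r) (rnorm v)%:E * k (g @^-1` [set v]))%E.
  transitivity (\int[k]_t (\sum_(v <- r) (rnorm v * \1_(g @^-1` [set v]) t)%:E))%E.
    apply: eq_integral => t _; rewrite sumEFin; congr (_%:E).
    rewrite (bigD1_seq (g t) (rP t) ur) indicE mem_set// mulr1 big1 => [|v vg].
      by rewrite /= addr0.
    by rewrite indicE memNset ?mulr0//= => gv; rewrite gv eqxx in vg.
  rewrite ge0_integral_sum//; last 2 first.
  - move=> v; apply/measurable_EFinP; apply: measurable_funM => //.
    by apply: measurable_indic; exact: gs.2.
  - by move=> v t _; rewrite lee_fin mulr_ge0 ?rnorm_ge0.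
  apply: eq_bigr => v _; under eq_integral do rewrite EFinM.
  rewrite ge0_integralZl_EFin ?rnorm_ge0//; last first.
    by apply/measurable_EFinP/measurable_indic; exact: gs.2.
  by rewrite integral_indic// ?setIT//; exact: gs.2.
rewrite (simple_integral_comp id gs ur rP).
apply: (@le_trans _ _ (\sum_(v <- r) rnorm (mu (g @^-1` [set v]) *: v))%:E).
  by rewrite lee_fin; exact: rnorm_sum.
rewrite -sumEFin; apply: lee_sum => v _; rewrite rnormZ mulrC EFinM.
by apply: lee_wpmul2l; [rewrite lee_fin rnorm_ge0|apply: muk; exact: gs.2].
Qed.

End simple_integral_theory.

(** The bound [e n + e m] is what the triangle inequality through a common limit in mean produces.
    Completeness is used for real and imaginary parts separately. *)
Lemma complex_cauchy_cvg (R : realType) (u : nat -> R[i]^o) (e : nat -> R) :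
  e @ \oo --> 0 -> (forall n m, rnorm (u n - u m) <= e n + e m) ->
  exists y : R[i]^o, u @ \oo --> y.
Proof.
move=> e0 ue.
have ch (p : R[i] -> R) : (forall z : R[i]^o, `|p z| <= rnorm z) ->
    (forall x y : R[i], p (x - y) = p x - p y) ->
    exists l : R, (fun n => p (u n)) @ \oo --> l.
  move=> pn pB; suff /cauchy_cvgP/cvg_ex[l h] : cauchy ((fun n => p (u n)) @ \oo).
    by exists l.
  apply/cauchyP => eps eps0.
  have [N _ NP] : \forall n \near \oo, `|0 - e n| < eps / 2.
    by move/cvgrPdist_lt : e0; apply; rewrite divr_gt0.
  exists (p (u N)); exists N => // n /= Nn; rewrite /ball/= -pB.
  apply: (le_lt_trans (pn _)); apply: (le_lt_trans (ue _ _)).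
  have := NP _ (leqnn N); have := NP _ Nn; rewrite /= !sub0r !normrN => h1 h2.
  rewrite (splitr eps); apply: ltrD.
    exact: (le_lt_trans (ler_norm _) h2).
  exact: (le_lt_trans (ler_norm _) h1).
have [a ha] := ch _ (@ler_Re_rnorm R) (fun x y => etrans (ReD _ _) (congr1 _ (raddfN (@complex.Re R : Rcomplex R -> R) y))).
have [b hb] := ch _ (@ler_Im_rnorm R) (fun x y => etrans (ImD _ _) (congr1 _ (raddfN (@complex.Im R : Rcomplex R -> R) y))).
by exists (a +i* b); apply/cvg_complexP.
Qed.

Section rounding.
Context (R : realType).

(** The cut-off to 0 outside [[-n, n]] keeps the range finite, while the grid [1 / (n + 1)] makes
    the error uniform inside. *)
Definition rounding (n : nat) (x : R) : R :=
  if `|x| <= n%:R then (Num.floor (x * n.+1%:R))%:~R / n.+1%:R else 0.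

Lemma rounding_close n x : `|x| <= n%:R -> `|x - rounding n x| <= n.+1%:R^-1.
Proof.
move=> xn; rewrite /rounding xn.
have n0 : 0 < n.+1%:R :> R by rewrite ltr0n.
have /andP[h1 h2] := floor_itv (x * n.+1%:R).
rewrite -[X in `|X - _|](mulfK (lt0r_neq0 n0)) -mulrBl normrM.
rewrite [X in _ * X <= _]gtr0_norm ?invr_gt0// ler_piMl ?invr_ge0 ?(ltW n0)//.
rewrite ger0_norm ?subr_ge0// lerBlDr addrC; apply/ltW; apply: (lt_le_trans h2).
by rewrite intrD.
Qed.

Lemma rounding_dist n x : `|x - rounding n x| <= 1 + `|x|.
Proof.
have [xn|xn] := leP `|x| n%:R.
  apply: (le_trans (rounding_close xn)).
  by rewrite (@le_trans _ _ 1) ?lerDl// invf_le1 ?ltr0n// ler1n.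
by rewrite /rounding ifF ?subr0 ?lerDr//; apply/negbTE; rewrite -ltNge.
Qed.

Lemma measurable_rounding n : measurable_fun setT (rounding n).
Proof.
apply: measurable_fun_ifT.
- by apply: measurable_fun_ler => //; exact: measurable_normr.
- apply: measurable_funM => //.
  apply: nondecreasing_measurable => // x y xy.
  by rewrite ler_int le_floor// ler_wpM2r.
- exact: measurable_cst.
Qed.

Lemma finite_rounding n : finite_set (range (rounding n)).
Proof.
pose N := (n * n.+1)%N.+1.
apply: (@sub_finite_set _ _ ((fun m : nat => (m%:R - N%:R : R) / n.+1%:R) @` `I_(N + N).+1)).
  move=> _ [x _ <-] /=; rewrite /rounding; case: ifPn => [xn|_]; last first.
    by exists N; [lia|rewrite subrr mul0r].
  have fN : `|Num.floor (x * n.+1%:R)| <= N%:Z.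
    have [h1 h2] := andP (floor_itv (x * n.+1%:R)).
    have xN : `|x * n.+1%:R| <= (n * n.+1)%:R.
      by rewrite normrM natrM [X in _ * X <= _]ger0_norm// ler_wpM2r.
    move: xN; rewrite ler_norml => /andP[h3 h4].
    rewrite ler_norml; apply/andP; split.
      have : (- (n * n.+1)%N%:Z)%:~R < (Num.floor (x * n.+1%:R) + 1)%:~R :> R.
        by apply: le_lt_trans h2; rewrite mulrNz.
      by rewrite ltr_int /N; lia.
    rewrite -(@ler_int R); apply: (le_trans h1); apply: (le_trans h4).
    by rewrite ler_nat.
  exists (absz (Num.floor (x * n.+1%:R) + N%:Z)); first by move: fN; lia.
  congr (_ / _); rewrite natr_absz ger0_norm; last by move: fN; lia.
  by rewrite intrD addrK.
exact/finite_image/finite_II.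
Qed.

End rounding.

Section simple_approximation.
Context d (T : measurableType d) (R : realType).
Variable f : T -> R[i]^o.
Hypothesis mRe : measurable_fun setT (fun t => complex.Re (f t)).
Hypothesis mIm : measurable_fun setT (fun t => complex.Im (f t)).

Definition simple_approx (n : nat) (t : T) : R[i]^o :=
  rounding n (complex.Re (f t)) +i* rounding n (complex.Im (f t)).

Let finite_valued_rounding n (g : T -> R) : measurable_fun setT g ->
  finite_valued (fun t => rounding n (g t)).
Proof.
move=> mg; split.
  by apply: (sub_finite_set _ (finite_rounding R n)) => _ [t _ <-]; exists (g t).
move=> y; rewrite -[X in measurable X]setTI.
have mr : measurable_fun setT (fun t => rounding n (g t)).
  by apply: measurableT_comp mg; exact: measurable_rounding.
by apply: mr.
Qed.

Lemma is_simple_approx n : is_simple (simple_approx n).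
Proof.
have h := finite_valued_pair (finite_valued_rounding n mRe) (finite_valued_rounding n mIm).
exact: (finite_valued_comp (fun x : R * R => (x.1 +i* x.2 : R[i]^o)) h).
Qed.

Let simple_approx_le n t : rnorm (f t - simple_approx n t) <=
  `|complex.Re (f t) - rounding n (complex.Re (f t))| +
  `|complex.Im (f t) - rounding n (complex.Im (f t))|.
Proof.
apply: (le_trans (rnorm_leD _)).
by rewrite /simple_approx; case: (f t) => a b.
Qed.

Lemma simple_approx_close n t : rnorm (f t) <= n%:R ->
  rnorm (f t - simple_approx n t) <= 2 / n.+1%:R.
Proof.
move=> ftn; apply: (le_trans (simple_approx_le _ _)).
rewrite -[2]/(1 + 1) mulrDl !mul1r lerD// rounding_close//; apply: le_trans ftn.
  exact: ler_Re_rnorm.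
exact: ler_Im_rnorm.
Qed.

Lemma simple_approx_dist n t : rnorm (f t - simple_approx n t) <= 2 + 2 * rnorm (f t).
Proof.
apply: (le_trans (simple_approx_le _ _)).
apply: (le_trans (lerD (rounding_dist _ _) (rounding_dist _ _))).
have h1 := ler_Re_rnorm (f t); have h2 := ler_Im_rnorm (f t).
by lra.
Qed.

Lemma simple_approx_cvg t : simple_approx ^~ t @ \oo --> f t.
Proof.
apply/cvg_rnormP.
apply: (@squeeze_cvgr _ _ _ _ (cst 0) (fun n : nat => 2 * n.+1%:R^-1)).
- near=> n; rewrite rnorm_ge0/= simple_approx_close//.
  by near: n; exact: nbhs_infty_ger.
- exact: cvg_cst.
- rewrite -[X in _ --> X](mulr0 2); apply: cvgMr; exact: cvg_harmonic.
Unshelve. all: by end_near. Qed.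

End simple_approximation.

Section bochner_theory.
Context d (T : measurableType d) (R : realType).
Variables (mu : set T -> R[i]^o) (hmu : complex_measure mu).
Variable k : {finite_measure set T -> \bar R}.
Hypothesis muk : forall A, measurable A -> ((rnorm (mu A))%:E <= k A)%E.
Hypothesis kmu : forall A, measurable A -> (k A <= 4%:E * total_variation mu A)%E.

Let tvk A : measurable A -> (total_variation mu A <= k A)%E.
Proof. by move=> mA; apply: total_variation_le => // B mB _; exact: muk. Qed.

Let tv_ge0 A : measurable A -> (0 <= total_variation mu A)%E.
Proof.
move=> mA; apply: (le_trans _ (total_variation_ge mu mA mA (fun t At => At))).
by rewrite lee_fin rnorm_ge0.
Qed.

Let tv0 : total_variation mu set0 = 0%E.
Proof.
by apply/eqP; rewrite eq_le tv_ge0// andbT; apply: (le_trans (tvk _)); rewrite ?measure0.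
Qed.

Definition strongly_measurable (X : normedModType R[i]) (f : T -> X) :=
  exists2 g : nat -> T -> X, (forall n, is_simple (g n)) &
    forall t, g ^~ t @ \oo --> f t.

Lemma strongly_measurable_rnorm (X : normedModType R[i]) (f : T -> X) :
  strongly_measurable f -> measurable_fun setT (fun t => rnorm (f t)).
Proof.
move=> [g gs gf]; apply: (@measurable_fun_cvg _ _ _ _ (fun n t => rnorm (g n t))).
  by move=> n; apply: (finite_valued_measurable (@rnorm R X)); exact: gs.
by move=> t _; apply: cvg_rnorm; exact: gf.
Qed.

Lemma is_simple_lin (X : normedModType R[i]) (a b : R[i]) (f g : T -> X) :
  is_simple f -> is_simple g -> is_simple (fun t => a *: f t + b *: g t).
Proof.
move=> fs gs.
exact: (finite_valued_comp (fun x : X * X => a *: x.1 + b *: x.2) (finite_valued_pair fs gs)).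
Qed.

Lemma strongly_measurable_lin (X : normedModType R[i]) (a b : R[i]) (f g : T -> X) :
  strongly_measurable f -> strongly_measurable g ->
  strongly_measurable (fun t => a *: f t + b *: g t).
Proof.
move=> [f' fs ff] [g' gs gg]; exists (fun n t => a *: f' n t + b *: g' n t).
  by move=> n; exact: is_simple_lin.
by move=> t; apply: cvgD; apply: cvgZr; [exact: ff|exact: gg].
Qed.

Lemma is_simple_strongly_measurable (X : normedModType R[i]) (f : T -> X) :
  is_simple f -> strongly_measurable f.
Proof. by move=> fs; exists (fun=> f) => // t; exact: cvg_cst. Qed.

Lemma strongly_measurableB (X : normedModType R[i]) (f g : T -> X) :
  strongly_measurable f -> strongly_measurable g ->
  strongly_measurable (fun t => f t - g t).
Proof.
move=> hf hg; have := strongly_measurable_lin 1 (-1) hf hg.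
by under eq_fun do rewrite scale1r scaleN1r.
Qed.

Lemma measurable_dist (X : normedModType R[i]) (f g : T -> X) :
  strongly_measurable f -> strongly_measurable g ->
  measurable_fun setT (fun t => (rnorm (f t - g t))%:E).
Proof.
move=> hf hg; apply/measurable_EFinP.
exact: strongly_measurable_rnorm (strongly_measurableB hf hg).
Qed.

Lemma le_integral_dist (X : normedModType R[i]) (f g h : T -> X) :
  strongly_measurable f -> strongly_measurable g -> strongly_measurable h ->
  (\int[k]_t (rnorm (f t - h t))%:E <=
    \int[k]_t (rnorm (f t - g t))%:E + \int[k]_t (rnorm (g t - h t))%:E)%E.
Proof.
move=> hf hg hh; rewrite -ge0_integralD//=.
- apply: ge0_le_integral => //.
  + by move=> t _; rewrite lee_fin rnorm_ge0.
  + exact: measurable_dist.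
  + by apply: emeasurable_funD; exact: measurable_dist.
  + by move=> t _; rewrite -EFinD lee_fin rnorm_triangle.
- by move=> t _; rewrite lee_fin rnorm_ge0.
- exact: measurable_dist.
- by move=> t _; rewrite lee_fin rnorm_ge0.
- exact: measurable_dist.
Qed.

(** Since [total_variation mu <= k <= 4 * total_variation mu], convergence in mean is the same for
    both; from here on estimates use the measure [k]. *)
Lemma is_bochner_integralP (X : normedModType R[i]) (f : T -> X) (y : X) :
  is_bochner_integral mu f y <-> exists g : nat -> T -> X,
    [/\ forall n, is_simple (g n),
        forall t, (fun n => g n t) @ \oo --> f t,
        (fun n => \int[k]_t (rnorm (f t - g n t))%:E)%E @ \oo --> (0 : \bar R)%E
      & (fun n => simple_integral mu (g n)) @ \oo --> y].
Proof.
split=> -[g [gs gf h gy]]; exists g; split => //.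
- apply: (@squeeze_cvge _ _ _ _ (cst 0%E) _
      (fun n => 4%:E * \int[total_variation mu]_t (rnorm (f t - g n t))%:E)%E).
  + apply: nearW => n; apply/andP; split.
      by apply: integral_ge0 => t _; rewrite lee_fin rnorm_ge0.
    apply: le_integral_set_function => //.
    by move=> t; rewrite lee_fin rnorm_ge0.
  + exact: cvg_cst.
  + by rewrite -[X in _ --> X](mule0 4%:E); apply: cvgeZl.
- apply: (@squeeze_cvge _ _ _ _ (cst 0%E) _
      (fun n => \int[k]_t (rnorm (f t - g n t))%:E)%E) => //.
  + apply: nearW => n; apply/andP; split.
      (* The integral against a mere set function is shown to be nonnegative by comparison with the
         zero measure. *)
      have := @le_integral_set_function _ _ _ (@mzero _ T R) (total_variation mu) 1
        (fun t => (rnorm (f t - g n t))%:E) ler01.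
      rewrite integral_measure_zero mul1e; apply => //.
      - by move=> A mA; rewrite mul1e; exact: tv_ge0.
      - by move=> t; rewrite lee_fin rnorm_ge0.
    rewrite -[leRHS]mul1e; apply: le_integral_set_function => //.
      by move=> A mA; rewrite mul1e; exact: tvk.
    by move=> t; rewrite lee_fin rnorm_ge0.
  + exact: cvg_cst.
Qed.

Lemma simple_integralB (X : normedModType R[i]) (f g : T -> X) :
  is_simple f -> is_simple g ->
  ((rnorm (simple_integral mu f - simple_integral mu g))%:E <=
    \int[k]_t (rnorm (f t - g t))%:E)%E.
Proof.
move=> fs gs; have := simple_integral_lin hmu 1 (-1) fs gs.
under eq_fun do rewrite scale1r scaleN1r.
rewrite scale1r scaleN1r => <-; apply: (simple_integral_bound hmu muk).
by have := is_simple_lin 1 (-1) fs gs; under eq_fun do rewrite scale1r scaleN1r.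
Qed.

(** The estimate passes from simple functions to the limit by the triangle inequality in mean. It is
    the source of uniqueness, of norm bounds (against the integrand 0) and of limit theorems. *)
Lemma is_bochner_integral_dist (X : normedModType R[i]) (f f' : T -> X) (y y' : X) :
  is_bochner_integral mu f y -> is_bochner_integral mu f' y' ->
  ((rnorm (y - y'))%:E <= \int[k]_t (rnorm (f t - f' t))%:E)%E.
Proof.
move=> /is_bochner_integralP[g [gs gf gI gy]] /is_bochner_integralP[g' [gs' gf' gI' gy']].
have sf : strongly_measurable f by exists g.
have sf' : strongly_measurable f' by exists g'.
have sg n : strongly_measurable (g n) by exact: is_simple_strongly_measurable.
have sg' n : strongly_measurable (g' n) by exact: is_simple_strongly_measurable.
set I := (\int[k]_t _)%E.
pose u n := (rnorm (simple_integral mu (g n) - simple_integral mu (g' n)))%:E.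
pose v n := ((\int[k]_t (rnorm (f t - g n t))%:E + I) +
  \int[k]_t (rnorm (f' t - g' n t))%:E)%E.
have I0 : (0 <= I)%E by apply: integral_ge0 => t _; rewrite lee_fin rnorm_ge0.
have uv n : (u n <= v n)%E.
  apply: (le_trans (simple_integralB (gs n) (gs' n))).
  apply: (le_trans (le_integral_dist (sg n) sf' (sg' n))).
  apply: leeD => //.
  apply: (le_trans (le_integral_dist (sg n) sf sf')).
  by rewrite leeD2r//; under eq_integral do rewrite rdistC.
have cu : u @ \oo --> (rnorm (y - y'))%:E.
  by apply/cvgE; apply: cvg_rnorm; exact: cvgB.
have cv : v @ \oo --> I.
  rewrite -[X in _ --> X]adde0; apply: cvgeD => //.
    by rewrite ge0_adde_def// inE.
  rewrite -[X in _ --> X]add0e; apply: cvgeD => //; exact: cvg_cst.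
rewrite -(cvg_lim _ cu)// -(cvg_lim _ cv)//.
by apply: lee_lim; [exact: cvgP cu|exact: cvgP cv|exact: nearW].
Qed.

Lemma is_bochner_integral_uniq (X : normedModType R[i]) (f : T -> X) (y y' : X) :
  is_bochner_integral mu f y -> is_bochner_integral mu f y' -> y = y'.
Proof.
move=> h h'; apply/eqP; rewrite -subr_eq0 -rnorm_eq0 eq_le rnorm_ge0 andbT.
rewrite -lee_fin; apply: (le_trans (is_bochner_integral_dist h h')).
by under eq_integral do rewrite subrr rnorm0; rewrite integral0.
Qed.

Lemma bochnerE (X : normedModType R[i]) (f : T -> X) (y : X) :
  is_bochner_integral mu f y -> bochner mu f = y.
Proof.
move=> h; apply: (@is_bochner_integral_uniq _ f) => //.
by apply: (xgetPex (0 : X)); exists y.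
Qed.

End bochner_theory.

Section bochner_lin.
Context d (T : measurableType d) (R : realType).
Variables (mu : set T -> R[i]^o) (hmu : complex_measure mu).
Variable k : {finite_measure set T -> \bar R}.
Hypothesis muk : forall A, measurable A -> ((rnorm (mu A))%:E <= k A)%E.
Hypothesis kmu : forall A, measurable A -> (k A <= 4%:E * total_variation mu A)%E.

Local Notation bochnerP := (is_bochner_integralP muk kmu).

Lemma is_bochner_strongly_measurable (X : normedModType R[i]) (f : T -> X) y :
  is_bochner_integral mu f y -> strongly_measurable f.
Proof. by move=> [g [gs gf _ _]]; exists g. Qed.

Lemma is_bochner_integral_lin (X : normedModType R[i]) (a b : R[i])
    (f f' : T -> X) (y y' : X) :
  is_bochner_integral mu f y -> is_bochner_integral mu f' y' ->
  is_bochner_integral mu (fun t => a *: f t + b *: f' t) (a *: y + b *: y').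
Proof.
move=> /bochnerP[g [gs gf gI gy]] /bochnerP[g' [gs' gf' gI' gy']].
have sf : strongly_measurable f by exists g.
have sf' : strongly_measurable f' by exists g'.
apply/bochnerP; exists (fun n t => a *: g n t + b *: g' n t); split.
- by move=> n; exact: is_simple_lin.
- by move=> t; apply: cvgD; apply: cvgZr; [exact: gf|exact: gf'].
- pose na := rnorm (a : R[i]^o); pose nb := rnorm (b : R[i]^o).
  apply: (@squeeze_cvge _ _ _ _ (cst 0%E) _
    (fun n => na%:E * \int[k]_t (rnorm (f t - g n t))%:E +
      nb%:E * \int[k]_t (rnorm (f' t - g' n t))%:E)%E).
  + apply: nearW => n; apply/andP; split.
      by apply: integral_ge0 => t _; rewrite lee_fin rnorm_ge0.
    have m1 := measurable_dist sf (is_simple_strongly_measurable (gs n)).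
    have m2 := measurable_dist sf' (is_simple_strongly_measurable (gs' n)).
    have p1 t : (0 <= (rnorm (f t - g n t))%:E)%E by rewrite lee_fin rnorm_ge0.
    have p2 t : (0 <= (rnorm (f' t - g' n t))%:E)%E by rewrite lee_fin rnorm_ge0.
    rewrite -!ge0_integralZl_EFin ?rnorm_ge0// -ge0_integralD//; last 4 first.
    * by move=> t _; rewrite mule_ge0// lee_fin rnorm_ge0.
    * exact: measurable_funeM.
    * by move=> t _; rewrite mule_ge0// lee_fin rnorm_ge0.
    * exact: measurable_funeM.
    apply: ge0_le_integral => //.
    * by move=> t _; rewrite lee_fin rnorm_ge0.
    * apply: measurable_dist; first exact: strongly_measurable_lin.
      exact: is_simple_strongly_measurable (is_simple_lin _ _ (gs n) (gs' n)).
    * by apply: emeasurable_funD; exact: measurable_funeM.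
    * move=> t _; rewrite -!EFinM -EFinD lee_fin opprD addrACA -!scalerBr.
      by apply: (le_trans (rnormD _ _)); rewrite !rnormZ.
  + exact: cvg_cst.
  + rewrite -[X in _ --> X]adde0 -[X in (X + _)%E](mule0 na%:E) -[X in (_ + X)%E](mule0 nb%:E).
    by apply: cvgeD; [rewrite !mule0|exact: cvgeZl|exact: cvgeZl].
- rewrite (_ : (fun n => _) = (fun n => a *: simple_integral mu (g n) +
      b *: simple_integral mu (g' n))); last first.
    by apply/funext => n; rewrite (simple_integral_lin hmu).
  by apply: cvgD; apply: cvgZr; [exact: gy|exact: gy'].
Qed.

Lemma is_bochner_integralZr (X : normedModType R[i]) (f : T -> R[i]^o) (c : R[i]^o) (v : X) :
  is_bochner_integral mu f c -> is_bochner_integral mu (fun t => f t *: v) (c *: v).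
Proof.
move=> /bochnerP[g [gs gf gI gy]].
have sf : strongly_measurable f by exists g.
apply/bochnerP; exists (fun n t => g n t *: v); split.
- by move=> n; apply: (finite_valued_comp (fun z : R[i]^o => z *: v)); exact: gs.
- by move=> t; apply: cvgZl; exact: gf.
- rewrite (_ : (fun n => _) = (fun n => (rnorm v)%:E * \int[k]_t (rnorm (f t - g n t))%:E)%E).
    by rewrite -[X in _ --> X](mule0 (rnorm v)%:E); exact: cvgeZl.
  apply/funext => n; rewrite -ge0_integralZl_EFin ?rnorm_ge0//.
  + by apply: eq_integral => t _; rewrite -EFinM -scalerBl rnormZ mulrC.
  + by move=> t _; rewrite lee_fin rnorm_ge0.
  + exact: measurable_dist sf (is_simple_strongly_measurable (gs n)).
- rewrite (_ : (fun n => _) = (fun n => simple_integral mu (g n) *: v)); last first.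
    by apply/funext => n; rewrite (simple_integralZr hmu).
  by apply: cvgZl; exact: gy.
Qed.

Lemma is_bochner_integral0 (X : normedModType R[i]) :
  is_bochner_integral mu (fun=> 0 : X) 0.
Proof.
apply/bochnerP; exists (fun _ _ => 0); split.
- move=> n; split.
    by apply: (sub_finite_set _ (finite_set1 (0 : X))) => _ [t _ <-].
  by move=> v; rewrite preimage_cst; case: ifP.
- by move=> t; exact: cvg_cst.
- rewrite (_ : (fun n => _) = cst 0%E); first exact: cvg_cst.
  by apply/funext => n; under eq_integral do rewrite subr0 rnorm0; rewrite integral0.
- rewrite (_ : (fun n => _) = cst 0); first exact: cvg_cst.
  apply/funext => n; rewrite /simple_integral fsbig1// => _ [t _ <-].
  by rewrite scaler0.
Qed.

Lemma is_bochner_integral_sum (X : normedModType R[i]) (I : Type) (r : seq I)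
    (f : I -> T -> X) (y : I -> X) :
  (forall i, is_bochner_integral mu (f i) (y i)) ->
  is_bochner_integral mu (fun t => \sum_(i <- r) f i t) (\sum_(i <- r) y i).
Proof.
move=> h; elim: r => [|i r ih].
  by under eq_fun do rewrite big_nil; rewrite big_nil; exact: is_bochner_integral0.
rewrite big_cons; under eq_fun do rewrite big_cons.
by have := is_bochner_integral_lin 1 1 (h i) ih; under eq_fun do rewrite !scale1r;
  rewrite !scale1r.
Qed.

Definition cmeasurable (f : T -> R[i]) :=
  measurable_fun setT (fun t => complex.Re (f t)) /\
  measurable_fun setT (fun t => complex.Im (f t)).

Lemma cmeasurable_strongly (f : T -> R[i]^o) : cmeasurable f -> strongly_measurable f.
Proof.
move=> [m1 m2]; exists (simple_approx f); first by move=> n; exact: is_simple_approx.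
by move=> t; exact: simple_approx_cvg.
Qed.

(** The error of the roundings is dominated by [2 + 2 |f|], integrable because [k] is finite. So
    they converge in mean, and their integrals are Cauchy in the complete space [R[i]]. *)
Lemma is_bochner_integral_ex (f : T -> R[i]^o) : cmeasurable f ->
  (\int[k]_t (rnorm (f t))%:E < +oo)%E -> exists c, is_bochner_integral mu f c.
Proof.
move=> mf fk; have [m1 m2] := mf; have sf := cmeasurable_strongly mf.
pose g := simple_approx f.
have gs n : is_simple (g n) by exact: is_simple_approx.
have mg n : measurable_fun setT (fun t => (rnorm (f t - g n t))%:E).
  exact: measurable_dist sf (is_simple_strongly_measurable (gs n)).
have mn : measurable_fun setT (fun t => (rnorm (f t))%:E).
  by apply/measurable_EFinP; exact: strongly_measurable_rnorm.
have h : (fun n => \int[k]_t (rnorm (f t - g n t))%:E)%E @ \oo --> (0 : \bar R)%E.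
  have p1 : {ae k, forall t, setT t -> (rnorm (f t - g n t))%:E @[n --> \oo] --> cst 0%E t}.
    apply: aeW => t _; have /cvg_rnormP/cvgE := @simple_approx_cvg d T R f t; exact.
  have p2 : k.-integrable setT (fun t => (2 + 2 * rnorm (f t))%:E).
    apply/integrableP; split.
      apply/measurable_EFinP; apply: measurable_funD => //.
      by apply: measurable_funM => //; exact/measurable_EFinP.
    under eq_integral do rewrite /= ger0_norm ?addr_ge0 ?mulr_ge0 ?rnorm_ge0// EFinD EFinM.
    rewrite ge0_integralD//; last 2 first.
    + by move=> t _; rewrite -EFinM lee_fin mulr_ge0 ?rnorm_ge0.
    + exact: measurable_funeM.
    rewrite integral_cst// ge0_integralZl_EFin//; last first.
      by move=> t _; rewrite lee_fin rnorm_ge0.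
    rewrite lte_add_pinfty// lte_mul_pinfty//.
    by rewrite -ge0_fin_numE// fin_num_measure.
  have p3 : {ae k, forall t n, setT t -> `|(rnorm (f t - g n t))%:E| <= (2 + 2 * rnorm (f t))%:E}%E.
    apply: aeW => t n _; rewrite gee0_abs ?lee_fin ?rnorm_ge0//.
    exact: simple_approx_dist.
  have [_ _] := dominated_convergence measurableT mg (measurable_cst _) p1 p2 p3.
  by rewrite integral0.
have [y hy] : exists y : R[i]^o, (fun n => simple_integral mu (g n)) @ \oo --> y.
  have /fine_cvgP[[N _ NP] hf] := h.
  (* [fine_cvgP] guarantees real values of the mean distances only from [N] on. *)
  suff [y hy] : exists y : R[i]^o, (fun n => simple_integral mu (g (n + N)%N)) @ \oo --> y.
    by exists y; rewrite -(cvg_shiftn N).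
  apply: (@complex_cauchy_cvg _ _ (fun n => fine (\int[k]_t (rnorm (f t - g (n + N)%N t))%:E)%E)).
    by rewrite (cvg_shiftn N (fun n => fine (\int[k]_t (rnorm (f t - g n t))%:E)%E)).
  move=> n m; rewrite -lee_fin EFinD !fineK; last 2 first.
  - by apply: NP; exact: leq_addl.
  - by apply: NP; exact: leq_addl.
  apply: (le_trans (simple_integralB hmu muk (gs _) (gs _))).
  apply: (le_trans (le_integral_dist k (is_simple_strongly_measurable (gs _)) sf
    (is_simple_strongly_measurable (gs _)))).
  by rewrite leeD2r//; under eq_integral do rewrite rdistC.
exists y; apply/bochnerP; exists g; split; [exact: gs| |exact: h|exact: hy].
by move=> t; exact: (@simple_approx_cvg d T R f t).
Qed.

End bochner_lin.

(** * Rotation invariance of Gaussian families *)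

Section lebesgue_shear.
Local Open Scope ereal_scope.
Context (R : realType).
Local Notation lambda := (@lebesgue_measure R).
Local Notation RR := (measurableTypeR R).

(** The image of Lebesgue measure under the translation agrees with it on half-open intervals, hence
    on all measurable sets. *)
Lemma ge0_integral_translation (f : R -> \bar R) (a : R) :
  measurable_fun setT f -> (forall x, 0 <= f x) ->
  \int[lambda]_x f (x + a)%R = \int[lambda]_x f x.
Proof.
move=> mf f0.
have ma : measurable_fun [set: RR] ((fun x : R => x + a)%R : RR -> RR).
  exact: measurable_funD.
pose g : {mfun RR >-> RR} :=
  HB.pack ((fun x : R => x + a)%R : RR -> RR) (isMeasurableFun.Build _ _ _ _ _ ma).
have E A : measurable A -> lambda A = pushforward lambda g A.
  move=> mA; apply: lebesgue_measure_unique => //= _ [[u v]] _ <-.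
  rewrite /pushforward (_ : _ @^-1` _ = `](u - a)%R, (v - a)%R]%classic); last first.
    by apply/seteqP; split => x /=; rewrite !in_itv/= ltrBlDr lerBrDr.
  rewrite !lebesgue_measure_itv/= !lte_fin ltrD2r; case: ifPn => // _.
  by rewrite -!EFinB opprB addrA subrK.
transitivity (\int[pushforward lambda g]_x f x).
  by rewrite ge0_integral_pushforward.
by apply: eq_measure_integral => A mA _; exact/esym/E.
Qed.

Local Notation lambda2 := (lambda \x lambda).

Lemma ge0_integral_shear1 (f : RR * RR -> \bar R) (t : R) :
  measurable_fun setT f -> (forall x, 0 <= f x) ->
  \int[lambda2]_z f ((z.1 : R) + t * z.2, z.2)%R = \int[lambda2]_z f z.
Proof.
move=> mf f0.
have mh : measurable_fun setT (fun z : RR * RR => ((z.1 : R) + t * z.2, z.2)%R).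
  apply: measurable_fun_pair; last exact: measurable_snd.
  by apply: measurable_funD => //; apply: measurable_funM.
rewrite (fubini_tonelli2 (fun z : RR * RR => f ((z.1 : R) + t * z.2, z.2)%R))//; last first.
  exact: measurableT_comp mf mh.
rewrite fubini_tonelli2//; apply: eq_integral => y _.
rewrite /fubini_G/= (@ge0_integral_translation (fun x => f (x, y)))//.
exact: measurableT_comp mf (measurable_pair2 y).
Qed.

Lemma ge0_integral_shear2 (f : RR * RR -> \bar R) (t : R) :
  measurable_fun setT f -> (forall x, 0 <= f x) ->
  \int[lambda2]_z f (z.1, (z.2 : R) + t * z.1)%R = \int[lambda2]_z f z.
Proof.
move=> mf f0.
have mh : measurable_fun setT (fun z : RR * RR => (z.1, (z.2 : R) + t * z.1)%R).
  apply: measurable_fun_pair; first exact: measurable_fst.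
  by apply: measurable_funD => //; apply: measurable_funM.
rewrite (fubini_tonelli1 (fun z : RR * RR => f (z.1, (z.2 : R) + t * z.1)%R))//; last first.
  exact: measurableT_comp mf mh.
rewrite fubini_tonelli1//; apply: eq_integral => x _.
rewrite /fubini_F/= (@ge0_integral_translation (fun y => f (x, y)))//.
exact: measurableT_comp mf (measurable_pair1 x).
Qed.

(* A planar rotation with s != 0 is a product of three shears. *)
Lemma ge0_integral_rotation (f : RR * RR -> \bar R) (c s : R) :
  (c ^+ 2 + s ^+ 2 = 1)%R -> s != 0%R ->
  measurable_fun setT f -> (forall x, 0 <= f x) ->
  \int[lambda2]_z f (c * z.1 - s * z.2, s * z.1 + c * z.2)%R = \int[lambda2]_z f z.
Proof.
(* The shears by [t], [s], [t] compose to the rotation because [1 + t * s = c] and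
   [t * (1 + c) = - s]. *)
move=> cs1 s0 mf f0; pose t := ((c - 1) / s)%R.
rewrite -[RHS](ge0_integral_shear1 t)//.
pose f1 (z : RR * RR) := f ((z.1 : R) + t * z.2, z.2)%R.
have mf1 : measurable_fun setT f1.
  apply: measurableT_comp mf _; apply: measurable_fun_pair; last exact: measurable_snd.
  by apply: measurable_funD => //; apply: measurable_funM.
rewrite -[RHS](@ge0_integral_shear2 f1 s)//; last by move=> x; exact: f0.
pose f2 (z : RR * RR) := f1 (z.1, (z.2 : R) + s * z.1)%R.
have mf2 : measurable_fun setT f2.
  apply: measurableT_comp mf1 _; apply: measurable_fun_pair; first exact: measurable_fst.
  by apply: measurable_funD => //; apply: measurable_funM.
rewrite -[RHS](@ge0_integral_shear1 f2 t)//; last by move=> x; exact: f0.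
apply: eq_integral => -[x y] _; rewrite /f2 /f1 /t/=; congr f.
have hs : (t * s = c - 1)%R by rewrite /t divfK.
have ht : (t * (1 + c) = - s)%R.
  apply: (mulIf s0); rewrite mulrAC hs.
  have -> : (- s * s = c ^+ 2 - (c ^+ 2 + s ^+ 2))%R by ring.
  by rewrite cs1; ring.
congr (_, _).
  transitivity ((1 + t * s) * x + (t * (1 + (1 + t * s))) * y)%R.
    by rewrite hs (_ : 1 + (c - 1) = c)%R ?ht; ring.
  by rewrite -/t; ring.
transitivity (s * x + (1 + t * s) * y)%R; first by rewrite hs; ring.
by rewrite -/t; ring.
Qed.

End lebesgue_shear.

Section gaussian_rotation.
Local Open Scope ereal_scope.
Context (R : realType) (sigma : R).
Hypothesis sigma0 : sigma != 0%R.
Local Notation lambda := (@lebesgue_measure R).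
Local Notation RR := (measurableTypeR R).
Local Notation rho := (normal_pdf 0 sigma).

Definition normal_pdf2 (z : RR * RR) : \bar R := (rho z.1 * rho z.2)%:E.

Let normal_pdf2_ge0 z : 0 <= normal_pdf2 z.
Proof. by rewrite lee_fin mulr_ge0// normal_pdf_ge0. Qed.

Let measurable_normal_pdf2 D : measurable_fun D normal_pdf2.
Proof.
apply: measurable_funTS; apply/measurable_EFinP; apply: measurable_funM.
  exact: measurableT_comp (measurable_normal_pdf 0 sigma) measurable_fst.
exact: measurableT_comp (measurable_normal_pdf 0 sigma) measurable_snd.
Qed.

Definition normal_prob2 (E : set (RR * RR)) : \bar R :=
  \int[lambda \x lambda]_(z in E) normal_pdf2 z.

Let normal_prob2_0 : normal_prob2 set0 = 0.
Proof. by rewrite /normal_prob2 integral_set0. Qed.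

Let normal_prob2_ge0 E : 0 <= normal_prob2 E.
Proof. by apply: integral_ge0. Qed.

Let normal_prob2_sigma_additive : semi_sigma_additive normal_prob2.
Proof.
move=> F mF tF mUF; rewrite /normal_prob2 ge0_integral_bigcup//.
by apply: is_cvg_ereal_nneg_natsum_cond => n _ _; exact: integral_ge0.
Qed.

HB.instance Definition _ := isMeasure.Build _ _ _ normal_prob2
  normal_prob2_0 normal_prob2_ge0 normal_prob2_sigma_additive.

Lemma normal_prob2_setX (A B : set RR) : measurable A -> measurable B ->
  normal_prob2 (A `*` B) = normal_prob 0 sigma A * normal_prob 0 sigma B.
Proof.
move=> mA mB; rewrite /normal_prob2 integral_mkcond.
pose f (z : RR * RR) := (rho z.1 * \1_A z.1 * (rho z.2 * \1_B z.2))%:E.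
have m1 (C : set RR) : measurable C -> measurable_fun [set: RR] (fun x => rho x * \1_C x)%R.
  move=> mC; apply: measurable_funM; first exact: measurable_normal_pdf.
  exact: measurable_indic.
have -> : normal_pdf2 \_ (A `*` B) = f.
  apply/funext => -[x y]; rewrite /patch /f/= !indicE in_setX/=.
  by case: (x \in A); case: (y \in B); rewrite /= ?mulr1 ?mulr0 ?mul0r.
rewrite fubini_tonelli1; last 2 first.
- apply/measurable_EFinP; apply: measurable_funM.
    by apply: measurableT_comp (m1 _ mA) measurable_fst.
  by apply: measurableT_comp (m1 _ mB) measurable_snd.
- by move=> z; rewrite lee_fin !mulr_ge0 ?normal_pdf_ge0.
have E C : measurable C -> \int[lambda]_x (rho x * \1_C x)%:E = normal_prob 0 sigma C.
  move=> mC; rewrite /normal_prob [RHS]integral_mkcond; apply: eq_integral => x _.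
  by rewrite patchE indicE; case: (x \in C); rewrite ?mulr1 ?mulr0.
rewrite /fubini_F /f/=.
transitivity (\int[lambda]_x ((rho x * \1_A x)%:E * normal_prob 0 sigma B)).
  apply: eq_integral => x _; under eq_integral do rewrite EFinM.
  rewrite ge0_integralZl_EFin//; first by rewrite E.
  - by move=> y _; rewrite lee_fin mulr_ge0// normal_pdf_ge0.
  - by apply/measurable_EFinP; exact: m1.
  - by rewrite mulr_ge0// normal_pdf_ge0.
rewrite ge0_integralZr//; first by rewrite E.
- by apply/measurable_EFinP; exact: m1.
- by move=> x _; rewrite lee_fin mulr_ge0// normal_pdf_ge0.
Qed.

Lemma normal_pdf2_rotation (c s x y : R) : (c ^+ 2 + s ^+ 2 = 1)%R ->
  normal_pdf2 (c * x - s * y, s * x + c * y)%R = normal_pdf2 (x, y).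
Proof.
move=> cs1; rewrite /normal_pdf2 normal_pdfE//; congr (_%:E).
rewrite /normal_fun /= [LHS]mulrACA [RHS]mulrACA -!expRD.
congr (_ * expR _)%R; rewrite !subr0 -!mulrDl; congr (_ / _)%R.
transitivity (- ((c ^+ 2 + s ^+ 2) * (x ^+ 2 + y ^+ 2)))%R; first by ring.
by rewrite cs1; ring.
Qed.

Lemma measurable_rotation (c s : R) : measurable_fun [set: RR * RR]
  (fun z : RR * RR => ((c * z.1 - s * z.2)%R, (s * z.1 + c * z.2)%R) : RR * RR).
Proof.
apply: measurable_fun_pair.
  by apply: measurable_funB; apply: measurable_funM.
by apply: measurable_funD; apply: measurable_funM.
Qed.

Lemma normal_prob2_rotation (c s : R) (E : set (RR * RR)) :
  (c ^+ 2 + s ^+ 2 = 1)%R -> s != 0%R -> measurable E ->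
  normal_prob2 ((fun z : RR * RR => ((c * z.1 - s * z.2)%R, (s * z.1 + c * z.2)%R)) @^-1` E)
  = normal_prob2 E.
Proof.
move=> cs1 s0 mE; rewrite /normal_prob2 !(integral_mkcond _ normal_pdf2).
transitivity (\int[lambda \x lambda]_z
    (normal_pdf2 \_ E) ((c * (z.1 : R) - s * z.2)%R, (s * (z.1 : R) + c * z.2)%R)).
  apply: eq_integral => -[x y] _.
  by rewrite /patch normal_pdf2_rotation.
apply: (@ge0_integral_rotation R (normal_pdf2 \_ E) c s) => //.
- by apply/(measurable_restrictT _ mE); exact: measurable_normal_pdf2.
- by move=> z; apply: erestrict_ge0 => t _.
Qed.

(** The product of two equal centred normal laws has the radial density [normal_pdf2], and planar
    Lebesgue measure is rotation invariant. *)
Lemma normal_prob_product_rotation (c s : R) (A B : set RR) :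
  (c ^+ 2 + s ^+ 2 = 1)%R -> s != 0%R -> measurable A -> measurable B ->
  (normal_prob 0 sigma \x normal_prob 0 sigma)
    [set z : RR * RR | A (c * z.1 - s * z.2)%R /\ B (s * z.1 + c * z.2)%R] =
  normal_prob 0 sigma A * normal_prob 0 sigma B.
Proof.
move=> cs1 s0 mA mB.
have mE : measurable [set z : RR * RR | A (c * z.1 - s * z.2)%R /\ B (s * z.1 + c * z.2)%R].
  rewrite (_ : [set z | _] =
     (fun z : RR * RR => ((c * z.1 - s * z.2)%R, (s * z.1 + c * z.2)%R)) @^-1` (A `*` B))//.
  rewrite -[X in measurable X]setTI; apply: measurable_rotation => //.
  exact: measurableX.
rewrite (@product_measure_unique _ _ _ _ _ _ _ normal_prob2)//; last first.
  by move=> C D mC mD; exact: normal_prob2_setX.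
rewrite -normal_prob2_setX// -(normal_prob2_rotation cs1 s0)//.
exact: measurableX.
Qed.

End gaussian_rotation.

Section gaussian_family.
Local Open Scope ereal_scope.
Context (R : realType) (d : measure_display) (Om : measurableType d).
Variables (P : probability Om R) (sigma : R).
Hypothesis sigma0 : sigma != 0%R.
Variable I : finType.
Local Notation N := (normal_prob 0%R sigma).
Local Notation RR := (measurableTypeR R).

(** Independence and the common normal law are combined in one condition on rectangles, the form
    that is stable under a rotation of two coordinates. *)
Definition gaussian_family (xi : I -> Om -> R) :=
  (forall i, measurable_fun setT (xi i)) /\
  forall B : I -> set R, (forall i, measurable (B i)) ->
    P [set w | forall i, B i (xi i w)] = (\prod_i fine (N (B i)))%:E.

Definition rotate_family (a b : I) (c s : R) (xi : I -> Om -> R) (i : I) (w : Om) : R :=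
  if i == a then (c * xi a w - s * xi b w)%R else
  if i == b then (s * xi a w + c * xi b w)%R else xi i w.

(** Freeze the other coordinates in the events [B i]. On that part of the space the pair
    [(xi a, xi b)] is distributed as a multiple of the product of two normal laws, which the
    rotation preserves. *)
Lemma gaussian_family_rotate (a b : I) (c s : R) (xi : I -> Om -> R) :
  a != b -> (c ^+ 2 + s ^+ 2 = 1)%R -> s != 0%R ->
  gaussian_family xi -> gaussian_family (rotate_family a b c s xi).
Proof.
move=> ab cs1 s0 [mxi xiN]; split.
  move=> i; rewrite /rotate_family; case: (i == a).
    by apply: measurable_funB; apply: measurable_funM.
  by case: (i == b) => //; apply: measurable_funD; apply: measurable_funM.
move=> B mB.
pose B' A1 A2 i := if i == a then A1 else if i == b then A2 else B i.
have mB' A1 A2 : measurable A1 -> measurable A2 -> forall i, measurable (B' A1 A2 i).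
  by move=> m1 m2 i; rewrite /B'; case: ifP => // _; case: ifP.
pose q : R := (\prod_(i | (i != a) && (i != b)) fine (N (B i)))%R.
have prodB' A1 A2 : (\prod_i fine (N (B' A1 A2 i)) = fine (N A1) * fine (N A2) * q)%R.
  rewrite (bigD1 a)//= (bigD1 b)//=; last by rewrite eq_sym.
  rewrite mulrA /B' !eqxx eq_sym (negbTE ab); congr (_ * _)%R.
  by apply: eq_bigr => i /andP[/negbTE -> /negbTE ->].
pose E0 := [set w | forall i, B' setT setT i (xi i w)].
have mrect (C : I -> set R) : (forall i, measurable (C i)) ->
    measurable [set w | forall i, C i (xi i w)].
  move=> mC; rewrite (_ : [set w | _] = \bigcap_(i in [set: I]) (xi i @^-1` C i)).
    apply: fin_bigcap_measurable => // i _.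
    by rewrite -[X in measurable X]setTI; apply: mxi.
  by apply/seteqP; split => [w h i _|w h i]; [exact: h|exact: (h i Logic.I)].
have mE0 : measurable E0 by apply: mrect; exact: mB'.
pose pr (w : Om) : RR * RR := (xi a w, xi b w).
have mpr : measurable_fun setT pr by apply: measurable_fun_pair; exact: mxi.
(* [P] is restricted to the event on the other coordinates. Its image under [pr] will be [q] times
   the product law, by uniqueness on rectangles. *)
pose m1 : {measure set Om -> \bar R} := mrestr P mE0.
pose m'0 : {measure set (RR * RR) -> \bar R} := pushforward m1 pr.
pose m' := m'0 mpr.
have q0 : (0 <= q)%R by apply: prodr_ge0 => i _; rewrite fine_ge0.
pose r : {nonneg R} := NngNum q0.
have m'E A1 A2 : measurable A1 -> measurable A2 ->
    m' (A1 `*` A2) = (fine (N A1) * fine (N A2) * q)%:E.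
  move=> mA1 mA2; rewrite -prodB' -xiN; last exact: mB'.
  rewrite /m' /m'0 /m1 /= /pushforward /mrestr; congr (P _).
  apply/seteqP; split => w /=.
    move=> [[h1 h2] h0] i; have := h0 i; rewrite /B'.
    by case: ifP => [/eqP ->//|_]; case: ifP => [/eqP ->//|_].
  move=> h; split; first split.
  - by have := h a; rewrite /B' eqxx.
  - by have := h b; rewrite /B' eq_sym (negbTE ab) eqxx.
  - move=> i; have := h i; rewrite /B'; case: ifP => // _; case: ifP => //.
have NN A : measurable A -> (fine (N A))%:E = N A.
  by move=> mA; rewrite fineK// fin_num_measure.
have h1 := @product_measure_unique _ _ _ _ _ (mscale r N) N m'.
have h2 := @product_measure_unique _ _ _ _ _ (mscale r N) N (mscale r (N \x N)).
have key X : measurable X -> m' X = (mscale r (N \x N)) X.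
  move=> mX; rewrite -h1//; last first.
    move=> A1 A2 mA1 mA2; rewrite m'E// /mscale/=.
    transitivity (q%:E * (fine (N A1))%:E * (fine (N A2))%:E); last by rewrite !NN.
    by rewrite -!EFinM; congr (_%:E); ring.
  rewrite -h2// => A1 A2 mA1 mA2.
  transitivity (q%:E * (N A1 * N A2)); last by rewrite /mscale/= muleA.
  by congr (_ * _); exact: product_measure1E.
pose Z := [set z : RR * RR | B a (c * z.1 - s * z.2)%R /\ B b (s * z.1 + c * z.2)%R].
have mZ : measurable Z.
  rewrite (_ : Z =
     (fun z : RR * RR => ((c * z.1 - s * z.2)%R, (s * z.1 + c * z.2)%R)) @^-1` (B a `*` B b))//.
  rewrite -[X in measurable X]setTI; apply: measurable_rotation => //.
  by apply: measurableX; exact: mB.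
transitivity (m' Z).
  rewrite /m' /m'0 /m1 /= /pushforward /mrestr; congr (P _).
  apply/seteqP; split => w /=.
    move=> h; split; first split.
    - by have := h a; rewrite /rotate_family eqxx.
    - by have := h b; rewrite /rotate_family eq_sym (negbTE ab) eqxx.
    - move=> i; have := h i; rewrite /B' /rotate_family.
      by case: ifP => // _; case: ifP.
  move=> [[h1' h2'] h0] i; have := h0 i; rewrite /B' /rotate_family.
  by case: ifP => [/eqP ->//|_]; case: ifP => [/eqP ->//|_].
rewrite key// /mscale /= /Z normal_prob_product_rotation//.
rewrite -(NN _ (mB a)) -(NN _ (mB b)) -!EFinM; congr (_%:E).
rewrite mulrC -(prodB' (B a) (B b)).
  apply: eq_bigr => i _; by rewrite /B'; case: ifP => [/eqP ->//|_]; case: ifP => [/eqP ->//|_].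
- exact: mB.
- exact: mB.
Qed.

Definition rectangles : set (set (I -> R)) :=
  [set E | exists2 B : I -> set R, (forall i, measurable (B i)) &
    E = [set x | forall i, B i (x i)]].

Local Notation RI := (g_sigma_algebraType rectangles).

Lemma measurable_family (xi : I -> Om -> R) : (forall i, measurable_fun setT (xi i)) ->
  measurable_fun setT ((fun w i => xi i w) : Om -> RI).
Proof.
move=> mxi; apply: (@measurability _ _ Om RI setT (fun w i => xi i w) rectangles) => //.
move=> _ [_ [B mB ->] <-]; rewrite setTI.
rewrite (_ : _ @^-1` _ = \bigcap_(i in [set: I]) (xi i @^-1` B i)).
  apply: fin_bigcap_measurable => // i _.
  by rewrite -[X in measurable X]setTI; apply: mxi.
by apply/seteqP; split => [w h i _|w h i]; [exact: h|exact: (h i Logic.I)].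
Qed.

(** Rectangles are stable under intersection and generate the sigma-algebra, so their probabilities
    determine the joint law. *)
Lemma gaussian_family_law (xi xi' : I -> Om -> R) (f : RI -> \bar R) :
  gaussian_family xi -> gaussian_family xi' ->
  measurable_fun setT f -> (forall x, 0 <= f x) ->
  \int[P]_w f (xi ^~ w) = \int[P]_w f (xi' ^~ w).
Proof.
move=> [mxi xiN] [mxi' xiN'] mf f0.
have m1 := measurable_family mxi; have m2 := measurable_family mxi'.
pose g1 : {mfun Om >-> RI} := HB.pack ((fun w i => xi i w) : Om -> RI)
  (isMeasurableFun.Build _ _ _ _ _ m1).
pose g2 : {mfun Om >-> RI} := HB.pack ((fun w i => xi' i w) : Om -> RI)
  (isMeasurableFun.Build _ _ _ _ _ m2).
transitivity (\int[pushforward P g1]_x f x); first by rewrite ge0_integral_pushforward.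
transitivity (\int[pushforward P g2]_x f x); last by rewrite ge0_integral_pushforward.
apply: eq_measure_integral => A mA _.
apply: (@g_sigma_algebra_measure_unique _ R RI rectangles _ (fun=> setT)) => //.
- by move=> E rE; exact: sub_sigma_algebra.
- by move=> n; exists (fun=> setT) => //; apply/seteqP; split.
- by rewrite bigcup_const//; exists 0%N.
- move=> _ _ [B mB ->] [C mC ->]; exists (fun i => B i `&` C i).
    by move=> i; exact: measurableI.
  by apply/seteqP; split => x /= => [[h1 h2] i|h]; [split|split => i; have [] := h i].
- by move=> _ [B mB ->]; exact: (etrans (xiN B mB) (esym (xiN' B mB))).
- by move=> n; rewrite /= /pushforward /= probability_setT ltry.
Qed.

(** After rounding of the coordinates, [f] factors through the countable set of integer vectors, and
    any such function is measurable; [f] is the limit. This makes norms of [X]-valued Gaussian sums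
    measurable. *)
Lemma measurable_fun_family (f : RI -> R) :
  (forall x, (fun n => f (fun i => (Num.floor (x i * n.+1%:R))%:~R / n.+1%:R)%R) @ \oo --> f x) ->
  measurable_fun setT f.
Proof.
move=> fx; pose rd n (x : I -> R) : {ffun I -> int} := [ffun i => Num.floor (x i * n.+1%:R)%R].
pose f' n (t : {ffun I -> int}) := f (fun i => (t i)%:~R / n.+1%:R)%R.
apply: (@measurable_fun_cvg _ RI R setT (fun n x => f' n (rd n x)) f); last first.
  move=> x _; rewrite (_ : (fun n => f' n (rd n x)) =
    (fun n => f (fun i => (Num.floor (x i * n.+1%:R))%:~R / n.+1%:R)%R)); first exact: fx.
  by apply/funext => n; rewrite /f' /rd; congr f; apply/funext => i; rewrite ffunE.
move=> n _ Y _; rewrite setTI.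
rewrite (_ : _ @^-1` _ = \bigcup_(k in [set: nat]) (if @choice.unpickle {ffun I -> int} k is Some t then
    (if f' n t \in Y then rd n @^-1` [set t] else set0) else set0)); last first.
  apply/seteqP; split => x /=.
    by move=> Yx; exists (choice.pickle (rd n x)) => //; rewrite choice.pickleK mem_set.
  move=> [k _]; case: (choice.unpickle k) => // t; case: ifPn => // /set_mem Yt.
  by rewrite /= => ->.
apply: bigcupT_measurable => k; case: (choice.unpickle k) => // t; case: ifP => // _.
apply: sub_sigma_algebra; exists (fun i => [set y | Num.floor (y * n.+1%:R)%R = t i]).
  move=> i; rewrite (_ : [set y | _] =
    (fun y : R => (Num.floor (y * n.+1%:R)%R)%:~R : R) @^-1` [set (t i)%:~R : R]); last first.
    by apply/seteqP; split => y /= => [->//|/intr_inj].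
  rewrite -[X in measurable X]setTI; apply: nondecreasing_measurable => //.
  by move=> x y xy; rewrite ler_int le_floor// ler_wpM2r.
apply/seteqP; split => x /=; first by move=> <- i; rewrite ffunE.
by move=> h; apply/ffunP => i; rewrite ffunE.
Qed.

End gaussian_family.

Section complex_gaussians.
Context (R : realType) (d : measure_display) (Om : measurableType d).
Variables (P : probability Om R) (gam : nat -> Om -> R[i]).
Hypothesis hgam : standard_complex_gaussians P gam.
Variable n : nat.
Variable X : normedModType R[i].
Implicit Types x : 'I_n -> X.

Local Notation sigma := ((Num.sqrt 2)^-1 : R).

Let sigma0 : sigma != 0.
Proof. by rewrite invr_eq0 sqrtr_eq0 -ltNge. Qed.

Definition gauss_xi (i : 'I_n * bool) (w : Om) : R := re_im gam (val i.1, i.2) w.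

Lemma gauss_xi_family : gaussian_family P sigma gauss_xi.
Proof.
have [mg gN ind] := hgam; split; first by move=> i; exact: mg.
move=> B mB.
pose J : {fset nat * bool} := [fset (val i.1, i.2) | i in {: 'I_n * bool}]%fset.
(* Independence is stated for events over all of [nat * bool]; indices that are not below [n]
   receive the whole line. *)
pose B' (j : nat * bool) : set R :=
  if insub j.1 is Some i then B (i, j.2) else setT.
have B'E (i : 'I_n * bool) : B' (val i.1, i.2) = B i.
  by rewrite /B' /= valK; case: i.
have mB' j : measurable (B' j) by rewrite /B'; case: insub.
have inj : {in {: 'I_n * bool} &, injective (fun i : 'I_n * bool => (val i.1, i.2))}.
  by move=> [i b] [i' b'] _ _ [] /val_inj -> ->.
have := ind J B' mB'.
have -> (f : nat * bool -> R) : \prod_(i <- J) f i = \prod_(i : 'I_n * bool) f (val i.1, i.2).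
  rewrite (perm_big [seq (val i.1, i.2) | i <- enum {: 'I_n * bool}]) /=.
    by rewrite big_map big_enum.
  apply: uniq_perm; first exact: fset_uniq.
    rewrite map_inj_uniq ?enum_uniq// => i i'.
    exact: inj.
  move=> j; apply/imfsetP/mapP => -[i _ ->]; exists i => //.
  by rewrite mem_enum.
rewrite (_ : \bigcap_(i in _) _ = [set w | forall i, B i (gauss_xi i w)]).
  move=> ->; congr (_%:E); apply: eq_bigr => i _.
  by rewrite B'E gN.
apply/seteqP; split => w h.
  move=> i; rewrite -B'E; apply: (h (val i.1, i.2)) => /=.
  by apply/imfsetP; exists i.
by move=> _ /= /imfsetP[i _ ->] /=; rewrite B'E; exact: h.
Qed.

Definition gauss_sum x (y : 'I_n * bool -> R) : X :=
  \sum_k (y (k, false) +i* y (k, true)) *: x k.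

Definition gauss_fun2 x (y : 'I_n * bool -> R) : \bar R :=
  ((rnorm (gauss_sum x y)) ^+ 2)%:E.

Definition gauss_energy x : \bar R :=
  (\int[P]_w ((rnorm (\sum_(k < n) gam k w *: x k)) ^+ 2)%:E)%E.

Lemma gauss_energyE x : gauss_energy x = (\int[P]_w gauss_fun2 x (gauss_xi ^~ w))%E.
Proof.
apply: eq_integral => w _; congr ((rnorm _ ^+ 2)%:E); apply: eq_bigr => k _.
by congr (_ *: _); rewrite /gauss_xi /re_im/=; case: (gam k w).
Qed.

Lemma measurable_gauss_fun2 x :
  measurable_fun setT (gauss_fun2 x : g_sigma_algebraType (@rectangles R ('I_n * bool)%type) -> \bar R).
Proof.
apply/measurable_EFinP; apply: measurable_funX.
apply: measurable_fun_family => y.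
pose yn m (i : 'I_n * bool) : R := (Num.floor (y i * m.+1%:R))%:~R / m.+1%:R.
have yny i : (fun m => yn m i) @ \oo --> y i.
  apply/cvgrPdist_le => e e0; near=> m.
  have m0 : 0 < m.+1%:R :> R by rewrite ltr0n.
  have /andP[h1 h2] := floor_itv (y i * m.+1%:R).
  apply: (@le_trans _ _ (m.+1%:R^-1)); last first.
    by apply/ltW; near: m; exact: (near_infty_natSinv_lt (PosNum e0)).
  rewrite /yn -[X in `|X - _|](mulfK (lt0r_neq0 m0)) -mulrBl normrM.
  rewrite [X in _ * X <= _]gtr0_norm ?invr_gt0// ler_piMl ?invr_ge0 ?(ltW m0)//.
  rewrite ger0_norm ?subr_ge0// lerBlDr addrC; apply/ltW; apply: (lt_le_trans h2).
  by rewrite intrD.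
apply: cvg_rnorm.
apply: cvg_big => [|k _]; first exact: add_continuous.
apply: cvgZl.
by apply/cvg_complexP; split => /=; exact: yny.
Unshelve. all: by end_near. Qed.

Lemma gauss_energy_law x (xi : 'I_n * bool -> Om -> R) :
  gaussian_family P sigma xi ->
  gauss_energy x = (\int[P]_w gauss_fun2 x (xi ^~ w))%E.
Proof.
move=> h; rewrite gauss_energyE.
apply: (gaussian_family_law gauss_xi_family h (measurable_gauss_fun2 x)).
by move=> y; rewrite lee_fin sqr_ge0.
Qed.

Lemma gauss_energy_ge0 x : (0 <= gauss_energy x)%E.
Proof. by apply: integral_ge0 => w _; rewrite lee_fin sqr_ge0. Qed.

Lemma measurable_gauss_energy x : measurable_fun setT
  (fun w => ((rnorm (\sum_(k < n) gam k w *: x k)) ^+ 2)%:E).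
Proof.
have m := measurable_family gauss_xi_family.1.
have := measurableT_comp (measurable_gauss_fun2 x) m.
congr measurable_fun; apply/funext => w /=.
congr ((rnorm _ ^+ 2)%:E); apply: eq_bigr => k _.
by congr (_ *: _); rewrite /gauss_xi /re_im/=; case: (gam k w).
Qed.

(** The factor [u] can be moved from [x k] to [gam k], where it rotates the pair of real and
    imaginary parts, with sine [Im u]. *)
Let phase_neq (k : 'I_n) (u : R[i]) x : complex.Im u != 0 ->
  complex.Re u ^+ 2 + complex.Im u ^+ 2 = 1 ->
  gauss_energy (fun j => if j == k then u *: x j else x j) = gauss_energy x.
Proof.
move=> u0 u1.
have kk : (k, false) != (k, true) by rewrite xpair_eqE eqxx.
rewrite [RHS](gauss_energy_law x (gaussian_family_rotate sigma0 kk u1 u0 gauss_xi_family)).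
rewrite gauss_energyE; apply: eq_integral => w _.
congr ((rnorm _ ^+ 2)%:E); apply: eq_bigr => j _.
rewrite /rotate_family !xpair_eqE /= !andbT !andbF; case: eqP => [->|//] /=.
rewrite scalerA; congr (_ *: _); case: u {u0 u1} => a b /=.
by apply/eqP; rewrite eq_complex/=; apply/andP; split; apply/eqP; ring.
Qed.

Lemma gauss_energy_phase (k : 'I_n) (u : R[i]) x :
  complex.Re u ^+ 2 + complex.Im u ^+ 2 = 1 ->
  gauss_energy (fun j => if j == k then u *: x j else x j) = gauss_energy x.
Proof.
move=> u1; have [u0|] := eqVneq (complex.Im u) 0; last by move=> ?; exact: phase_neq.
have i1 : complex.Re ('i%C : R[i]) ^+ 2 + complex.Im ('i%C : R[i]) ^+ 2 = 1.
  by rewrite /= expr0n expr1n add0r.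
(* For [u = 1] or [u = -1] write [u = 'i * v]; both factors have nonzero imaginary part, so
   [phase_neq] applies twice. *)
pose v : R[i] := 0 +i* (- complex.Re u).
have ru0 : complex.Re u != 0.
  by apply/eqP => ru; move: u1; rewrite ru u0 expr0n addr0 => /eqP; rewrite eq_sym oner_eq0.
rewrite -(@phase_neq k 'i%C x) ?oner_eq0//.
rewrite -(@phase_neq k v (fun j => if j == k then 'i%C *: x j else x j)); last 2 first.
- by rewrite /= oppr_eq0.
- by rewrite /v/= expr0n add0r sqrrN -u1 u0 expr0n addr0.
congr gauss_energy; apply/funext => j; case: eqP => // _.
rewrite scalerA; congr (_ *: _); apply/eqP; rewrite eq_complex /v/=.
by rewrite u0 !mul0r mulr0 !mulr1 sub0r opprK addr0 !eqxx.
Qed.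

(** Real coefficients mix real parts with real parts and imaginary parts with imaginary parts, so
    two real rotations in succession do it. *)
Lemma gauss_energy_rotation (k l : 'I_n) (c s : R) x :
  k != l -> c ^+ 2 + s ^+ 2 = 1 -> s != 0 ->
  gauss_energy (fun j => if j == k then c%:C *: x k + s%:C *: x l else
    if j == l then (- s)%:C *: x k + c%:C *: x l else x j) = gauss_energy x.
Proof.
move=> kl cs1 s0.
have k1 : (k, false) != (l, false) by rewrite xpair_eqE eqxx andbT.
have k2 : (k, true) != (l, true) by rewrite xpair_eqE eqxx andbT.
have h1 := gaussian_family_rotate sigma0 k1 cs1 s0 gauss_xi_family.
have h2 := gaussian_family_rotate sigma0 k2 cs1 s0 h1.
rewrite [RHS](gauss_energy_law x h2) gauss_energyE; apply: eq_integral => w _.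
congr ((rnorm _ ^+ 2)%:E); rewrite /gauss_sum.
rewrite (bigD1 k)//= [in RHS](bigD1 k)//= (bigD1 l)//=; last by rewrite eq_sym.
rewrite [in RHS](bigD1 l)//=; last by rewrite eq_sym.
rewrite !addrA; congr (_ + _); last first.
  apply: eq_bigr => j /andP[jk jl].
  by rewrite /rotate_family !xpair_eqE (negbTE jk) (negbTE jl) /= ?andbF.
rewrite eqxx eq_sym (negbTE kl) eqxx /rotate_family !xpair_eqE !eqxx /= ?andbF ?andbT.
rewrite [l == k]eq_sym (negbTE kl) /= !scalerDr !scalerA addrACA -!scalerDl.
by congr (_ *: _ + _ *: _); apply/eqP; rewrite eq_complex/=; apply/andP; split;
  apply/eqP; ring.
Qed.

End complex_gaussians.

(** * Phases, roots of unity and unitary matrices *)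

Section unit_complex.
Context (R : realType).
Implicit Types z u : R[i].

Definition unimodular u := complex.Re u ^+ 2 + complex.Im u ^+ 2 = 1.

Lemma unimodular_conj u : unimodular u -> u^*%C * u = 1.
Proof.
case: u => a b; rewrite /unimodular/= => h.
apply/eqP; rewrite eq_complex/=; apply/andP; split; apply/eqP.
  by rewrite -[RHS]h; ring.
by ring.
Qed.

Lemma phase_ex z : exists2 u, unimodular u & u * z = (rnorm (z : R[i]^o))%:C.
Proof.
have [->|z0] := eqVneq z 0.
  by exists 1; rewrite ?mulr0 ?(@rnorm0 R R[i]^o)// /unimodular/= expr0n expr1n addr0.
have r0 : rnorm (z : R[i]^o) != 0 by rewrite rnorm_eq0.
have r2 : rnorm (z : R[i]^o) ^+ 2 = complex.Re z ^+ 2 + complex.Im z ^+ 2.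
  by rewrite rnormCE sqr_sqrtr ?addr_ge0 ?sqr_ge0.
move: (rnorm _) r0 r2 => r r0 r2.
exists ((complex.Re z / r) +i* (- (complex.Im z / r))).
  by rewrite /unimodular/= sqrrN !expr_div_n -mulrDl -r2 divff// expf_neq0.
case: z z0 r2 => a b _ /= r2; apply/eqP; rewrite eq_complex/=; apply/andP; split; apply/eqP.
  by apply: (mulIf r0); rewrite -expr2 r2; field.
by field.
Qed.

Lemma unimodular_mul u v : unimodular u -> unimodular v -> unimodular (u * v).
Proof.
case: u => a b; case: v => c e; rewrite /unimodular/= => h1 h2.
by transitivity ((a ^+ 2 + b ^+ 2) * (c ^+ 2 + e ^+ 2)); [ring|rewrite h1 h2 mulr1].
Qed.

Lemma unimodular_conjc u : unimodular u -> unimodular (u^*%C).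
Proof. by case: u => a b; rewrite /unimodular/= sqrrN. Qed.

(** Once its phase is removed, [z] becomes its modulus [r], the real part of a unit number [t],
    hence the half sum of [t] and its conjugate. *)
Lemma half_sum_unimodular z : rnorm (z : R[i]^o) <= 1 ->
  exists u v, [/\ unimodular u, unimodular v & z = (2^-1)%:C * (u + v)].
Proof.
move=> z1; have [w w1 wz] := phase_ex z; set r := rnorm _ in z1 wz.
have r0 : 0 <= r by exact: rnorm_ge0.
have r21 : 0 <= 1 - r ^+ 2 by rewrite subr_ge0 expr_le1.
pose t : R[i] := r +i* Num.sqrt (1 - r ^+ 2).
have t1 : unimodular t by rewrite /unimodular/= sqr_sqrtr// addrC subrK.
exists (w^*%C * t), (w^*%C * t^*%C); split.
- by apply: unimodular_mul => //; exact: unimodular_conjc.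
- by apply: unimodular_mul; exact: unimodular_conjc.
rewrite -mulrDr mulrCA (_ : _ * (t + _) = r%:C).
  by rewrite -wz mulrA unimodular_conj// mul1r.
apply/eqP; rewrite eq_complex/=; apply/andP; split; apply/eqP; last by ring.
by field.
Qed.

Definition cis (t : R) : R[i] := cos t +i* sin t.

Lemma cisD s t : cis (s + t) = cis s * cis t.
Proof.
apply/eqP; rewrite eq_complex/= cosD sinD; apply/andP; split; apply/eqP; ring.
Qed.

Lemma cis0 : cis 0 = 1.
Proof. by rewrite /cis cos0 sin0. Qed.

Lemma cisN t : cis (- t) = (cis t)^*%C.
Proof. by rewrite /cis cosN sinN. Qed.

Lemma rnorm_cis t : rnorm (cis t : R[i]^o) = 1.
Proof. by rewrite rnormCE /= cos2Dsin2 sqrtr1. Qed.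

Lemma cisMn t m : cis (t *+ m) = cis t ^+ m.
Proof. by elim: m => [|m ih]; rewrite ?mulr0n ?cis0// mulrS cisD ih exprS. Qed.

Lemma cis_2pi_nat (m : nat) : cis (2 * pi *+ m) = 1.
Proof. by rewrite cisMn /cis mulr_natl cos2pi sin2pi expr1n. Qed.

Lemma cis_2pi_int (m : int) : cis (2 * pi *~ m) = 1.
Proof.
case: m => m; first exact: cis_2pi_nat.
rewrite NegzE mulrNz cisN.
by have -> : cis (2 * pi *~ m.+1) = 1 := cis_2pi_nat _; rewrite conjc1.
Qed.

Lemma cis_sum_eq0 (n : nat) (m : int) : (0 < n)%N -> ~~ (n%:Z %| m)%Z ->
  \sum_(j < n) cis (2 * pi * m%:~R * j%:R / n%:R) = 0.
Proof.
move=> n0 nm; have nR : n%:R != 0 :> R by rewrite pnatr_eq0 -lt0n.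
pose w := cis (2 * pi * m%:~R / n%:R).
have -> : \sum_(j < n) cis (2 * pi * m%:~R * j%:R / n%:R) = \sum_(j < n) w ^+ j.
  by apply: eq_bigr => j _; rewrite -cisMn -mulr_natr; congr cis; field.
have wn : w ^+ n = 1.
  rewrite /w -cisMn.
  have -> : 2 * pi * m%:~R / n%:R *+ n = 2 * pi *~ m :> R.
    by rewrite -[LHS]mulr_natr divfK// mulrzr.
  exact: cis_2pi_int.
(* Reduce [m] to its remainder [0 < r < n]; then [1 - Re w = 2 sin^2 x] with [x = pi r / n] strictly
   between 0 and [pi]. *)
have w1 : w != 1.
  pose r := (m %% n%:Z)%Z; pose q := (m %/ n%:Z)%Z.
  have nZ : n%:Z != 0 by lia.
  have rn : (r < n%:Z)%R by rewrite /r; have := ltz_pmod m (_ : 0 < n%:Z); apply; lia.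
  have r0 : (0 < r)%R.
    rewrite lt_neqAle modz_ge0// andbT eq_sym.
    by apply/eqP => /dvdz_mod0P; apply/negP.
  have -> : w = cis (2 * pi * r%:~R / n%:R).
    rewrite /w (_ : 2 * pi * m%:~R / n%:R = 2 * pi * r%:~R / n%:R + 2 * pi *~ q).
      by rewrite cisD cis_2pi_int mulr1.
    rewrite (divz_eq m n%:Z) -/q -/r intrD intrM -mulrzr.
    by rewrite -pmulrn; field.
  pose x : R := pi * r%:~R / n%:R.
  have x0 : 0 < sin x.
    apply: sin_gt0_pi; rewrite !(divr_gt0, mulr_gt0) ?pi_gt0 ?ltr0z ?ltr0n//=.
    rewrite ltr_pdivrMr ?ltr0n// ltr_pM2l ?pi_gt0//.
    by rewrite [n%:R]pmulrn ltr_int.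
  rewrite (_ : 2 * pi * r%:~R / n%:R = x + x); last by rewrite /x; field.
  apply/eqP => -[]; rewrite cosD -!expr2 cos2sin2 => h _.
  have := mulr_gt0 x0 x0; rewrite -expr2; lra.
have := subrX1 w n; rewrite wn subrr => /esym/eqP; rewrite mulf_eq0 subr_eq0 (negbTE w1).
by move=> /eqP.
Qed.

End unit_complex.

Section unitary_invariance.
Context (R : realType) (d : measure_display) (Om : measurableType d).
Variables (P : probability Om R) (gam : nat -> Om -> R[i]).
Hypothesis hgam : standard_complex_gaussians P gam.
Variable n : nat.
Variable X : normedModType R[i].
Implicit Types (x : 'I_n -> X) (V : 'I_n -> 'I_n -> R[i]).

Local Notation Q := (@gauss_energy R d Om P gam n X).

Definition act V x (k : 'I_n) : X := \sum_l V k l *: x l.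

Definition orthonormal_cols V := forall l l',
  \sum_i (V i l)^*%C * V i l' = (l == l')%:R.

Definition row_phase (k : 'I_n) (u : R[i]) V (i l : 'I_n) : R[i] :=
  if i == k then u * V k l else V i l.

Definition row_rotation (k k' : 'I_n) (c s : R) V (i l : 'I_n) : R[i] :=
  if i == k then c%:C * V k l + s%:C * V k' l else
  if i == k' then (- s)%:C * V k l + c%:C * V k' l else V i l.

Let act_row_phase k u V x : act (row_phase k u V) x =
  fun j => if j == k then u *: act V x j else act V x j.
Proof.
apply/funext => j; rewrite /act /row_phase; case: eqP => [->|//].
by rewrite scaler_sumr; apply: eq_bigr => l _; rewrite scalerA.
Qed.

Let act_row_rotation k k' c s V x : act (row_rotation k k' c s V) x =
  fun j => if j == k then c%:C *: act V x k + s%:C *: act V x k' else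
    if j == k' then (- s)%:C *: act V x k + c%:C *: act V x k' else act V x j.
Proof.
apply/funext => j; rewrite /act /row_rotation; case: eqP => _; last case: eqP => // _.
  rewrite !scaler_sumr -big_split; apply: eq_bigr => l _.
  by rewrite scalerDl !scalerA.
rewrite !scaler_sumr -big_split; apply: eq_bigr => l _.
by rewrite scalerDl !scalerA.
Qed.

Let orthonormal_row_phase k u V : unimodular u -> orthonormal_cols V ->
  orthonormal_cols (row_phase k u V).
Proof.
move=> u1 oV l l'; rewrite -oV; apply: eq_bigr => i _; rewrite /row_phase.
case: eqP => [->|//]; rewrite rmorphM/= mulrACA unimodular_conj//.
by rewrite mul1r.
Qed.

Let orthonormal_row_rotation k k' c s V : k != k' -> c ^+ 2 + s ^+ 2 = 1 ->
  orthonormal_cols V -> orthonormal_cols (row_rotation k k' c s V).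
Proof.
move=> kk cs1 oV l l'; rewrite -oV.
rewrite (bigD1 k)//= [in RHS](bigD1 k)//= (bigD1 k')//=; last by rewrite eq_sym.
rewrite [in RHS](bigD1 k')//=; last by rewrite eq_sym.
rewrite !addrA; congr (_ + _); last first.
  by apply: eq_bigr => j /andP[/negbTE jk /negbTE jl]; rewrite /row_rotation jk jl.
rewrite /row_rotation !eqxx eq_sym (negbTE kk).
have cs : c%:C ^+ 2 + s%:C ^+ 2 = 1 :> R[i] by rewrite -!rmorphXn -rmorphD/= cs1.
have conjE (x y : R) (z z' : R[i]) :
    (x%:C * z + y%:C * z')^*%C = x%:C * z^*%C + y%:C * z'^*%C.
  case: z => z1 z2; case: z' => z3 z4; apply/eqP; rewrite eq_complex/=.
  by apply/andP; split; apply/eqP; ring.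
rewrite !conjE rmorphN/=.
transitivity ((c%:C ^+ 2 + s%:C ^+ 2) *
   ((V k l)^*%C * V k l' + (V k' l)^*%C * V k' l')); first by ring.
by rewrite cs mul1r.
Qed.

Let energy_row_phase k u V x : unimodular u -> Q (act (row_phase k u V) x) = Q (act V x).
Proof. by move=> u1; rewrite act_row_phase gauss_energy_phase. Qed.

Let energy_row_rotation k k' c s V x : k != k' -> c ^+ 2 + s ^+ 2 = 1 -> s != 0 ->
  Q (act (row_rotation k k' c s V) x) = Q (act V x).
Proof. by move=> kk cs1 s0; rewrite act_row_rotation gauss_energy_rotation. Qed.

(* Gaussian elimination by phases and planar rotations: once the columns before
   [m] are standard, column [m] is made standard without touching them. *)
Lemma gauss_energy_unitary V x : orthonormal_cols V -> Q (act V x) = Q x.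
Proof.
(* The outer induction is on a bound [r] for the number of columns left, the inner one on the number
   [cnt] of nonzero entries of column [m] below the diagonal. *)
suff main r : forall m V, (n - m <= r)%N -> orthonormal_cols V ->
    (forall i l : 'I_n, (l < m)%N -> V i l = (i == l)%:R) -> Q (act V x) = Q x.
  by move=> oV; apply: (main n 0%N) => //; rewrite subn0.
have std m W : (n <= m)%N -> (forall i l : 'I_n, (l < m)%N -> W i l = (i == l)%:R) ->
    Q (act W x) = Q x.
  move=> nm Wm; congr gauss_energy; apply/funext => k; rewrite /act (bigD1 k)//=.
  rewrite Wm ?eqxx ?scale1r; last by rewrite (leq_trans _ nm).
  rewrite big1 ?addr0// => l lk; rewrite Wm ?(leq_trans _ nm)//.
  by rewrite eq_sym (negbTE lk) scale0r.
elim: r => [|r ihr] m W nr oW Wm; first by apply: (std m) => //; lia.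
have [nm|mn] := leqP n m; first exact: (std m).
pose k := Ordinal mn.
(* Orthogonality to the columns that are already standard clears column [k] above the diagonal. *)
have below V' (i : 'I_n) : orthonormal_cols V' ->
    (forall i l : 'I_n, (l < m)%N -> V' i l = (i == l)%:R) -> (i < m)%N -> V' i k = 0.
  move=> oV' V'm im; have := oV' i k.
  rewrite (bigD1 i)//= big1 ?addr0.
    by rewrite V'm// eqxx conjc1 mul1r => ->; rewrite -val_eqE/= ltn_eqF.
  by move=> j ji; rewrite V'm// (negbTE ji) conjc0 mul0r.
pose cnt V' := #|[pred i : 'I_n | (m < i)%N && (V' i k != 0 :> R[i])]|.
have [c] := ubnP (cnt W); elim: c W oW Wm => // c ihc W oW Wm Wc.
case: (pickP [pred i : 'I_n | (m < i)%N && (W i k != 0)]) => [i /andP[mi Wi0]|none]; last first.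
  have off i : i != k -> W i k = 0.
    move=> ik; case: (ltngtP (val i) m) => [im|mi|im]; first exact: below.
      by apply/eqP; have := none i; rewrite /= mi => /negbFE.
    by move: ik; rewrite -val_eqE/= im eqxx.
  (* Column [k] now has a single nonzero entry and unit length, so [W k k] is unimodular and its
     conjugate is the phase that turns it into 1. *)
  have := oW k k; rewrite eqxx (bigD1 k)//= big1 ?addr0; last first.
    by move=> i ik; rewrite off// mulr0.
  move=> Wkk; pose u := (W k k)^*%C.
  have u1 : unimodular u.
    apply: unimodular_conjc; move: Wkk; rewrite /unimodular.
    by case: (W k k) => a b /= [] <- _; ring.
  rewrite -(energy_row_phase k W x u1); apply: (ihr m.+1); first lia.
    exact: orthonormal_row_phase.
  move=> i l; rewrite ltnS leq_eqVlt => /orP[/eqP lm|lm]; rewrite /row_phase.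
    have -> : l = k by apply/val_inj.
    by case: eqVneq => [_|ik]; [rewrite Wkk|rewrite off].
  case: eqP => [->|_]; last exact: Wm.
  by rewrite Wm// -val_eqE/= gtn_eqF// mulr0.
have ki : k != i by rewrite -val_eqE/= ltn_eqF.
(* Phases make the two entries real, [a] and [b]; the rotation with cosine [a / q] and sine [b / q]
   then puts [q] in row [k] and 0 in row [i]. *)
have [u u1 uE] := phase_ex (W k k); have [v v1 vE] := phase_ex (W i k).
set a := rnorm _ in uE; set b := rnorm _ in vE.
have b0 : b != 0 by rewrite rnorm_eq0.
pose W1 := row_phase k u (row_phase i v W).
have W1k : W1 k k = a%:C by rewrite /W1 /row_phase eqxx (negbTE ki).
have W1i : W1 i k = b%:C by rewrite /W1 /row_phase eqxx [i == k]eq_sym (negbTE ki).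
have q0 : 0 < a ^+ 2 + b ^+ 2 by rewrite ltr_wpDl ?sqr_ge0// exprn_even_gt0.
pose q := Num.sqrt (a ^+ 2 + b ^+ 2).
have qq : q ^+ 2 = a ^+ 2 + b ^+ 2 by rewrite sqr_sqrtr// ltW.
have qn0 : q != 0 by rewrite sqrtr_eq0 -ltNge.
have cs1 : (a / q) ^+ 2 + (b / q) ^+ 2 = 1.
  by rewrite !expr_div_n -mulrDl -qq divff// expf_neq0.
have s0 : b / q != 0 by rewrite mulf_neq0// invr_eq0.
pose W2 := row_rotation k i (a / q) (b / q) W1.
have W1m (j l : 'I_n) : (l < m)%N -> W1 j l = (j == l)%:R.
  move=> lm; have kl : (k == l) = false by rewrite -val_eqE/= gtn_eqF.
  have il : (i == l) = false by rewrite -val_eqE/= gtn_eqF// (ltn_trans lm).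
  rewrite /W1 /row_phase; case: eqP => [->|_].
    by rewrite (negbTE ki) Wm// kl mulr0.
  by case: eqP => [->|_]; rewrite Wm// il mulr0.
rewrite -(energy_row_phase i W x v1) -(energy_row_phase k _ x u1) -/W1.
rewrite -(energy_row_rotation W1 x ki cs1 s0) -/W2.
apply: ihc.
- by do 3?[apply: orthonormal_row_rotation => //|apply: orthonormal_row_phase => //].
- move=> j l lm; have kl : (k == l) = false by rewrite -val_eqE/= gtn_eqF.
  have il : (i == l) = false by rewrite -val_eqE/= gtn_eqF// (ltn_trans lm).
  rewrite /W2 /row_rotation !W1m// kl il.
  by case: eqP => [->|_]; [rewrite kl|case: eqP => [->|//]; rewrite il]; rewrite !mulr0 addr0.
- rewrite ltnS in Wc; apply: leq_trans Wc; apply: proper_card.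
  apply/properP; split; last first.
    exists i; first by rewrite inE mi.
    rewrite inE mi/= negbK /W2 /row_rotation [i == k]eq_sym (negbTE ki) eqxx W1k W1i.
    have -> : (- (b / q))%:C * a%:C + (a / q)%:C * b%:C = (- (b / q) * a + a / q * b)%:C.
      by rewrite rmorphD !rmorphM.
    by rewrite (_ : - (b / q) * a + a / q * b = 0)//; ring.
  apply/fintype.subsetP => j; rewrite !inE => /andP[mj].
  have jk : j != k by rewrite -val_eqE/= gtn_eqF.
  rewrite mj /W2 /row_rotation (negbTE jk); have [->|ji] := eqVneq j i; first by rewrite Wi0.
  by rewrite /W1 /row_phase (negbTE jk) (negbTE ji) => ->.
Qed.

End unitary_invariance.

(** * Gaussian energies under multipliers and convolutions on Z/n *)

Section gaussian_contraction.
Context (R : realType) (d : measure_display) (Om : measurableType d).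
Variables (P : probability Om R) (gam : nat -> Om -> R[i]).
Hypothesis hgam : standard_complex_gaussians P gam.
Variable X : normedModType R[i].

Local Notation Q n := (@gauss_energy R d Om P gam n X).

Let scalerC (a b : R[i]) (v : X) : a *: (b *: v) = b *: (a *: v).
Proof. by rewrite !scalerA mulrC. Qed.

Lemma gauss_energy_mean n (y z : 'I_n -> X) :
  (Q n (fun k => (2^-1)%:C *: (y k + z k)) <= 2^-1%:E * (Q n y + Q n z))%E.
Proof.
rewrite /gauss_energy -ge0_integralD//; last 4 first.
- by move=> w _; rewrite lee_fin sqr_ge0.
- exact: (measurable_gauss_energy hgam).
- by move=> w _; rewrite lee_fin sqr_ge0.
- exact: (measurable_gauss_energy hgam).
rewrite -ge0_integralZl_EFin ?invr_ge0//; last 2 first.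
- by move=> w _; rewrite adde_ge0// lee_fin sqr_ge0.
- by apply: emeasurable_funD; exact: (measurable_gauss_energy hgam).
apply: ge0_le_integral => //.
- by move=> w _; rewrite lee_fin sqr_ge0.
- exact: (measurable_gauss_energy hgam).
- by apply: measurable_funeM; apply: emeasurable_funD; exact: (measurable_gauss_energy hgam).
move=> w _; rewrite -EFinD -EFinM lee_fin.
set A := \sum_(k < n) gam k w *: y k; set B := \sum_(k < n) gam k w *: z k.
have -> : \sum_(k < n) gam k w *: ((2^-1)%:C *: (y k + z k)) = (2^-1)%:C *: (A + B).
  by rewrite /A /B -big_split/= scaler_sumr; apply: eq_bigr => k _; rewrite scalerC scalerDr.
rewrite rnorm_real ger0_norm ?invr_ge0//.
have h := rnormD A B; have a0 := rnorm_ge0 A; have b0 := rnorm_ge0 B.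
apply: (@le_trans _ _ ((2^-1 * (rnorm A + rnorm B)) ^+ 2)).
  by rewrite lerXn2r ?nnegrE ?mulr_ge0 ?invr_ge0 ?addr_ge0 ?rnorm_ge0// ler_wpM2l ?invr_ge0.
by have := sqr_ge0 (rnorm A - rnorm B); nra.
Qed.

Lemma gauss_energyZ n (c : R) (y : 'I_n -> X) :
  (Q n (fun k => c%:C *: y k) = (c ^+ 2)%:E * Q n y)%E.
Proof.
rewrite /gauss_energy -ge0_integralZl_EFin ?sqr_ge0//; last 2 first.
- by move=> w _; rewrite lee_fin sqr_ge0.
- exact: (measurable_gauss_energy hgam).
apply: eq_integral => w _; rewrite -EFinM; congr (_%:E).
rewrite -[c ^+ 2]real_normK ?num_real// -exprMn -rnorm_real; congr (rnorm _ ^+ 2).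
by rewrite scaler_sumr; apply: eq_bigr => k _; rewrite scalerC.
Qed.

(** A number of modulus at most 1 is the mean of two phases; each phase preserves the energy, and
    [gauss_energy_mean] is its convexity. *)
Lemma gauss_energy_contract1 n (k : 'I_n) (c : R[i]) (y : 'I_n -> X) :
  rnorm (c : R[i]^o) <= 1 ->
  (Q n (fun j => if j == k then c *: y j else y j) <= Q n y)%E.
Proof.
move=> /half_sum_unimodular[u [v [u1 v1 ->]]].
have -> : (fun j => if j == k then ((2^-1)%:C * (u + v)) *: y j else y j) =
    (fun j => (2^-1)%:C *: ((if j == k then u *: y j else y j) +
      (if j == k then v *: y j else y j))).
  apply/funext => j; case: eqP => _; first by rewrite -scalerDl scalerA.
  rewrite scalerDr -scalerDl -rmorphD/= (_ : 2^-1 + 2^-1 = 1) ?rmorph1 ?scale1r//.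
  by rewrite [RHS]splitr div1r.
apply: (le_trans (gauss_energy_mean _ _)).
have E (x : R[i]) : unimodular x ->
    Q n (fun j => if j == k then x *: y j else y j) = Q n y.
  move=> x1; rewrite -[RHS](gauss_energy_phase hgam k _ x1); congr gauss_energy.
rewrite !E// muleDr ?ge0_adde_def ?inE ?gauss_energy_ge0//.
rewrite -ge0_muleDl ?lee_fin ?invr_ge0// -EFinD.
have -> : (2^-1 + 2^-1 = 1 :> R)%R by rewrite [RHS]splitr div1r.
by rewrite mul1e.
Qed.

Lemma gauss_energy_contract n (c : 'I_n -> R[i]) (y : 'I_n -> X) :
  (forall k, rnorm (c k : R[i]^o) <= 1) -> (Q n (fun k => c k *: y k) <= Q n y)%E.
Proof.
move=> c1.
suff main (s : seq 'I_n) : uniq s ->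
    (Q n (fun k => if k \in s then c k *: y k else y k) <= Q n y)%E.
  have := main (enum 'I_n) (enum_uniq _); congr (_ <= _)%E; congr gauss_energy.
  by apply/funext => k; rewrite mem_enum.
elim: s => [_|i s ih /= /andP[is_ us]].
  exact: lexx.
apply: le_trans (ih us).
have := gauss_energy_contract1 i (fun k => if k \in s then c k *: y k else y k) (c1 i).
congr (_ <= _)%E; congr gauss_energy; apply/funext => k; rewrite inE.
by case: eqP => [->|//]; rewrite (negbTE is_).
Qed.

Lemma gauss_energy_multiplier n (c : 'I_n -> R[i]) (N : R) (y : 'I_n -> X) : 0 <= N ->
  (forall k, rnorm (c k : R[i]^o) <= N) ->
  (Q n (fun k => c k *: y k) <= (N ^+ 2)%:E * Q n y)%E.
Proof.
move=> N0 cN; have [N00|Nn0] := eqVneq N 0.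
  have c0 k : c k = 0.
    apply/eqP; rewrite -(@rnorm_eq0 R R[i]^o) eq_le rnorm_ge0 andbT.
    by apply: (le_trans (cN k)); rewrite N00.
  rewrite N00 expr0n mul0e /gauss_energy integral0_eq// => w _.
  by rewrite big1 ?rnorm0 ?expr0n// => k _; rewrite c0 scale0r scaler0.
have Np : 0 < N by rewrite lt0r Nn0.
have -> : (fun k => c k *: y k) = (fun k => N%:C *: (((N^-1)%:C * c k) *: y k)).
  by apply/funext => k; rewrite scalerA mulrA -rmorphM/= divff// rmorph1 mul1r.
rewrite gauss_energyZ lee_wpmul2l ?lee_fin ?sqr_ge0//.
apply: gauss_energy_contract => k.
rewrite (@rnormM R) rnormR ger0_norm ?invr_ge0// mulrC ler_pdivrMr// mul1r.
exact: cN.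
Qed.

(** A list of pairs stands for a finitely supported measure on the integers, repeated points
    allowed; this is its Fourier transform. *)
Definition symbol (D : seq (int * R[i])) (xi : R) : R[i] :=
  \sum_(e <- D) e.2 * cis (- (xi * e.1%:~R)).

Lemma character_sum (n : nat) (m : int) : (0 < n)%N ->
  \sum_(j < n) cis (2 * pi * m%:~R * j%:R / n%:R) = (if (n%:Z %| m)%Z then n%:R else 0) :> R[i].
Proof.
move=> n0; have nR : n%:R != 0 :> R by rewrite pnatr_eq0 -lt0n.
case: ifPn => [/dvdzP[q ->]|]; last exact: cis_sum_eq0.
transitivity (\sum_(j < n) (1 : R[i])); last by rewrite sumr_const card_ord.
apply: eq_bigr => j _; rewrite -(@cis_2pi_int R (q * j%:Z)); congr cis.
by rewrite -[RHS]mulrzr !intrM -!pmulrn; field.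
Qed.

(** The Fourier matrix [V] diagonalises the sum, with [symbol D] at the points [- 2 pi j / n] as
    multiplier. Owing to the reflected index [e.1 - k], it is [V] itself and not its inverse that
    acts last, so [gauss_energy_unitary] covers both transforms. *)
Lemma gauss_energy_circulant n (D : seq (int * R[i])) (N : R) (F : int -> X) :
  (0 < n)%N -> (forall m, F (m + n%:Z) = F m) -> 0 <= N ->
  (forall xi, rnorm (symbol D xi : R[i]^o) <= N) ->
  (Q n (fun k => \sum_(e <- D) e.2 *: F (e.1 - k%:Z))%R <=
    (N ^+ 2)%:E * Q n (fun k => F k%:Z)%R)%E.
Proof.
move=> n0 Fn N0 DN; have nR : n%:R != 0 :> R by rewrite pnatr_eq0 -lt0n.
have Fq (q : nat) m : F (m + (n * q)%:Z) = F m.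
  elim: q m => [|q ih] m; first by rewrite muln0 addr0.
  by rewrite mulnS PoszD addrA ih Fn.
have Fmod m : F m = F (m %% n%:Z)%Z.
  rewrite [in LHS](divz_eq m n%:Z); case: (m %/ n%:Z)%Z => q.
    by rewrite addrC mulrC -PoszM Fq.
  rewrite -(Fq q.+1); congr F; rewrite NegzE; lia.
pose c : R[i] := (Num.sqrt n%:R)^-1%:C.
have cc : c * c = (n%:R)^-1.
  rewrite /c -rmorphM -expr2 exprVn sqr_sqrtr ?ler0n//= fmorphV/=.
  by rewrite rmorph_nat.
pose V (k j : 'I_n) : R[i] := c * cis (- (2 * pi * k%:R * j%:R / n%:R)).
have conjE (z : R[i]) : (c * z)^*%C = c * z^*%C.
  by rewrite /c; case: z => x y; apply/eqP; rewrite eq_complex/=; apply/andP; split; apply/eqP; ring.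
have nC : n%:R != 0 :> R[i] by rewrite pnatr_eq0 -lt0n.
have oV : orthonormal_cols V.
  move=> l l'; rewrite /V.
  transitivity (n%:R^-1 * \sum_(j < n) cis (2 * pi * (l%:Z - l'%:Z)%:~R * j%:R / n%:R) : R[i]).
    rewrite mulr_sumr; apply: eq_bigr => j _.
    rewrite conjE -cisN opprK mulrACA cc -cisD; congr (_ * cis _).
    by rewrite intrB -!pmulrn; field.
  rewrite character_sum//; case: eqVneq => [->|ll].
    by rewrite subrr dvdz0 mulVf.
  rewrite ifF ?mulr0//; apply/negbTE; move: ll; rewrite -val_eqE/= => ll.
  have lt1 := ltn_ord l; have lt2 := ltn_ord l'.
  have {}ll : (l : nat) <> l' by apply/eqP.
  apply/negP => /dvdzP[q e].
  (* Two distinct indices below [n] differ by less than [n], so their difference is not a multiple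
     of [n]. *)
  have [q0|[q0|q0]] : q = 0 \/ (1 <= q)%R \/ (q <= -1)%R by lia.
  - by move: e; rewrite q0; lia.
  - by nia.
  - by nia.
pose Fh := act V (fun k => F k%:Z).
pose m j := symbol D (- (2 * pi * j%:R / n%:R)).
have Finv i : F i = \sum_(j < n) (c * cis (2 * pi * i%:~R * j%:R / n%:R)) *: Fh j.
  transitivity (\sum_(l < n) (n%:R^-1 * \sum_(j < n)
      cis (2 * pi * (i - l%:Z)%:~R * j%:R / n%:R)) *: F l%:Z); last first.
    under eq_bigr do rewrite mulr_sumr scaler_suml.
    rewrite exchange_big/=; apply: eq_bigr => j _.
    rewrite /Fh /act scaler_sumr; apply: eq_bigr => l _.
    rewrite scalerA /V mulrACA cc -cisD; congr ((_ * cis _) *: _).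
    by rewrite intrB -!pmulrn; field.
  have r0 : (0 <= (i %% n%:Z)%Z)%R by rewrite modz_ge0//; lia.
  have rn : ((i %% n%:Z)%Z < n%:Z)%R by have := ltz_pmod i (_ : 0 < n%:Z); apply; lia.
  have rr : (`|(i %% n%:Z)%Z| < n)%N by lia.
  rewrite (bigD1 (Ordinal rr))//= character_sum// ifT; last first.
    rewrite gez0_abs//; apply/dvdzP; exists (i %/ n%:Z)%Z.
    by rewrite {1}(divz_eq i n%:Z) addrK.
  rewrite mulVf// scale1r gez0_abs// -Fmod big1 ?addr0// => l lr.
  rewrite character_sum// ifF ?mulr0 ?scale0r//; apply/negbTE/negP => /dvdzP[q iq].
  move/negP: lr; apply; apply/eqP/val_inj => /=; have ll := ltn_ord l.
  have -> : i = q * n%:Z + l%:Z by rewrite -iq subrK.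
  rewrite modzMDl modz_small ?absz_nat//; lia.
have -> : (fun k : 'I_n => \sum_(e <- D) e.2 *: F (e.1 - k%:Z)) =
    act V (fun j => m j *: Fh j).
  apply/funext => k; rewrite /act.
  under eq_bigr do rewrite Finv scaler_sumr.
  rewrite exchange_big/=; apply: eq_bigr => j _.
  rewrite scalerA /m /symbol mulr_sumr scaler_suml; apply: eq_bigr => e _.
  rewrite scalerA; congr (_ *: _); rewrite /V [RHS]mulrCA; congr (_ * _).
  rewrite -[RHS]mulrA -cisD; congr (_ * cis _).
  by rewrite intrB -!pmulrn; field.
rewrite (gauss_energy_unitary hgam)//.
apply: (le_trans (@gauss_energy_multiplier n (fun j => m j) N Fh N0 (fun j => DN _))).
by rewrite (gauss_energy_unitary hgam).
Qed.

End gaussian_contraction.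

(** * Transference along the group *)

Lemma powRV (R : realType) (x s : R) : 0 < x -> x^-1 `^ s = (x `^ s)^-1.
Proof. by move=> x0; rewrite -(powR_inv1 (ltW x0)) -powRrM mulN1r powRN. Qed.

(* Hoelder's inequality, using [a i <= a i `^ (1 - q^-1)]. *)
Lemma weighted_hoelder (R : realType) (n : nat) (a t : 'I_n -> R) (q : R) : 1 < q ->
  (forall i, 0 < a i <= 1) -> (forall i, 0 <= t i) ->
  \sum_(i < n) a i * t i <=
    (\sum_(i < n) a i) `^ (1 - q^-1) * (\sum_(i < n) t i `^ q) `^ q^-1.
Proof.
move=> q1 a01 t0; have q0 : 0 < q by lra.
have a0 i : 0 <= a i by have /andP[/ltW] := a01 i.
have qV : q^-1 < 1 by rewrite invf_lt1.
set S := \sum_(i < n) a i; set Tq := \sum_(i < n) t i `^ q; set r := 1 - q^-1.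
have r0 : 0 < r by rewrite subr_gt0.
have [T0|Tn0] := eqVneq Tq 0.
  rewrite big1 ?mulr_ge0 ?powR_ge0// => i _.
  have /eqP : t i `^ q = 0.
    by apply: (psumr_eq0P _ T0) => // j _; exact: powR_ge0.
  by rewrite powR_eq0 => /andP[/eqP -> _]; rewrite mulr0.
have T0 : 0 < Tq by rewrite lt0r Tn0 sumr_ge0// => i _; exact: powR_ge0.
have [S0|Sn0] := eqVneq S 0.
  rewrite big1 ?mulr_ge0 ?powR_ge0// => i _.
  by rewrite (psumr_eq0P _ S0) ?mul0r.
have S0 : 0 < S by rewrite lt0r Sn0 sumr_ge0.
set T := Tq `^ q^-1; have Tp : 0 < T by rewrite powR_gt0.
have Srp : 0 < S `^ r by rewrite powR_gt0.
have TqE : T `^ q = Tq by rewrite -powRrM mulVf ?gt_eqF// powRr1// ltW.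
rewrite -[leRHS]mulr1 -ler_pdivrMl ?mulr_gt0// invfM mulr_sumr.
(* Young's inequality is applied to each term normalised by [S ^ r] and [T]; the bounds add up to
   [r + q^-1 = 1]. *)
apply: (@le_trans _ _ (\sum_(i < n) (r * (a i / S) + q^-1 * (t i `^ q / Tq)))); last first.
  rewrite big_split/= -!mulr_sumr -!mulr_suml !divff ?gt_eqF// !mulr1.
  by rewrite /r subrK.
apply: ler_sum => i _.
have aS : 0 <= a i / S by rewrite divr_ge0// ltW.
have tT : 0 <= t i / T by rewrite divr_ge0// ltW.
have := @conjugate_powR R ((a i / S) `^ r) (t i / T) r^-1 q (powR_ge0 _ _) tT.
rewrite invr_gt0 invrK /r subrK => /(_ r0 q0 erefl).
rewrite -powRrM mulfV ?gt_eqF// powRr1// => h.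
apply: le_trans (le_trans h _); last first.
  rewrite mulrC lerD// mulrC ler_wpM2l ?invr_ge0 ?(ltW q0)//.
  by rewrite powRM ?invr_ge0 ?(ltW Tp)// powRV// TqE.
rewrite -/r powRM ?invr_ge0 ?(ltW S0)//.
rewrite powRV//.
have -> : (S `^ r)^-1 / T * (a i * t i) = (t i * T^-1 * (S `^ r)^-1) * a i by ring.
have -> : a i `^ r / S `^ r * (t i / T) = (t i * T^-1 * (S `^ r)^-1) * a i `^ r by ring.
rewrite ler_wpM2l ?mulr_ge0 ?invr_ge0 ?powR_ge0//.
by rewrite ger1_powR// gerBl invr_ge0 ltW.
Qed.

Section cyclic.
Context (R : realType) (d : measure_display) (Om : measurableType d).
Variables (P : probability Om R) (gam : nat -> Om -> R[i]).
Hypothesis hgam : standard_complex_gaussians P gam.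
Variable X : normedModType R[i].

Lemma gauss_normE n (x : 'I_n -> X) :
  (gauss_norm P gam x = gauss_energy P gam x `^ 2^-1)%E.
Proof. by rewrite /gauss_norm unlock. Qed.

Lemma lp_norm_ge0 n p (x : 'I_n -> X) : 0 <= lp_norm p x.
Proof. exact: powR_ge0. Qed.

Lemma lp_norm_circulant n (D : seq (int * R[i])) (N p q t c : R) (F : int -> X) :
  (0 < n)%N -> (forall m, F (m + n%:Z) = F m) -> 0 <= N -> 0 <= c ->
  type_bound P gam X p t -> cotype_bound P gam X q c ->
  (forall xi, rnorm (symbol D xi : R[i]^o) <= N) ->
  lp_norm q (fun k : 'I_n => \sum_(e <- D) e.2 *: F (e.1 - k%:Z)) <=
    c * (N * (t * lp_norm p (fun k : 'I_n => F k%:Z))).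
Proof.
move=> n0 Fn N0 c0 ht hc DN; rewrite -lee_fin.
apply: (le_trans (hc _ _)); rewrite EFinM lee_wpmul2l ?lee_fin//.
apply: (@le_trans _ _ (N%:E * gauss_norm P gam (fun k : 'I_n => F k%:Z)))%E; last first.
  by rewrite [leRHS]EFinM lee_wpmul2l ?lee_fin//; exact: ht.
rewrite !gauss_normE.
have -> : N%:E = ((N ^+ 2)%:E `^ 2^-1)%E.
  by rewrite poweR_EFin powR12_sqrt ?sqr_ge0// sqrtr_sqr ger0_norm.
rewrite -poweRM ?lee_fin ?sqr_ge0 ?gauss_energy_ge0//.
apply: gt0_ler_poweR.
- by rewrite invr_ge0.
- by rewrite in_itv/= leey andbT gauss_energy_ge0.
- by rewrite in_itv/= leey andbT mule_ge0 ?lee_fin ?sqr_ge0 ?gauss_energy_ge0.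
- exact: gauss_energy_circulant.
Qed.

End cyclic.

Section resolvent_sums.
Variables (R : realType) (a : R).

Lemma geometric_sum_le n : 0 <= a < 1 -> \sum_(i < n) a ^+ i <= (1 - a)^-1.
Proof.
move=> /andP[a0 a1]; rewrite -[leRHS]mul1r ler_pdivlMr ?subr_gt0// mulrC.
have := subrX1 a n; have := exprn_ge0 n a0; lra.
Qed.

Lemma geometric_sum2_le K : 0 <= a < 1 ->
  \sum_(i < (K + K).+1) a ^+ `|(i%:Z - K%:Z)%R|%N <= 2 / (1 - a).
Proof.
move=> a01; have /andP[a0 a1] := a01; rewrite -addnS big_split_ord/= mulr2n mulrDl mul1r lerD//.
  apply: le_trans (geometric_sum_le K a01); rewrite (reindex_inj rev_ord_inj)/=.
  apply: ler_sum => i _; apply: ler_wiXn2l => //; first exact: ltW.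
  by have := ltn_ord i; lia.
apply: le_trans (geometric_sum_le K.+1 a01); apply: ler_sum => i _.
by rewrite PoszD addrAC subrr add0r.
Qed.

Variable w : nat -> R.
Let phi i := (1 + a ^+ 2) * w i.+1 - a * (w i.+2 + w i).

(** The second difference annihilates the geometric kernel away from its peak, so each one-sided sum
    telescopes. [phi i] is centred at [w i.+1], whence the shifts by one. *)
Let sum_left j : \sum_(i < j) a ^+ (j - i) * phi i =
  a * (w j - a * w j.+1) - a ^+ j.+1 * (w 0 - a * w 1).
Proof.
elim: j => [|j ih]; first by rewrite big_ord0; ring.
rewrite big_ord_recr/= subSnn.
have -> : \sum_(i < j) a ^+ (j.+1 - i) * phi i = a * \sum_(i < j) a ^+ (j - i) * phi i.
  by rewrite mulr_sumr; apply: eq_bigr => i _; rewrite subSn ?exprS ?mulrA// ltnW.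
by rewrite ih /phi !exprS; ring.
Qed.

Let sum_right j n : \sum_(i < n) a ^+ i * phi (j + i)%N =
  (w j.+1 - a * w j) - a ^+ n * (w (j + n).+1 - a * w (j + n)%N).
Proof.
elim: n => [|n ih]; first by rewrite big_ord0 addn0; ring.
by rewrite big_ord_recr/= ih /phi !addnS [a ^+ n.+1]exprS; ring.
Qed.

Lemma resolvent_sum j n : \sum_(i < j + n) a ^+ `|(j%:Z - i%:Z)%R|%N * phi i =
  (1 - a ^+ 2) * w j.+1 - a ^+ n * (w (j + n).+1 - a * w (j + n)%N)
  - a ^+ j.+1 * (w 0 - a * w 1).
Proof.
rewrite big_split_ord/=.
have -> : \sum_(i < j) a ^+ `|(j%:Z - i%:Z)%R|%N * phi i = \sum_(i < j) a ^+ (j - i) * phi i.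
  by apply: eq_bigr => i _; have := ltn_ord i => ?; congr (_ ^+ _ * _); lia.
have -> : \sum_(i < n) a ^+ `|(j%:Z - (j + i)%N%:Z)%R|%N * phi (j + i)%N =
    \sum_(i < n) a ^+ i * phi (j + i)%N.
  by apply: eq_bigr => i _; congr (_ ^+ _ * _); lia.
by rewrite sum_left sum_right; ring.
Qed.

End resolvent_sums.

(* [a ^+ `|k| / (1 - a ^+ 2)] is the Green function of the second difference operator
   [v |-> (1 + a ^+ 2) * v k - a * (v (k + 1) + v (k - 1))], so that [v] is the
   convolution of its density with [a ^+ `|k|]. *)
Definition resolvent_density (R : realType) (a : R) (v : int -> R) (k : int) : R :=
  ((1 + a ^+ 2) * v k - a * (v (k + 1) + v (k - 1))) / (1 - a ^+ 2).

(** A window of radius [K] reproduces [v m] up to the two boundary terms of [resolvent_sum], each at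
    most a multiple of [a ^ (K - |m|)]. *)
Lemma resolvent_density_sum (R : realType) (a V : R) (v : int -> R) (K : nat) (m : int) :
  0 < a < 1 -> (forall k, `|v k| <= V) -> (`|m| <= K)%N ->
  `|\sum_(i < (K + K).+1) resolvent_density a v (i%:Z - K%:Z) * a ^+ `|(m - (i%:Z - K%:Z))%R|%N
    - v m| <= 4 * V / (1 - a ^+ 2) / a ^+ `|m|%N * a ^+ K.
Proof.
move=> /andP[a0 a1] vV mK.
have V0 : 0 <= V by apply: le_trans (vV 0).
have a2 : 0 < 1 - a ^+ 2 by rewrite subr_gt0 expr_lt1// ltW.
(* [w 0] is the point just left of the window, which the second difference at the left end
   involves. *)
pose w i := v (i%:Z - 1 - K%:Z).
have [j jE] : exists j : nat, j%:Z = m + K%:Z by exists `|(m + K%:Z)%R|%N; lia.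
have jK : (j <= K + K)%N by lia.
pose n := ((K + K).+1 - j)%N.
have nE : (j + n = (K + K).+1)%N by rewrite /n subnKC// ltnW.
have -> : \sum_(i < (K + K).+1) resolvent_density a v (i%:Z - K%:Z) *
      a ^+ `|(m - (i%:Z - K%:Z))%R|%N =
    (\sum_(i < j + n) a ^+ `|(j%:Z - i%:Z)%R|%N *
      ((1 + a ^+ 2) * w i.+1 - a * (w i.+2 + w i))) / (1 - a ^+ 2).
  rewrite nE mulr_suml; apply: eq_bigr => i _; rewrite mulrC -[RHS]mulrA; congr (a ^+ _ * _).
    by rewrite jE; lia.
  rewrite /resolvent_density /w; congr (((_ * v _) - _ * (v _ + v _)) / _); lia.
rewrite resolvent_sum nE.
have -> : v m = w j.+1 by rewrite /w; congr v; lia.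
set x := w (K + K).+2 - _; set y := w 0 - _.
have -> : ((1 - a ^+ 2) * w j.+1 - a ^+ n * x - a ^+ j.+1 * y) / (1 - a ^+ 2) - w j.+1 =
   - (a ^+ n * x + a ^+ j.+1 * y) / (1 - a ^+ 2).
  by field; rewrite gt_eqF.
rewrite normrM normrN [X in _ * X]gtr0_norm ?invr_gt0//.
have -> : 4 * V / (1 - a ^+ 2) / a ^+ `|m|%N * a ^+ K =
   (4 * V * (a ^+ K / a ^+ `|m|%N)) / (1 - a ^+ 2) by ring.
rewrite ler_pM2r ?invr_gt0//.
rewrite -expfB_cond ?(gt_eqF a0)//.
have wV i i' : `|w i - a * w i'| <= 2 * V.
  apply: le_trans (ler_normB _ _) _; rewrite normrM (gtr0_norm a0).
  have := vV (i%:Z - 1 - K%:Z); have := vV (i'%:Z - 1 - K%:Z); rewrite -!/(w _) => h1 h2.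
  have : a * `|w i'| <= 1 * V by rewrite ler_pM// ltW.
  lra.
apply: le_trans (ler_normD _ _) _; rewrite !normrM !normrX (gtr0_norm a0).
have e1 : a ^+ n <= a ^+ (K - `|m|) by rewrite ler_wiXn2l ?(ltW a0) ?(ltW a1)//; lia.
have e2 : a ^+ j.+1 <= a ^+ (K - `|m|) by rewrite ler_wiXn2l ?(ltW a0) ?(ltW a1)//; lia.
have : a ^+ n * `|x| <= a ^+ (K - `|m|) * (2 * V).
  by apply: ler_pM => //; [rewrite exprn_ge0// ltW|exact: wV].
have : a ^+ j.+1 * `|y| <= a ^+ (K - `|m|) * (2 * V).
  by apply: ler_pM => //; [rewrite exprn_ge0// ltW|exact: wV].
lra.
Qed.

Lemma le_geometric_error (R : realType) (a x y E : R) (L : nat) : 0 <= a < 1 ->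
  (forall K, (L <= K)%N -> x <= y + E * a ^+ K) -> x <= y.
Proof.
move=> /andP[a0 a1] h.
have c : (fun K => y + E * a ^+ K) @ \oo --> y.
  rewrite -[X in _ --> X]addr0; apply: cvgD; first exact: cvg_cst.
  rewrite -[X in _ --> X](mulr0 E); apply: cvgM; first exact: cvg_cst.
  by apply: cvg_expr; rewrite ger0_norm.
apply: (ler_cvg_to (cvg_cst x) c).
by near=> K; apply: h; near: K; exact: nbhs_infty_ge.
Unshelve. all: by end_near. Qed.

(** A translation multiplies the symbol by a unit number only; it serves to move all indices of a
    convolution into one period. *)
Definition shift_seq (R : realType) (s : int) (D : seq (int * R[i])) : seq (int * R[i]) :=
  [seq (e.1 + s, e.2) | e <- D].

Lemma symbol_shift (R : realType) (s : int) (D : seq (int * R[i])) xi :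
  symbol (shift_seq s D) xi = cis (- (xi * s%:~R)) * symbol D xi.
Proof.
rewrite /symbol big_map mulr_sumr; apply: eq_bigr => e _ /=.
by rewrite intrD mulrDr opprD cisD mulrCA mulrC [_ * cis (- (xi * s%:~R))]mulrC mulrA.
Qed.

Lemma seq_support_bound (R : realType) (D : seq (int * R[i])) :
  exists L : nat, forall e, e \in D -> (`|e.1| <= L)%N.
Proof.
exists (\max_(e <- D) `|e.1|)%N => e eD.
exact: (@leq_bigmax_seq _ _ (fun=> true) (fun e => `|e.1|%N) e eD isT).
Qed.

Section transference.
Context (R : realType) (d : measure_display) (Om : measurableType d).
Variables (P : probability Om R) (gam : nat -> Om -> R[i]).
Hypothesis hgam : standard_complex_gaussians P gam.
Variables (X : normedModType R[i]) (V : int -> {linear X -> X}).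
Hypothesis hV : forall k l x, V (k + l) x = V k (V l x).
Variables (p q t c : R).
Hypotheses (hp : 1 <= p) (hq : 1 < q) (c0 : 0 <= c).
Hypotheses (ht : type_bound P gam X p t) (hc : cotype_bound P gam X q c).
Variables (a b G M : R) (C : int -> R).
Hypotheses (a0 : 0 < a) (ab : a <= b) (b1 : b < 1) (bG : 2 / (1 - b) <= G).
Hypothesis M0 : 0 <= M.
Hypothesis VM : forall k y, rnorm (V k y) <= M * C k * rnorm y.
Hypothesis Cb : forall k : int, a ^+ `|k|%N * C k <= b ^+ `|k|%N.

Variables (D : seq (int * R[i])) (N : R) (N0 : 0 <= N).
Hypothesis DN : forall xi, rnorm (symbol D xi : R[i]^o) <= N.
Variables (z : X) (B : R) (B0 : 0 <= B).
Hypothesis zB : forall l, rnorm (V l z) <= B * C l.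

Let a1 : a < 1. Proof. exact: le_lt_trans b1. Qed.
Let b0 : 0 < b. Proof. exact: lt_le_trans ab. Qed.
Let p0 : 0 < p. Proof. exact: lt_le_trans hp. Qed.
Let q0 : 0 < q. Proof. exact: lt_trans hq. Qed.
Let G0 : 0 <= G.
Proof. by apply: le_trans bG; rewrite divr_ge0// subr_ge0 ltW. Qed.

Let f (l : int) : X := (a ^+ `|l|%N)%:C *: V l z.

(* For indices at most [K] the convolution is computed on a cyclic group so large
   that it does not wrap around. *)
Let convolution_bound K :
  (\sum_(i < (K + K).+1) rnorm (\sum_(e <- D) e.2 *: f (e.1 - (i%:Z - K%:Z))) `^ q) `^ q^-1
  <= c * (N * (t * (B * G `^ p^-1))) \/ t < 0.
Proof.
have [t0|t0] := leP 0 t; last by right.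
left; have [L DL] := seq_support_bound D.
(* [f] is evaluated at differences of a support point of size at most [L] and an index of size at
   most [K]; one period covers [[-Q, Q]]. *)
pose Q := (K + L)%N; pose n := (Q + Q).+1.
pose F (j : int) := f ((j %% n%:Z)%Z - Q%:Z).
have Fs j : (0 <= j)%R -> (j < n%:Z)%R -> F j = f (j - Q%:Z).
  by move=> j0 jn; rewrite /F modz_small// j0.
have Fn m : F (m + n%:Z) = F m by rewrite /F modzDr.
(* With the shift by [Q + K], the index [e.1 + (Q + K) - i] lies between 0 and [2 Q] for [i <= 2 K],
   so reduction modulo [n] leaves it unchanged. *)
have := @lp_norm_circulant R d Om P gam hgam X n (shift_seq (Q + K)%N%:Z D) N p q t c F
  isT Fn N0 c0 ht hc.
have sN xi : rnorm (symbol (shift_seq (Q + K)%N%:Z D) xi : R[i]^o) <= N.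
  by rewrite symbol_shift (@rnormM R) rnorm_cis mul1r.
move=> /(_ sN) h.
have h1 : lp_norm p (fun k : 'I_n => F k%:Z) <= B * G `^ p^-1.
  rewrite /lp_norm.
  have -> : B * G `^ p^-1 = (B `^ p * G) `^ p^-1.
    by rewrite powRM ?powR_ge0// -powRrM divff ?powRr1// gt_eqF.
  rewrite ge0_ler_powR ?invr_ge0 ?nnegrE ?mulr_ge0 ?powR_ge0 ?(ltW p0)//.
    by apply: sumr_ge0 => i _; exact: powR_ge0.
  apply: (@le_trans _ _ (\sum_(i < n) B `^ p * b ^+ `|(i%:Z - Q%:Z)%R|%N)); last first.
    rewrite -mulr_sumr ler_wpM2l ?powR_ge0//; apply: le_trans bG.
    by apply: geometric_sum2_le; rewrite (ltW b0).
  apply: ler_sum => i _; rewrite Fs ?ltz_nat//.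
  set l := i%:Z - Q%:Z.
  have bl0 : 0 < b ^+ `|l|%N by rewrite exprn_gt0.
  apply: (@le_trans _ _ ((B * b ^+ `|l|%N) `^ p)).
    rewrite ge0_ler_powR ?nnegrE ?mulr_ge0 ?rnorm_ge0 ?(ltW bl0) ?(ltW p0)//.
    rewrite /f rnorm_real ger0_norm ?exprn_ge0 ?(ltW a0)//.
    apply: (@le_trans _ _ (a ^+ `|l|%N * (B * C l))).
      by rewrite ler_wpM2l ?exprn_ge0 ?(ltW a0)//; exact: zB.
    by rewrite mulrCA ler_wpM2l.
  (* As [p >= 1] and [b < 1], the power [p] of [b^|l|] may be dropped, so that the single constant
     [G] bounds all geometric sums. *)
  rewrite powRM ?(ltW bl0)// ler_wpM2l ?powR_ge0// ge1r_powR// bl0/=.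
  by rewrite exprn_ile1// ltW.
apply: (@le_trans _ _ (c * (N * (t * lp_norm p (fun k : 'I_n => F k%:Z))))); last first.
  by rewrite !ler_wpM2l.
apply: le_trans h; rewrite /lp_norm.
rewrite ge0_ler_powR ?invr_ge0 ?nnegrE ?(ltW q0)//.
- by apply: sumr_ge0 => i _; exact: powR_ge0.
- by apply: sumr_ge0 => i _; exact: powR_ge0.
have Kn : ((K + K).+1 <= n)%N by rewrite ltnS leq_add ?leq_addr.
rewrite (big_ord_widen n (fun i => rnorm (\sum_(e <- D) e.2 *: f (e.1 - (i%:Z - K%:Z))) `^ q))//.
rewrite big_mkcond; apply: ler_sum => i _; case: ifP => iK; last exact: powR_ge0.
rewrite le_eqVlt; apply/orP; left; apply/eqP; congr (rnorm _ `^ _).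
rewrite big_map; apply: eq_big_seq => e eD /=; congr (_ *: _).
have aux (m : int) (i' : nat) : (`|m| <= L)%N -> (i' < (K + K).+1)%N ->
    f (m - (i'%:Z - K%:Z)) = F (m + (Q + K)%N%:Z - i'%:Z).
  move=> mL iK'; have r0 : (0 <= m + (Q + K)%N%:Z - i'%:Z)%R.
    by rewrite /Q; clear -iK' mL; lia.
  have rn : (m + (Q + K)%N%:Z - i'%:Z < n%:Z)%R by rewrite /n /Q; clear -iK' mL; lia.
  by rewrite (Fs _ r0 rn); congr f; rewrite /Q; clear; lia.
by rewrite aux//; exact: DL.
Qed.

Variables (v : int -> R) (Vb H : R).
Hypotheses (vb : forall k, `|v k| <= Vb) (H0 : 0 <= H).
Hypothesis vH : forall k : int, `|resolvent_density a v k| * C k <= H * a ^+ `|k|%N.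

(** Insert [v m = \sum_k phi k a^|m - k|] and [V m = V k (V (m - k))]: the sum becomes
    [\sum_k phi k V k (g k)], where [g] correlates [D] with [l |-> a^|l| V l z]. The operators
    [phi k V k] have norm at most [M H a^|k|]. Hoelder with these weights yields [G ^ (1 - 1/q)],
    and the [l^p] norm of the second factor of the correlation yields [G ^ (1/p)]. *)
Lemma transference : 0 <= t ->
  rnorm (\sum_(e <- D) (e.2 * (v e.1)%:C) *: V e.1 z) <=
  M * H * (G `^ (1 - q^-1) * (c * (N * (t * (B * G `^ p^-1))))).
Proof.
move=> t0; have [L DL] := seq_support_bound D.
(* [vK] rebuilds [v] from a window of radius [K]; the resulting error [E * a ^ K] disappears through
   [le_geometric_error]. *)
pose vK K m := \sum_(i < (K + K).+1) resolvent_density a v (i%:Z - K%:Z) *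
  a ^+ `|(m - (i%:Z - K%:Z))%R|%N.
pose E := \sum_(e <- D) rnorm (e.2 : R[i]^o) *
  (4 * Vb / (1 - a ^+ 2) / a ^+ `|e.1|%N) * rnorm (V e.1 z).
apply: (@le_geometric_error R a _ _ E L) => [|K LK]; first by rewrite (ltW a0).
have -> : \sum_(e <- D) (e.2 * (v e.1)%:C) *: V e.1 z =
    \sum_(e <- D) (e.2 * (vK K e.1)%:C) *: V e.1 z -
    \sum_(e <- D) (e.2 * (vK K e.1 - v e.1)%:C) *: V e.1 z.
  rewrite -sumrB; apply: eq_bigr => e _; rewrite -scalerBl -mulrBr -rmorphB/=.
  by rewrite opprB addrCA subrr addr0.
apply: le_trans (rnormB _ _) _; rewrite lerD//; last first.
  apply: le_trans (rnorm_sum _ _ _) _; rewrite /E mulr_suml big_seq [leRHS]big_seq.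
  apply: ler_sum => e eD; rewrite rnormZ (@rnormM R) rnormR -!mulrA ler_wpM2l ?rnorm_ge0//.
  rewrite [rnorm _ * _]mulrC !mulrA ler_wpM2r ?rnorm_ge0//.
  apply: resolvent_density_sum => //; first by rewrite a0.
  by apply: leq_trans LK; exact: DL.
pose g (i : nat) := \sum_(e <- D) e.2 *: f (e.1 - (i%:Z - K%:Z)).
have -> : \sum_(e <- D) (e.2 * (vK K e.1)%:C) *: V e.1 z =
    \sum_(i < (K + K).+1) (resolvent_density a v (i%:Z - K%:Z))%:C *: V (i%:Z - K%:Z) (g i).
  under eq_bigr do rewrite /vK rmorph_sum mulr_sumr scaler_suml.
  rewrite exchange_big/=; apply: eq_bigr => i _.
  rewrite /g linear_sum scaler_sumr; apply: eq_bigr => e _.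
  rewrite /f linearZ/= [V _ (_ *: _)]linearZ/= -hV [i%:Z - _ + _]addrC subrK !scalerA.
  by rewrite rmorphM/= mulrCA mulrA.
apply: le_trans (rnorm_sum _ _ _) _.
apply: (@le_trans _ _ (M * H * \sum_(i < (K + K).+1) a ^+ `|(i%:Z - K%:Z)%R|%N * rnorm (g i))).
  rewrite mulr_sumr; apply: ler_sum => i _; rewrite rnorm_real.
  apply: (@le_trans _ _ (`|resolvent_density a v (i%:Z - K%:Z)| *
     (M * C (i%:Z - K%:Z) * rnorm (g i)))).
    by rewrite ler_wpM2l.
  rewrite !mulrA ler_wpM2r ?rnorm_ge0// mulrAC [_ * M]mulrC mulrAC -!mulrA ler_wpM2l//.
  by rewrite [leRHS]mulrC.
rewrite ler_wpM2l ?mulr_ge0//.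
apply: le_trans (@weighted_hoelder R _ (fun i : 'I_(K + K).+1 => a ^+ `|(i%:Z - K%:Z)%R|%N)
  (fun i => rnorm (g i)) q hq _ _) _ => [i|i|].
- by rewrite exprn_gt0//= exprn_ile1// ltW.
- exact: rnorm_ge0.
have [h|] := convolution_bound K; last by rewrite ltNge t0.
apply: ler_pM; rewrite ?powR_ge0//.
rewrite ge0_ler_powR ?nnegrE//.
- by rewrite subr_ge0 invf_le1 ?(ltW hq).
- by apply: sumr_ge0 => i _; rewrite exprn_ge0// ltW.
apply: le_trans (le_trans (geometric_sum2_le K _) _) bG; first by rewrite (ltW a0).
by rewrite ler_wpM2l// lef_pV2 ?posrE ?subr_gt0// lerB.
Qed.

End transference.

(** * The weight [1 / cosh] and its second differences *)

Section cosh.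
Context {R : realType}.
Implicit Types x y b : R.

Lemma cosh_gt0 x : 0 < cosh x.
Proof. by rewrite divr_gt0// addr_gt0// expR_gt0. Qed.

Lemma cosh0 : cosh (0 : R) = 1.
Proof. by rewrite /cosh oppr0 expR0 divff. Qed.

Lemma coshN x : cosh (- x) = cosh x.
Proof. by rewrite /cosh opprK addrC. Qed.

Lemma cosh_norm x : cosh `|x| = cosh x.
Proof. by case: (ger0P x) => _; rewrite ?coshN. Qed.

Lemma ler_cosh_norm x y : `|x| <= `|y| -> cosh x <= cosh y.
Proof.
rewrite -(cosh_norm x) -(cosh_norm y); move: `|x| `|y| (normr_ge0 x) => {}x {}y x0 xy.
rewrite ler_pM2r ?invr_gt0// !expRN.
have ex := expR_gt0 x; have ey := expR_gt0 y.
have ex1 : 1 <= expR x by rewrite -expR0 ler_expR.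
have exy : expR x <= expR y by rewrite ler_expR.
have -> : expR y + (expR y)^-1 = expR x + (expR x)^-1 +
    (expR y - expR x) * (1 - (expR x * expR y)^-1).
  by field; rewrite !gt_eqF.
rewrite lerDl mulr_ge0 ?subr_ge0// invf_le1 ?mulr_gt0//.
by rewrite -[1]mulr1 ler_pM//; lra.
Qed.

Lemma cosh_ge1 x : 1 <= cosh x.
Proof. by rewrite -cosh0 ler_cosh_norm// normr0. Qed.

Lemma cosh_le_expR x : cosh x <= expR `|x|.
Proof.
rewrite -cosh_norm /cosh; have : expR (- `|x|) <= expR `|x|.
  by rewrite ler_expR; have := normr_ge0 x; lra.
lra.
Qed.

Lemma expR_le_cosh x : expR `|x| <= 2 * cosh x.
Proof. by rewrite -cosh_norm /cosh; have := expR_gt0 (- `|x|); lra. Qed.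

Lemma coshD_le x y : cosh (x + y) <= expR `|y| * cosh x.
Proof.
rewrite /cosh opprD !expRD mulrA ler_pM2r ?invr_gt0// mulrDr lerD//.
  by rewrite mulrC ler_wpM2r ?expR_ge0// ler_expR ler_norm.
by rewrite mulrC ler_wpM2r ?expR_ge0// ler_expR -normrN ler_norm.
Qed.

Lemma expR_dist x y : `|expR x - expR y| <= `|x - y| * (expR x + expR y).
Proof.
wlog xy : x y / x <= y.
  move=> h; have /orP[|yx] := le_total x y; first exact: h.
  by rewrite (distrC (expR x)) (distrC x) (addrC (expR x)) h.
have exy : expR x <= expR y by rewrite ler_expR.
rewrite (distrC (expR x)) (distrC x) !ger0_norm ?subr_ge0//.
have h := expR_ge1Dx (x - y).
have : expR y * (1 + (x - y)) <= expR y * expR (x - y) by rewrite ler_wpM2l ?expR_ge0.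
rewrite -expRD [y + _]addrC subrK => h2.
have : 0 <= (y - x) * expR x by rewrite mulr_ge0 ?subr_ge0 ?expR_ge0.
nra.
Qed.

Lemma cosh_dist x y : `|cosh x - cosh y| <= `|x - y| * (cosh x + cosh y).
Proof.
have h1 := expR_dist x y; have h2 := expR_dist (- x) (- y).
have e : `|- x - - y| = `|x - y| by rewrite -opprD normrN.
rewrite e in h2; have := ler_normD (expR x - expR y) (expR (- x) - expR (- y)).
have -> : cosh x - cosh y = (expR x - expR y + (expR (- x) - expR (- y))) / 2.
  by rewrite /cosh; field.
rewrite normrM [X in _ * X]gtr0_norm ?invr_gt0// /cosh.
by lra.
Qed.

Lemma one_minus_expRN x : x * expR (- x) <= 1 - expR (- x) <= x.
Proof.
have h1 := expR_ge1Dx (- x); have h2 := expR_ge1Dx x; have e := expR_gt0 (- x).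
have : (1 + x) * expR (- x) <= expR x * expR (- x) by rewrite ler_pM2r.
by rewrite -expRD subrr expR0 => h3; apply/andP; split; lra.
Qed.

End cosh.

Section weight.
Context {R : realType}.
Variables (omega h : R).
Hypotheses (omega0 : 0 < omega) (h01 : 0 < h <= 1).

Definition weight s : R := (cosh (omega * s))^-1.

Lemma weight_gt0 s : 0 < weight s.
Proof. by rewrite invr_gt0 cosh_gt0. Qed.

Lemma weight_le1 s : weight s <= 1.
Proof. by rewrite invf_le1 ?cosh_gt0// cosh_ge1. Qed.

Lemma weightD s t : weight (s + t) <= expR (omega * `|t|) * weight s.
Proof.
rewrite /weight ler_pdivlMr ?cosh_gt0// mulrC ler_pdivrMr ?cosh_gt0//.
have := coshD_le (omega * (s + t)) (omega * - t).
by rewrite -mulrDr addrK normrM normrN (gtr0_norm omega0).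
Qed.

Lemma weight_le_expR s : weight s <= 2 * expR (- (omega * `|s|)).
Proof.
rewrite expRN -[omega]gtr0_norm// -normrM -ler_pdivrMl// -invfM lef_pV2 ?posrE ?mulr_gt0 ?cosh_gt0 ?addr_gt0 ?invr_gt0 ?expR_gt0//.
exact: expR_le_cosh.
Qed.

Lemma weight_dist s t : `|weight s - weight t| <= 2 * (omega * `|s - t|).
Proof.
have cs := cosh_gt0 (omega * s); have ct := cosh_gt0 (omega * t).
have -> : weight s - weight t = (cosh (omega * t) - cosh (omega * s)) * (weight s * weight t).
  by rewrite /weight; field; rewrite !gt_eqF.
rewrite normrM [X in _ * X]gtr0_norm ?mulr_gt0 ?weight_gt0//.
apply: (@le_trans _ _ ((omega * `|s - t|) * (cosh (omega * t) + cosh (omega * s)) *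
    (weight s * weight t))).
  rewrite ler_wpM2r ?mulr_ge0 ?(ltW (weight_gt0 _))//.
  have := cosh_dist (omega * t) (omega * s).
  by rewrite -mulrBr normrM (gtr0_norm omega0) (distrC t).
have -> : omega * `|s - t| * (cosh (omega * t) + cosh (omega * s)) * (weight s * weight t) =
    (weight s + weight t) * (omega * `|s - t|).
  by rewrite /weight; field; rewrite !gt_eqF.
rewrite ler_wpM2r ?mulr_ge0 ?(ltW omega0)//.
by have := weight_le1 s; have := weight_le1 t; lra.
Qed.

Let a := expR (- (omega * h)).
Let wk (k : int) := weight (k%:~R * h).
Let S := (a ^- 2 - a ^+ 2) / 4.

Let h0 : 0 < h. Proof. by case/andP: h01. Qed.
Let h1 : h <= 1. Proof. by case/andP: h01. Qed.
Let b0 : 0 < omega * h. Proof. exact: mulr_gt0. Qed.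
Let bo : omega * h <= omega. Proof. by rewrite ger_pMr. Qed.
Let a0 : 0 < a. Proof. exact: expR_gt0. Qed.
Let a1 : a < 1. Proof. by rewrite expR_lt1 oppr_lt0. Qed.

(** Put [b = omega h], so that [1 + a^2 = 2 a cosh b]. By [cosh (x + b) + cosh (x - b) = 2 cosh x
    cosh b] and [cosh (x + b) cosh (x - b) = cosh^2 x + sinh^2 b], the second difference collapses
    to a single product; [S] is [sinh (2 b) / 2]. *)
Lemma weight_density k : resolvent_density a wk k = S * wk (k - 1) * wk k * wk (k + 1).
Proof.
pose E := expR (omega * (k%:~R * h)); have E0 : 0 < E := expR_gt0 _.
have e1 : cosh (omega * (k%:~R * h)) = (E + E^-1) / 2 by rewrite /cosh expRN.
have e2 : cosh (omega * ((k + 1)%:~R * h)) = (E / a + a / E) / 2.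
  rewrite /cosh /E /a -!expRN -!expRD intrD; congr ((expR _ + expR _) / _); ring.
have e3 : cosh (omega * ((k - 1)%:~R * h)) = (E * a + (E * a)^-1) / 2.
  rewrite /cosh /E /a -expRD -expRN intrB; congr ((expR _ + expR _) / _); ring.
rewrite /resolvent_density /wk /weight e1 e2 e3 /S.
have p1 : 0 < 1 - a ^+ 2 by rewrite subr_gt0 expr_lt1// ltW.
have p2 : 0 < E ^+ 2 + 1 by rewrite ltr_wpDl// sqr_ge0.
have p3 : 0 < E ^+ 2 + a ^+ 2 by rewrite ltr_wpDl ?exprn_gt0// sqr_ge0.
have p4 : 0 < (E * a) ^+ 2 + 1 by rewrite ltr_wpDl// sqr_ge0.
have -> : (E + E^-1) / 2 = (E ^+ 2 + 1) / (2 * E) by field; rewrite gt_eqF.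
have -> : (E / a + a / E) / 2 = (E ^+ 2 + a ^+ 2) / (2 * E * a) by field; rewrite !gt_eqF.
have -> : (E * a + (E * a)^-1) / 2 = ((E * a) ^+ 2 + 1) / (2 * E * a).
  by field; rewrite !gt_eqF.
by field; rewrite !gt_eqF.
Qed.

(** The bound rests on [1 - exp (- 4 omega h) <= 4 omega h] and [h <= 1]. This one power of [h]
    offsets the [1/h] grid points per unit length. *)
Lemma weight_density_coef : 0 <= S <= omega * h * expR (2 * omega).
Proof.
have aa : a ^- 2 = expR (2 * (omega * h)).
  by rewrite /a expRN exprVn invrK -expRM_natl.
have a2 : a ^+ 2 = expR (2 * (omega * h)) * expR (- (4 * (omega * h))).
  by rewrite -expRD /a -expRM_natl; congr expR; ring.
have /andP[_ e2] := one_minus_expRN (4 * (omega * h)).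
have e3 : expR (2 * (omega * h)) <= expR (2 * omega) by rewrite ler_expR ler_pM2l.
have e4 : expR (- (4 * (omega * h))) <= 1 by rewrite expR_le1 oppr_le0 mulr_ge0// ltW.
have e5 := expR_gt0 (2 * (omega * h)).
rewrite /S aa a2; set x := expR (2 * (omega * h)) in e3 e5 *.
set y := expR (- (4 * (omega * h))) in e2 e4 *.
have : 0 <= x * (1 - y) by rewrite mulr_ge0// ?subr_ge0// ltW.
have : x * (1 - y) <= expR (2 * omega) * (4 * (omega * h)).
  by rewrite ler_pM// ?subr_ge0// ltW.
by move=> g1 g2; apply/andP; split; lra.
Qed.

Let wk0 k : 0 <= wk k. Proof. exact/ltW/weight_gt0. Qed.

Lemma weight_int_le k : wk k <= 2 * a ^+ `|k|%N.
Proof.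
apply: (le_trans (weight_le_expR _)); rewrite /a -expRM_natl ler_pM2l// ler_expR.
by rewrite natr_absz intr_norm normrM (gtr0_norm h0) mulrN mulrCA.
Qed.

Lemma weight_int_shift k (s : int) : (`|s| <= 1)%N -> wk (k + s) <= 2 * expR omega * a ^+ `|k|%N.
Proof.
move=> s1; rewrite /wk intrD mulrDl; apply: (le_trans (weightD _ _)).
have -> : 2 * expR omega * a ^+ `|k|%N = expR omega * (2 * a ^+ `|k|%N) by ring.
apply: ler_pM; rewrite ?expR_ge0 ?wk0//; last exact: weight_int_le.
rewrite ler_expR -[leRHS]mulr1 ler_pM2l// normrM (gtr0_norm h0) -intr_norm -natr_absz.
by rewrite mulr_ile1 ?(ltW h0)// lern1.
Qed.

End weight.

Lemma resolvent_densityB (R : realType) (a : R) (v w : int -> R) k :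
  resolvent_density a (fun k => v k - w k) k =
  resolvent_density a v k - resolvent_density a w k.
Proof. by rewrite /resolvent_density -mulrBl; congr (_ / _); ring. Qed.

Section weighted_transference.
Context (R : realType) (d : measure_display) (Om : measurableType d).
Variables (P : probability Om R) (gam : nat -> Om -> R[i]).
Hypothesis hgam : standard_complex_gaussians P gam.
Variables (X : normedModType R[i]) (U : R -> {linear X -> X}).
Hypothesis UD : forall s t x, U (s + t) x = U s (U t x).
Variables (omega omega0 p q t c M : R).
Hypotheses (homega0 : 0 <= omega0) (homega : omega0 < omega).
Hypothesis UM : forall s x, rnorm (U s x) <= M * cosh (omega0 * s) * rnorm x.
Hypotheses (hp : 1 <= p) (hq : 1 < q) (c0 : 0 <= c) (t0 : 0 <= t) (M0 : 0 <= M).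
Hypotheses (ht : type_bound P gam X p t) (hc : cotype_bound P gam X q c).
Variables (h : R) (h01 : 0 < h <= 1).
Variables (D : seq (int * R[i])) (N : R) (N0 : 0 <= N).
Hypothesis DN : forall xi, rnorm (symbol D xi : R[i]^o) <= N.
Variables (z : X) (B : R) (B0 : 0 <= B).
Hypothesis zB : forall l : int, rnorm (U (l%:~R * h) z) <= B * cosh (omega0 * (l%:~R * h)).

(** The base of the power is [C1], chosen so that [2 / (1 - b) <= C1 / h], and the exponent is
    [(1 - 1/q) + 1/p]. The prefactor covers both coefficients that occur: [2 omega exp (3 omega)]
    for the weight and [12 omega^2 exp (3 omega)] for its increments. *)
Definition transference_const : R :=
  12 * (1 + omega) ^+ 2 * expR (3 * omega) *
    (2 * expR (omega - omega0) / (omega - omega0)) `^ (1 + (p^-1 - q^-1)).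

Local Notation theta := (p^-1 - q^-1).
Let h0 : 0 < h. Proof. by case/andP: h01. Qed.
Let h1 : h <= 1. Proof. by case/andP: h01. Qed.
Let omega_gt0 : 0 < omega. Proof. exact: le_lt_trans homega. Qed.
Let a := expR (- (omega * h)).
Let b := expR (- ((omega - omega0) * h)).
Let d0 : 0 < omega - omega0. Proof. by rewrite subr_gt0. Qed.
Let C1 := 2 * expR (omega - omega0) / (omega - omega0).
Let C1_gt0 : 0 < C1. Proof. by rewrite divr_gt0 ?mulr_gt0 ?expR_gt0. Qed.
Let wk (k : int) := weight omega (k%:~R * h).
Let S := (a ^- 2 - a ^+ 2) / 4.
Let C (k : int) := cosh (omega0 * (k%:~R * h)).

(** From [1 - exp (- y) >= y exp (- y)] with [y = (omega - omega0) h], and [h <= 1] in the last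
    exponential. *)
Let bC1 : 2 / (1 - b) <= C1 / h.
Proof.
have dh : 0 < (omega - omega0) * h by exact: mulr_gt0.
have /andP[e1 _] := one_minus_expRN ((omega - omega0) * h).
have b1 : 0 < 1 - b by rewrite subr_gt0 expR_lt1 oppr_lt0.
rewrite ler_pdivrMr// /C1.
apply: (@le_trans _ _ (2 * expR (omega - omega0) / (omega - omega0) / h *
   ((omega - omega0) * h * expR (- (omega - omega0))))).
  by rewrite expRN le_eqVlt; apply/orP; left; apply/eqP; field;
     rewrite !gt_eqF ?expR_gt0.
rewrite ler_wpM2l ?divr_ge0 ?mulr_ge0 ?expR_ge0 ?(ltW h0) ?(ltW d0)//.
apply: le_trans e1; rewrite ler_wpM2l ?(ltW dh)// ler_expR lerN2.
by rewrite ger_pMr.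
Qed.

Let wC k : wk k * C k <= 1.
Proof.
rewrite /wk /weight mulrC ler_pdivrMr ?cosh_gt0// mul1r ler_cosh_norm// !normrM.
by rewrite (ger0_norm homega0) (gtr0_norm omega_gt0) ler_wpM2r ?mulr_ge0// ltW.
Qed.

(** This is [transference] for [V k = U (k h)] and [G = C1 / h]. From [h ^ (-1 - theta)] one factor
    [1/h] is set beside [H], which will be of order [h] or [h^2]. *)
Lemma weighted_transference_gen (v : int -> R) (H : R) : 0 <= H ->
  (forall k, `|v k| <= 2) ->
  (forall k : int, `|resolvent_density a v k| * C k <= H * a ^+ `|k|%N) ->
  rnorm (\sum_(e <- D) (e.2 * (v e.1)%:C) *: U (e.1%:~R * h) z) <=
    H / h * C1 `^ (1 + theta) * (M * (c * t * N) * B) * h `^ (- theta).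
Proof.
move=> H0 v2 vH.
have G0 : 0 < C1 / h by rewrite divr_gt0.
have hV k l x : U ((k + l)%:~R * h) x = U (k%:~R * h) (U (l%:~R * h) x).
  by rewrite intrD mulrDl UD.
have ab : a <= b by rewrite ler_expR lerN2 ler_pM2r// gerBl.
have b1 : b < 1 by rewrite expR_lt1 oppr_lt0 mulr_gt0.
have CM k y : rnorm (U (k%:~R * h) y) <= M * C k * rnorm y by exact: UM.
have Cb k : a ^+ `|k|%N * C k <= b ^+ `|k|%N.
  have -> : a ^+ `|k|%N = b ^+ `|k|%N * expR (- (omega0 * `|k%:~R * h|)).
    rewrite -!expRM_natl -expRD natr_absz intr_norm normrM (gtr0_norm h0); congr expR; ring.
  rewrite -mulrA -[leRHS]mulr1 ler_wpM2l ?exprn_ge0 ?expR_ge0//.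
  rewrite mulrC expRN ler_pdivrMr ?expR_gt0// mul1r.
  by apply: (le_trans (cosh_le_expR _)); rewrite normrM (ger0_norm homega0).
have := @transference R d Om P gam hgam X (fun k => U (k%:~R * h)) hV p q t c hp hq c0 ht hc
  a b (C1 / h) M C (expR_gt0 _) ab b1 bC1 M0 CM Cb D N N0 DN z B B0 zB v 2 H v2 H0 vH t0.
move=> /le_trans; apply; rewrite le_eqVlt; apply/orP; left; apply/eqP.
have -> : M * H * ((C1 / h) `^ (1 - q^-1) * (c * (N * (t * (B * (C1 / h) `^ p^-1))))) =
   H * (M * (c * t * N) * B) * ((C1 / h) `^ (1 - q^-1) * (C1 / h) `^ p^-1) by ring.
rewrite -powRD; last by apply/implyP => _; rewrite gt_eqF.
have -> : 1 - q^-1 + p^-1 = 1 + theta by ring.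
rewrite powRM ?(ltW C1_gt0) ?invr_ge0 ?(ltW h0)// powRV//.
rewrite [h `^ (1 + _)]powRD; last by apply/implyP => _; rewrite gt_eqF.
rewrite powRr1 ?(ltW h0)// powRN; field.
by rewrite !gt_eqF ?powR_gt0.
Qed.

Let density k : resolvent_density a wk k = S * wk (k - 1) * wk k * wk (k + 1).
Proof. exact: weight_density. Qed.

Let S_ge0 : 0 <= S.
Proof. by have /andP[] := weight_density_coef omega_gt0 h01. Qed.

Let S_le : S <= omega * h * expR (2 * omega).
Proof. by have /andP[] := weight_density_coef omega_gt0 h01. Qed.

Let wk_gt0 k : 0 < wk k. Proof. exact: weight_gt0. Qed.
Let wk_ge0 k : 0 <= wk k. Proof. exact: ltW. Qed.
Let Swk_ge0 i j : 0 <= S * wk i * wk j.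
Proof. exact: mulr_ge0 (mulr_ge0 S_ge0 (wk_ge0 _)) (wk_ge0 _). Qed.
Let wk_le1 k : wk k <= 1. Proof. exact: weight_le1. Qed.

(** The factors of the density share the work: [wk k] absorbs the growth [C k] of the group,
    [wk (k + s)] supplies the decay [a^|k|], and [u] stays free to be an increment. *)
Let shift_bound k (s : int) u : (`|s| <= 1)%N -> 0 <= u ->
  S * u * wk k * wk (k + s) * C k <=
    (omega * h * expR (2 * omega)) * u * (2 * expR omega * a ^+ `|k|%N).
Proof.
move=> s1 u0.
have -> : S * u * wk k * wk (k + s) * C k = (S * u) * (wk (k + s) * (wk k * C k)) by ring.
apply: ler_pM.
- exact: mulr_ge0.
- by apply: mulr_ge0 => //; apply: mulr_ge0 => //; exact/ltW/cosh_gt0.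
- by rewrite ler_wpM2r.
rewrite -[leRHS]mulr1; apply: ler_pM; [exact: wk_ge0| |exact: weight_int_shift|exact: wC].
by apply: mulr_ge0; [exact: wk_ge0|exact/ltW/cosh_gt0].
Qed.

Let const_le (x : R) : 0 <= x <= 12 * (1 + omega) ^+ 2 * expR (3 * omega) -> forall y, 0 <= y ->
  x * C1 `^ (1 + theta) * (M * (c * t * N) * B) * y <=
  transference_const * (M * (c * t * N) * B) * y.
Proof.
move=> /andP[x0 x1] y y0; rewrite ler_wpM2r// ler_wpM2r ?mulr_ge0//.
by rewrite /transference_const ler_wpM2r ?powR_ge0.
Qed.

Lemma transference_weight :
  rnorm (\sum_(e <- D) (e.2 * (weight omega (e.1%:~R * h))%:C) *: U (e.1%:~R * h) z) <=
    transference_const * (M * (c * t * N) * B) * h `^ (- theta).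
Proof.
have e3 : expR (3 * omega) = expR (2 * omega) * expR omega by rewrite -expRD; congr expR; ring.
have hH k : `|resolvent_density a wk k| * C k <=
    (2 * omega * expR (3 * omega) * h) * a ^+ `|k|%N.
  rewrite density ger0_norm ?(mulr_ge0 (Swk_ge0 _ _) (wk_ge0 _))//.
  apply: le_trans (shift_bound _ _ _) _; rewrite ?(ltW (wk_gt0 _))//.
  apply: (@le_trans _ _ (omega * h * expR (2 * omega) * 1 * (2 * expR omega * a ^+ `|k|%N))).
    by rewrite ler_wpM2r ?mulr_ge0 ?exprn_ge0 ?expR_ge0// ler_wpM2l ?mulr_ge0 ?expR_ge0// ltW.
  by rewrite e3; lra.
apply: (le_trans (weighted_transference_gen _ _ hH)).
- by rewrite !mulr_ge0 ?expR_ge0 ?(ltW omega_gt0) ?(ltW h0).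
- by move=> k; rewrite gtr0_norm//; have := wk_le1 k; lra.
apply: const_le; last exact: powR_ge0.
rewrite mulfK ?gt_eqF// !mulr_ge0 ?expR_ge0 ?(ltW omega_gt0)//=.
by rewrite ler_wpM2r ?expR_ge0//; have := omega_gt0; nra.
Qed.

Lemma transference_weight_diff (s : int) : s = 1 \/ s = -1 ->
  rnorm (\sum_(e <- D) (e.2 * (weight omega (e.1%:~R * h) - weight omega ((e.1 + s)%:~R * h))%:C)
    *: U (e.1%:~R * h) z) <=
    transference_const * (M * (c * t * N) * B) * (h * h `^ (- theta)).
Proof.
move=> s1.
have e3 : expR (3 * omega) = expR (2 * omega) * expR omega by rewrite -expRD; congr expR; ring.
pose v k := wk k - wk (k + s).
(* The densities at [k] and [k + s] have two factors in common, so the increment falls on the third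
   one. *)
have vd k : resolvent_density a v k = S * wk k * wk (k + s) * (wk (k - s) - wk (k + s + s)).
  have dE : resolvent_density a (fun k => wk (k + s)) k = resolvent_density a wk (k + s).
    by rewrite /resolvent_density; congr ((_ - _ * (wk _ + wk _)) / _); ring.
  rewrite resolvent_densityB dE !density.
  case: s1 => ->; first by rewrite addrK; ring.
  by rewrite opprK subrK; ring.
(* The two points are [3 h] apart and [weight] has Lipschitz constant [2 omega]. *)
have wd k : `|wk (k - s) - wk (k + s + s)| <= 6 * omega * h.
  have -> : 6 * omega * h = 2 * (omega * (3 * h)) by ring.
  apply: (le_trans (weight_dist _ _ _)) => //; rewrite ler_pM2l// ler_pM2l//.
  rewrite -mulrBl normrM (gtr0_norm h0) ler_pM2r// -intrB -intr_norm.
  have -> : k - s - (k + s + s) = - (3 * s) by ring.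
  by case: s1 => ->.
have hH k : `|resolvent_density a v k| * C k <=
    (12 * omega ^+ 2 * expR (3 * omega) * h ^+ 2) * a ^+ `|k|%N.
  rewrite vd normrM (ger0_norm (Swk_ge0 _ _)).
  set u := `|_|.
  have -> : S * wk k * wk (k + s) * u * C k = S * u * wk k * wk (k + s) * C k by ring.
  have s1' : (`|s| <= 1)%N by case: s1 => ->.
  apply: (le_trans (shift_bound k s1' (normr_ge0 _))).
  apply: (@le_trans _ _ (omega * h * expR (2 * omega) * (6 * omega * h) * (2 * expR omega * a ^+ `|k|%N))).
    by rewrite ler_wpM2r ?mulr_ge0 ?exprn_ge0 ?expR_ge0// ler_wpM2l ?mulr_ge0 ?expR_ge0 ?wd// ltW.
  by rewrite e3 le_eqVlt; apply/orP; left; apply/eqP; ring.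
apply: (le_trans (weighted_transference_gen _ _ hH)).
- by rewrite !mulr_ge0 ?expR_ge0 ?exprn_ge0 ?(ltW omega_gt0) ?(ltW h0).
- move=> k; have := wk_le1 k; have := wk_gt0 k; have := wk_le1 (k + s); have := wk_gt0 (k + s).
  by rewrite /v => *; rewrite ler_norml; apply/andP; split; lra.
have -> : 12 * omega ^+ 2 * expR (3 * omega) * h ^+ 2 / h =
    (12 * omega ^+ 2 * expR (3 * omega)) * h by field; rewrite gt_eqF.
have -> x y w : x * h * y * w * h `^ (- theta) = x * y * w * (h * h `^ (- theta)) by ring.
apply: const_le; last by rewrite mulr_ge0 ?powR_ge0 ?(ltW h0).
rewrite !mulr_ge0 ?exprn_ge0 ?expR_ge0 ?(ltW omega_gt0)//=.
rewrite ler_wpM2r ?expR_ge0// ler_wpM2l// lerXn2r ?nnegrE ?addr_ge0 ?(ltW omega_gt0)//.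
by rewrite lerDr.
Qed.

End weighted_transference.

(** * Dyadic refinement *)

Section coarsening.
Context {R : realType}.
Implicit Types (D : seq (int * R[i])) (m : int).

Lemma odd_divz2 m : m = (m %/ 2)%Z * 2 + (odd `|m|%N)%:Z.
Proof. lia. Qed.

Lemma cis_pi_int m : cis (- (pi * m%:~R)) = (if odd `|m|%N then -1 else 1) :> R[i].
Proof.
have -> : - (pi * m%:~R) = - (pi * ((m %/ 2)%Z%:~R * 2)) + - (pi * (odd `|m|%N)%:R) :> R.
  by rewrite {1}(odd_divz2 m) intrD intrM mulrDr opprD.
rewrite cisD; have -> : - (pi * ((m %/ 2)%Z%:~R * 2)) = 2 * pi * (- (m %/ 2)%Z)%:~R :> R.
  by rewrite intrN; ring.
rewrite mulrzr cis_2pi_int mul1r; case: odd => /=.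
  by rewrite mulr1 /cis cosN sinN cospi sinpi; apply/eqP; rewrite eq_complex/= oppr0 !eqxx.
by rewrite mulr0 oppr0 cis0.
Qed.

(** The transpose of linear interpolation from the even points, whose indices are then halved: an
    odd point hands half of its mass to either neighbour. *)
Definition coarsen D := flatten [seq (if odd `|e.1|%N
  then [:: ((e.1 %/ 2)%Z, (2^-1)%:C * e.2); ((e.1 %/ 2)%Z + 1, (2^-1)%:C * e.2)]
  else [:: ((e.1 %/ 2)%Z, e.2)]) | e <- D].

Definition odd_part D := [seq e <- D | odd `|e.1|%N].

Lemma big_coarsen (V : zmodType) (F : int * R[i] -> V) D :
  \sum_(e <- coarsen D) F e = \sum_(e <- D) (if odd `|e.1|%N
    then F ((e.1 %/ 2)%Z, (2^-1)%:C * e.2) + F ((e.1 %/ 2)%Z + 1, (2^-1)%:C * e.2)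
    else F ((e.1 %/ 2)%Z, e.2)).
Proof.
rewrite big_flatten/= big_map; apply: eq_bigr => e _; case: odd.
  by rewrite big_cons big_seq1.
by rewrite big_seq1.
Qed.

(** The two coefficients are nonnegative with sum 1, so a bound on the symbol survives any number of
    coarsenings unchanged. *)
Lemma symbol_coarsen D xi : symbol (coarsen D) xi =
  ((1 + cos (xi / 2)) / 2)%:C * symbol D (xi / 2) +
  ((1 - cos (xi / 2)) / 2)%:C * symbol D (xi / 2 + pi).
Proof.
rewrite /symbol big_coarsen !mulr_sumr -big_split/=; apply: eq_bigr => e _.
have -> : - ((xi / 2 + pi) * e.1%:~R) = - (xi / 2 * e.1%:~R) + - (pi * e.1%:~R) by ring.
rewrite cisD cis_pi_int; set m := e.1; set c := e.2.
have mE : m%:~R = (m %/ 2)%Z%:~R * 2 + (odd `|m|%N)%:R :> R.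
  by rewrite {1}(odd_divz2 m) intrD intrM.
case: ifP => om; rewrite om/= in mE.
  have e1 : cis (- (xi * (m %/ 2)%Z%:~R)) = cis (- (xi / 2 * m%:~R)) * cis (xi / 2) :> R[i].
    by rewrite -cisD; congr cis; rewrite mE; field.
  have e2 : cis (- (xi * ((m %/ 2)%Z + 1)%:~R)) = cis (- (xi / 2 * m%:~R)) * cis (- (xi / 2)) :> R[i].
    by rewrite -cisD; congr cis; rewrite mE intrD; field.
  rewrite e1 e2 /cis !cosN !sinN; move: (cos _) (sin _) (cos _) (sin _) => c1 s1 c2 s2.
  by case: c => x y; apply/eqP; rewrite eq_complex/=; apply/andP; split; apply/eqP; field.
have -> : cis (- (xi * (m %/ 2)%Z%:~R)) = cis (- (xi / 2 * m%:~R)) :> R[i].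
  by congr cis; rewrite mE; field.
move: (cis _) (cos _) => [x1 y1] c1.
by case: c => x y; apply/eqP; rewrite eq_complex/=; apply/andP; split; apply/eqP; field.
Qed.

Lemma symbol_odd_part D xi : symbol (odd_part D) xi =
  (2^-1)%:C * (symbol D xi - symbol D (xi + pi)).
Proof.
rewrite /symbol /odd_part big_filter big_mkcond -sumrB mulr_sumr; apply: eq_bigr => e _.
rewrite mulrDl opprD cisD cis_pi_int; case: ifP => _.
  rewrite mulrN1 mulrN opprK; move: (_ * _) => [x y].
  by apply/eqP; rewrite eq_complex/=; apply/andP; split; apply/eqP; field.
by rewrite mulr1 subrr mulr0.
Qed.

Variables (D : seq (int * R[i])) (N : R).
Hypothesis DN : forall xi, rnorm (symbol D xi : R[i]^o) <= N.

Lemma symbol_coarsen_le xi : rnorm (symbol (coarsen D) xi : R[i]^o) <= N.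
Proof.
rewrite symbol_coarsen; set u := xi / 2.
have c1 := cos_le1 u; have c2 := cos_geN1 u.
apply: (le_trans (@rnormD R R[i]^o _ _)); rewrite !(@rnormM R) !rnormR.
have c3 : 0 <= 1 + cos u by rewrite addrC -[1]opprK subr_ge0.
rewrite !ger0_norm ?divr_ge0 ?subr_ge0//.
have -> : N = (1 + cos u) / 2 * N + (1 - cos u) / 2 * N by field.
by rewrite lerD// ler_wpM2l ?divr_ge0 ?subr_ge0//.
Qed.

Lemma symbol_odd_part_le xi : rnorm (symbol (odd_part D) xi : R[i]^o) <= N.
Proof.
rewrite symbol_odd_part (@rnormM R) rnormR ger0_norm//.
have := @rnormB R R[i]^o (symbol D xi) (symbol D (xi + pi)).
by have := DN xi; have := DN (xi + pi); lra.
Qed.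

End coarsening.

Section dyadic_induction.
Context (R : realType) (d : measure_display) (Om : measurableType d).
Variables (P : probability Om R) (gam : nat -> Om -> R[i]).
Hypothesis hgam : standard_complex_gaussians P gam.
Variables (X : normedModType R[i]) (U : R -> {linear X -> X}).
Hypothesis UD : forall s t x, U (s + t) x = U s (U t x).
Variables (omega omega0 p q t c M : R).
Hypotheses (homega0 : 0 <= omega0) (homega : omega0 < omega).
Hypothesis UM : forall s x, rnorm (U s x) <= M * cosh (omega0 * s) * rnorm x.
Hypotheses (hp : 1 <= p) (hq : 1 < q) (c0 : 0 <= c) (t0 : 0 <= t) (M1 : 1 <= M).
Hypotheses (ht : type_bound P gam X p t) (hc : cotype_bound P gam X q c).
Variables (DA : set X) (A : X -> X).
Hypothesis UA : generates DA (fun x => (- 'i) *: A x) U.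

Local Notation theta := (p^-1 - q^-1).
Let M0 : 0 <= M. Proof. exact: le_trans M1. Qed.

(* Cut [[r, r + s]] into [n] equal steps and let [n] go to infinity. *)
Lemma group_lipschitz r s b : DA b ->
  rnorm (U (r + s) b - U r b) <= `|s| * (M * (expR (omega0 * `|s|) * cosh (omega0 * r))) * rnorm (A b).
Proof.
move=> Db; have [->|s0] := eqVneq s 0.
  by rewrite addr0 subrr rnorm0 normr0 !mul0r.
set Cm := expR (omega0 * `|s|) * cosh (omega0 * r).
have /UA hd : DA b /\ (- 'i) *: A b = (- 'i) *: A b by [].
pose u n : R := s / n.+1%:R.
have cu : u @ \oo --> 0^'.
  have u0 : u @ \oo --> (0 : R).
    rewrite -(mulr0 s); apply: cvgM; first exact: cvg_cst.
    exact: cvg_harmonic.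
  move=> S S0; have : \forall n \near \oo, u n != 0 -> S (u n) by exact: (u0 _ S0).
  apply: filterS => n; apply.
  by rewrite mulf_neq0// invr_eq0 pnatr_eq0.
have := cvg_rnorm _ (cvg_comp _ _ cu hd).
rewrite rnormZ rnormN.
have -> : rnorm ('i : R[i]^o) = 1.
  by rewrite rnormCE /= expr0n /= add0r expr1n sqrtr1.
rewrite mul1r => cA.
have cB : (fun n => `|s| * (M * Cm) * rnorm ((u n)^-1%:C *: (U (u n) b - b))) @ \oo -->
    `|s| * (M * Cm) * rnorm (A b).
  by apply: cvgM; [exact: cvg_cst|exact: cA].
apply: (ler_cvg_to (cvg_cst (rnorm (U (r + s) b - U r b))) cB).
apply: nearW => n /=.
have -> : U (r + s) b - U r b = \sum_(0 <= j < n.+1) U (r + u n *+ j) (U (u n) b - b).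
  transitivity (\sum_(0 <= j < n.+1) (U (r + u n *+ j.+1) b - U (r + u n *+ j) b)).
    by rewrite telescope_sumr// mulr0n addr0 -[u n *+ n.+1]mulr_natr divfK.
  by apply: eq_bigr => j _; rewrite linearB/= -UD -addrA mulrSr.
apply: (le_trans (rnorm_sum _ _ _)).
apply: (@le_trans _ _ (\sum_(0 <= j < n.+1) M * Cm * rnorm (U (u n) b - b))).
  rewrite !big_mkord; apply: ler_sum => j _; apply: (le_trans (UM _ _)).
  rewrite ler_wpM2r ?rnorm_ge0// ler_wpM2l// mulrDr.
  apply: (le_trans (coshD_le _ _)); rewrite ler_wpM2r ?(ltW (cosh_gt0 _))// ler_expR.
  rewrite normrM (ger0_norm homega0) ler_wpM2l// -mulr_natr /u mulrAC -mulrA normrM.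
  rewrite ler_piMr// ger0_norm ?divr_ge0// ler_pdivrMr// mul1r ler_nat.
  by have := ltn_ord j; exact: ltnW.
rewrite sumr_const_nat subn0 rnorm_real normfV /u normrM normfV invfM invrK.
rewrite -[leLHS]mulr_natl normr_nat le_eqVlt; apply/orP; left; apply/eqP.
by field; rewrite normr_eq0.
Qed.

Definition weighted_orbit_sum (h : R) (D : seq (int * R[i])) (x : X) : X :=
  \sum_(e <- D) (e.2 * (weight omega (e.1%:~R * h))%:C) *: U (e.1%:~R * h) x.

Lemma generator0 : DA 0.
Proof.
have /UA[] // : (fun h : R => h^-1%:C *: (U h 0 - 0)) @ 0^' --> (0 : X).
rewrite (_ : (fun h : R => _) = cst 0); first exact: cvg_cst.
by apply/funext => h /=; rewrite linear0 subrr scaler0.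
Qed.

Lemma K_functional_ge (h y K : R) (x : X) : 0 <= K ->
  (forall a b, DA b -> x = a + b -> y <= K * (rnorm a + h * graph_norm A b)) ->
  y <= K * K_functional DA A h x.
Proof.
move=> K0 H.
have D0 := generator0.
(* The infimum is compared after division by [K]; for [K = 0] the decomposition [x = x + 0]
   suffices. *)
have [K00|Kn0] := eqVneq K 0.
  by have := H x 0 D0; rewrite addr0 K00 !mul0r; exact.
have Kp : 0 < K by rewrite lt0r Kn0.
rewrite -ler_pdivrMl//; apply: lb_le_inf.
  exists (rnorm x + h * graph_norm A 0); exists (x, 0) => //=.
  by split => //; rewrite addr0.
by move=> _ [[a b] /= [Db xab] <-]; rewrite ler_pdivrMl//; exact: H.
Qed.

(** The 3 comes from [h |x| + 2 (|a| + h |A b|) <= 3 (|a| + h graph_norm b)] for [x = a + b];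
    [exp omega0] pays for moving an orbit by one step [h <= 1]. *)
Definition dyadic_const : R :=
  3 * expR omega0 * transference_const omega omega0 p q.

Let tc_ge0 : 0 <= transference_const omega omega0 p q.
Proof.
have o1 : 0 <= 1 + omega by apply: addr_ge0 => //; exact: le_trans homega0 (ltW homega).
by rewrite /transference_const !mulr_ge0 ?powR_ge0 ?expR_ge0.
Qed.

Let dc_ge0 : 0 <= dyadic_const.
Proof. by apply: mulr_ge0 => //; rewrite mulr_ge0 ?expR_ge0. Qed.

Let factor_ge0 N : 0 <= N -> 0 <= c * t * M ^+ 2 * N.
Proof. by move=> N0; apply: mulr_ge0 => //; apply: mulr_ge0; [exact: mulr_ge0|exact: exprn_ge0]. Qed.

(** At an odd point the error is [w0 x0 - (w1 x1 + w2 x2) / 2]. Each half is split as for the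
    derivative of a product, [w0 x0 - w1 x1 = (w0 - w1) x1 - w0 (x1 - x0)]: one sum has an increment
    of the weight, the other an increment of the orbit. *)
Lemma weighted_orbit_sum_coarsen h D x : weighted_orbit_sum h D x =
  weighted_orbit_sum (2 * h) (coarsen D) x +
  (2^-1)%:C *: \sum_(s <- [:: 1; -1]) (
    \sum_(e <- odd_part D) (e.2 * (weight omega (e.1%:~R * h) - weight omega ((e.1 + s)%:~R * h))%:C)
      *: U (e.1%:~R * h) (U (s%:~R * h) x) -
    \sum_(e <- odd_part D) (e.2 * (weight omega (e.1%:~R * h))%:C)
      *: U (e.1%:~R * h) (U (s%:~R * h) x - x)).
Proof.
rewrite /weighted_orbit_sum big_coarsen big_cons big_seq1 -!sumrB -big_split/=.
rewrite /odd_part big_filter scaler_sumr [X in _ + X]big_mkcond -big_split/=.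
apply: eq_bigr => e _; set m := e.1; set k := e.2.
have mE : m%:~R = (m %/ 2)%Z%:~R * 2 + (odd `|m|%N)%:R :> R.
  by rewrite {1}(odd_divz2 m) intrD intrM.
case: ifP => om; rewrite om/= in mE; last first.
  by rewrite addr0 mE addr0 mulrA.
have -> : (m %/ 2)%Z%:~R * (2 * h) = (m - 1)%:~R * h by rewrite intrB mE; ring.
have -> : ((m %/ 2)%Z + 1)%:~R * (2 * h) = (m + 1)%:~R * h by rewrite !intrD mE; ring.
have e1 : U (m%:~R * h) (U (1%:~R * h) x) = U ((m + 1)%:~R * h) x by rewrite -UD -mulrDl -intrD.
have e2 : U (m%:~R * h) (U ((-1)%:~R * h) x) = U ((m - 1)%:~R * h) x by rewrite -UD -mulrDl -intrD.
rewrite !(linearB (U (m%:~R * h)))/= e1 e2.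
set w0 := weight _ (m%:~R * h); set w1 := weight _ ((m + 1)%:~R * h).
set w2 := weight _ ((m - 1)%:~R * h).
set x0 := U (m%:~R * h) x; set x1 := U ((m + 1)%:~R * h) x; set x2 := U ((m - 1)%:~R * h) x.
have aux w (y y0 : X) : (k * (w0 - w)%:C) *: y - ((k * w0%:C) *: y - y0) = y0 - (k * w%:C) *: y.
  by rewrite rmorphB/= mulrBr scalerBl opprB addrC addrA subrK.
rewrite !scalerBr !aux -!mulrA -![((2^-1)%:C * _) *: _]scalerA -!scalerDr.
set y0 := (k * w0%:C) *: x0; set y1 := (k * w1%:C) *: x1; set y2 := (k * w2%:C) *: x2.
have -> : y2 + y1 + (y0 - y1 + (y0 - y2)) = y0 + y0.
  by rewrite [y2 + y1]addrC addrACA addrC [y1 + _]addrC subrK [y2 + _]addrC subrK.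
rewrite scalerDr -scalerDl -rmorphD/= (_ : 2^-1 + 2^-1 = 1) ?rmorph1 ?scale1r//.
by rewrite [RHS]splitr div1r.
Qed.

(** For [x = a + b] the increments of the weight cost [h |x|]. In the increments of the orbit, [a]
    is bounded by its two terms and [b] through [group_lipschitz]; the infimum over decompositions
    gives the K-functional. *)
Let odd_part_bound h D N x : 0 < h <= 1 -> 0 <= N ->
  (forall xi, rnorm (symbol D xi : R[i]^o) <= N) ->
  rnorm (weighted_orbit_sum h D x) <= rnorm (weighted_orbit_sum (2 * h) (coarsen D) x) +
    dyadic_const * (c * t * M ^+ 2 * N) * h `^ (- theta) * K_functional DA A h x.
Proof.
move=> h01 N0 DN; have f0 := factor_ge0 N0; have /andP[h0 h1] := h01.
have ON := symbol_odd_part_le DN.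
rewrite weighted_orbit_sum_coarsen; apply: (le_trans (rnormD _ _)); rewrite lerD2l.
have tl0 := powR_ge0 h (- theta).
apply: K_functional_ge => [|a b Db xab].
  exact: mulr_ge0 (mulr_ge0 dc_ge0 f0) tl0.
set g := graph_norm A b.
have ra := rnorm_ge0 a; have rb := rnorm_ge0 b; have rAb := rnorm_ge0 (A b).
pose e0 := expR omega0.
have e01 : 1 <= e0 by rewrite -expR0 ler_expR.
have ch s l : s = 1 \/ s = -1 -> cosh (omega0 * (l + s%:~R * h)) <= e0 * cosh (omega0 * l).
  move=> s1; rewrite mulrDr; apply: (le_trans (coshD_le _ _)).
  rewrite ler_wpM2r ?(ltW (cosh_gt0 _))// ler_expR.
  have -> : `|omega0 * (s%:~R * h)| = omega0 * h.
    by rewrite !normrM (ger0_norm homega0) (gtr0_norm h0); case: s1 => ->; rewrite ?normrN1 ?normr1 mul1r.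
  by rewrite ler_piMr.
(* This is where [h <= 1] lets the weight increments be charged to the same decomposition. *)
have hx : h * rnorm x <= rnorm a + h * rnorm b.
  have : h * rnorm x <= h * (rnorm a + rnorm b) by rewrite ler_pM2l// xab rnormD.
  have : h * rnorm a <= 1 * rnorm a by exact: ler_wpM2r.
  by rewrite mul1r mulrDr => g1 g2; apply: (le_trans g2); rewrite lerD2r.
set T := transference_const omega omega0 p q.
have main s : s = 1 \/ s = -1 ->
    rnorm (\sum_(e <- odd_part D)
      (e.2 * (weight omega (e.1%:~R * h) - weight omega ((e.1 + s)%:~R * h))%:C)
        *: U (e.1%:~R * h) (U (s%:~R * h) x) -
      \sum_(e <- odd_part D) (e.2 * (weight omega (e.1%:~R * h))%:C)
        *: U (e.1%:~R * h) (U (s%:~R * h) x - x)) <=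
    dyadic_const * (c * t * M ^+ 2 * N) * h `^ (- theta) * (rnorm a + h * g).
  move=> s1; apply: (le_trans (rnormB _ _)).
  have B10 : 0 <= M * e0 * rnorm x by rewrite !mulr_ge0 ?rnorm_ge0 ?expR_ge0.
  have B20 : 0 <= M * (2 * e0) * (rnorm a + h * rnorm (A b)).
    by rewrite !mulr_ge0 ?addr_ge0 ?mulr_ge0 ?expR_ge0 ?(ltW h0).
  have zB1 (l : int) : rnorm (U (l%:~R * h) (U (s%:~R * h) x)) <=
      M * e0 * rnorm x * cosh (omega0 * (l%:~R * h)).
    rewrite -UD; apply: (le_trans (UM _ _)).
    rewrite [leRHS]mulrAC ler_wpM2r ?rnorm_ge0//.
    by rewrite -!mulrA ler_wpM2l ?ch.
  have zB2 (l : int) : rnorm (U (l%:~R * h) (U (s%:~R * h) x - x)) <=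
      M * (2 * e0) * (rnorm a + h * rnorm (A b)) * cosh (omega0 * (l%:~R * h)).
    set cl := cosh _; have cl0 : 0 < cl := cosh_gt0 _.
    have -> : U (l%:~R * h) (U (s%:~R * h) x - x) =
        (U (l%:~R * h + s%:~R * h) a - U (l%:~R * h) a) +
        (U (l%:~R * h + s%:~R * h) b - U (l%:~R * h) b).
      rewrite (linearB (U (l%:~R * h)))/= -UD xab.
      by rewrite (linearD (U (l%:~R * h))) (linearD (U (l%:~R * h + s%:~R * h)))/= opprD addrACA.
    apply: (le_trans (rnormD _ _)).
    have h1' : rnorm (U (l%:~R * h + s%:~R * h) a - U (l%:~R * h) a) <= M * (2 * e0) * rnorm a * cl.
      apply: (le_trans (rnormB _ _)).
      have u1 : rnorm (U (l%:~R * h + s%:~R * h) a) <= M * (e0 * cl) * rnorm a.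
        by apply: (le_trans (UM _ _)); rewrite ler_wpM2r// ler_wpM2l// ch.
      have u2 : rnorm (U (l%:~R * h) a) <= M * (e0 * cl) * rnorm a.
        apply: (le_trans (UM _ _)); rewrite ler_wpM2r// ler_wpM2l// -/cl.
        by rewrite ler_peMl// ltW.
      by lra.
    have h2' : rnorm (U (l%:~R * h + s%:~R * h) b - U (l%:~R * h) b) <=
        h * (M * (e0 * cl)) * rnorm (A b).
      apply: (le_trans (group_lipschitz _ _ Db)).
      have -> : `|s%:~R * h| = h.
        by rewrite normrM (gtr0_norm h0); case: s1 => ->; rewrite ?normrN1 ?normr1 mul1r.
      rewrite ler_wpM2r// ler_wpM2l ?(ltW h0)// ler_wpM2l// ler_wpM2r ?(ltW cl0)//.
      by rewrite ler_expR ler_piMr.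
    have : 0 <= h * (M * (e0 * cl)) * rnorm (A b).
      by rewrite !mulr_ge0 ?expR_ge0 ?(ltW h0) ?(ltW cl0).
    by lra.
  have q1 := transference_weight_diff hgam UD homega0 homega UM hp hq c0 t0 M0 ht hc h01 N0 ON B10 zB1 s1.
  have q2 := transference_weight hgam UD homega0 homega UM hp hq c0 t0 M0 ht hc h01 N0 ON B20 zB2.
  apply: (le_trans (lerD q1 q2)); rewrite -/T.
  have -> : T * (M * (c * t * N) * (M * e0 * rnorm x)) * (h * h `^ (- theta)) +
      T * (M * (c * t * N) * (M * (2 * e0) * (rnorm a + h * rnorm (A b)))) * h `^ (- theta) =
    (T * e0 * (c * t * M ^+ 2 * N) * h `^ (- theta)) *
      (h * rnorm x + 2 * (rnorm a + h * rnorm (A b))) by ring.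
  have -> : dyadic_const * (c * t * M ^+ 2 * N) * h `^ (- theta) * (rnorm a + h * g) =
    (T * e0 * (c * t * M ^+ 2 * N) * h `^ (- theta)) * (3 * (rnorm a + h * g)).
    by rewrite /dyadic_const -/T -/e0; ring.
  apply: ler_wpM2l; first exact: mulr_ge0 (mulr_ge0 (mulr_ge0 tc_ge0 (expR_ge0 _)) f0) tl0.
  rewrite /g /graph_norm !mulrDr.
  have : 0 <= h * rnorm b by rewrite mulr_ge0// ltW.
  have : 0 <= h * rnorm (A b) by rewrite mulr_ge0// ltW.
  move: hx ra; move: (h * rnorm x) (h * rnorm b) (h * rnorm (A b)) (rnorm a) => u1 u2 u3 u4.
  by lra.
rewrite rnorm_real ger0_norm ?invr_ge0// ler_pdivrMl//.
rewrite big_cons big_seq1; apply: (le_trans (rnormD _ _)).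
rewrite [leRHS]mulr_natl mulr2n; apply: lerD; apply: main; by [left|right].
Qed.

(** Each coarsening adds the term of its own step. At step 1 the plain transference bound remains,
    and [|x| <= |a| + |b|] turns it into the term [j = 0]. *)
Lemma weighted_orbit_sum_le J D N x : 0 <= N ->
  (forall xi, rnorm (symbol D xi : R[i]^o) <= N) ->
  rnorm (weighted_orbit_sum (2^-1 ^+ J) D x) <=
    dyadic_const * (c * t * M ^+ 2 * N) *
    \sum_(j < J.+1) (2^-1 ^+ j) `^ (- theta) * K_functional DA A (2^-1 ^+ j) x.
Proof.
move=> N0; have f0 := factor_ge0 N0; elim: J D => [|J ih] D DN.
  rewrite big_ord1 !expr0 powR1 mul1r.
  apply: K_functional_ge => [|a b Db xab].
    exact: mulr_ge0 dc_ge0 f0.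
  have h01 : ((0 : R) < 1) && ((1 : R) <= 1) by rewrite ltr01/=.
  have B0 : 0 <= M * rnorm x by rewrite mulr_ge0 ?rnorm_ge0.
  have zB (l : int) : rnorm (U (l%:~R * 1) x) <= M * rnorm x * cosh (omega0 * (l%:~R * 1)).
    by apply: (le_trans (UM _ _)); rewrite mulrAC.
  have := transference_weight hgam UD homega0 homega UM hp hq c0 t0 M0 ht hc h01 N0 DN B0 zB.
  move=> /le_trans; apply; rewrite powR1 mulr1 mul1r.
  have -> : transference_const omega omega0 p q * (M * (c * t * N) * (M * rnorm x)) =
    (transference_const omega omega0 p q * (c * t * M ^+ 2 * N)) * rnorm x by ring.
  apply: ler_pM; [exact: mulr_ge0 tc_ge0 f0|exact: rnorm_ge0| |].
    rewrite /dyadic_const ler_wpM2r// ler_peMl//.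
    have : 1 <= expR omega0 by rewrite -expR0 ler_expR.
    lra.
  rewrite xab; apply: (le_trans (rnormD _ _)); rewrite lerD2l /graph_norm lerDl rnorm_ge0//.
have h01 : 0 < (2^-1 : R) ^+ J.+1 <= 1.
  by rewrite exprn_gt0//= exprn_ile1// invf_le1// ler1n.
apply: (le_trans (odd_part_bound x h01 N0 DN)).
have -> : 2 * (2^-1 : R) ^+ J.+1 = 2^-1 ^+ J by rewrite exprS mulrA divff ?mul1r.
rewrite big_ord_recr/= mulrDr; apply: lerD; last by rewrite !mulrA.
exact/ih/symbol_coarsen_le.
Qed.

End dyadic_induction.

(** * Weighted measures and their Fourier transform *)

Section weighted_measure.
Context d (T : measurableType d) (R : realType).
Variables (mu : set T -> R[i]^o) (hmu : complex_measure mu).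
Variable k : {finite_measure set T -> \bar R}.
Hypothesis muk : forall A, measurable A -> ((rnorm (mu A))%:E <= k A)%E.
Hypothesis kmu : forall A, measurable A -> (k A <= 4%:E * total_variation mu A)%E.

Lemma is_bochner_integral_cvg (X : normedModType R[i]) (f_ : nat -> T -> X) (f : T -> X)
    (y_ : nat -> X) (y : X) (g : T -> R) :
  (forall n, is_bochner_integral mu (f_ n) (y_ n)) -> is_bochner_integral mu f y ->
  (forall t, (f_ n t) @[n --> \oo] --> f t) ->
  (forall n t, rnorm (f t - f_ n t) <= g t) ->
  measurable_fun setT g -> (\int[k]_t (g t)%:E < +oo)%E ->
  y_ @ \oo --> y.
Proof.
move=> fy_ fy ff fg mg kg.
have g0 t : 0 <= g t by apply: le_trans (fg 0%N t); exact: rnorm_ge0.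
apply/cvg_rnormP/cvgE.
apply: (@squeeze_cvge _ _ _ _ (cst 0%E) _
    (fun n => \int[k]_t (rnorm (f t - f_ n t))%:E)%E).
- apply: nearW => n; rewrite lee_fin rnorm_ge0/=.
  exact: (is_bochner_integral_dist hmu muk kmu fy (fy_ n)).
- exact: cvg_cst.
have mf n : measurable_fun setT (fun t => (rnorm (f t - f_ n t))%:E).
  apply: measurable_dist; first exact: is_bochner_strongly_measurable fy.
  exact: is_bochner_strongly_measurable (fy_ n).
have p1 : {ae k, forall t, setT t -> (rnorm (f t - f_ n t))%:E @[n --> \oo] --> cst 0%E t}.
  by apply: aeW => t _; have /cvg_rnormP/cvgE := ff t; exact.
have p2 : k.-integrable setT (EFin \o g).
  apply/integrableP; split; first exact/measurable_EFinP.
  by under eq_integral do rewrite /= ger0_norm//.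
have p3 : {ae k, forall t n, setT t -> `|(rnorm (f t - f_ n t))%:E| <= (EFin \o g) t}%E.
  by apply: aeW => t n _; rewrite gee0_abs ?lee_fin ?rnorm_ge0//=; exact: fg.
have [_ _] := dominated_convergence measurableT mf (measurable_cst _) p1 p2 p3.
by rewrite integral0.
Qed.

Lemma cmeasurableM (f g : T -> R[i]) : cmeasurable f -> cmeasurable g ->
  cmeasurable (fun t => f t * g t).
Proof.
move=> [f1 f2] [g1 g2]; split.
  have -> : (fun t => complex.Re (f t * g t)) = (fun t => complex.Re (f t) * complex.Re (g t)
      - complex.Im (f t) * complex.Im (g t)).
    by apply/funext => t; case: (f t) => a b; case: (g t).
  by apply: measurable_funB; exact: measurable_funM.
have -> : (fun t => complex.Im (f t * g t)) = (fun t => complex.Re (f t) * complex.Im (g t)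
    + complex.Im (f t) * complex.Re (g t)).
  by apply/funext => t; case: (f t) => a b; case: (g t).
by apply: measurable_funD; exact: measurable_funM.
Qed.

Lemma cmeasurable_if (B : set T) (f : T -> R[i]) : measurable B -> cmeasurable f ->
  cmeasurable (fun t => if t \in B then f t else 0).
Proof.
move=> mB [f1 f2].
have aux (p : R[i] -> R) : p 0 = 0 -> measurable_fun setT (fun t => p (f t)) ->
    measurable_fun setT (fun t => p (if t \in B then f t else 0)).
  move=> p0 mp; rewrite (_ : (fun t => _) = (fun t => if t \in B then p (f t) else 0)).
    apply: measurable_fun_ifT => //.
    apply: (@measurable_fun_bool _ _ _ _ true); rewrite setTI.
    rewrite (_ : _ @^-1` _ = B)//; apply/seteqP; split => t /= tB; last exact: mem_set.
    exact: set_mem tB.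
  by apply/funext => t; case: ifP.
by split; exact: aux.
Qed.

Lemma cmeasurable_rnorm (f : T -> R[i]^o) : cmeasurable f ->
  measurable_fun setT (fun t => rnorm (f t)).
Proof. by move=> /cmeasurable_strongly/strongly_measurable_rnorm. Qed.

Variable h : T -> R[i]^o.
Hypothesis mh : cmeasurable h.
Hypothesis kh : (\int[k]_t (rnorm (h t))%:E < +oo)%E.

Lemma is_bochner_integral_dominated (f : T -> R[i]^o) (K : R) : cmeasurable f ->
  (forall t, rnorm (f t) <= K * rnorm (h t)) ->
  exists c, is_bochner_integral mu f c.
Proof.
move=> mf fK; apply: (is_bochner_integral_ex hmu muk kmu mf).
have mnh : measurable_fun setT (fun t => (rnorm (h t))%:E).
  by apply/measurable_EFinP; exact: cmeasurable_rnorm.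
apply: (@le_lt_trans _ _ (\int[k]_t (`|K| * rnorm (h t))%:E)%E).
  apply: ge0_le_integral => //.
  - by move=> t _; rewrite lee_fin rnorm_ge0.
  - by apply/measurable_EFinP; exact: cmeasurable_rnorm.
  - by apply/measurable_EFinP; apply: measurable_funM => //; exact: cmeasurable_rnorm.
  move=> t _; rewrite lee_fin; apply: (le_trans (fK t)).
  by rewrite ler_wpM2r ?rnorm_ge0// ler_norm.
under eq_integral do rewrite EFinM.
rewrite ge0_integralZl_EFin//; last by move=> t _; rewrite lee_fin rnorm_ge0.
by rewrite lte_mul_pinfty.
Qed.

Local Notation nu := (weighted h mu).

Lemma weightedP B : measurable B ->
  is_bochner_integral mu (fun s => if s \in B then h s else 0) (nu B).
Proof.
move=> mB; have [c hc] : exists c, is_bochner_integral mu (fun s => if s \in B then h s else 0) c.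
  apply: (@is_bochner_integral_dominated _ 1); first exact: cmeasurable_if.
  by move=> t; rewrite mul1r; case: ifP => // _; rewrite rnorm0 rnorm_ge0.
by rewrite /weighted (bochnerE hmu muk kmu hc).
Qed.

Lemma weighted_le B : measurable B ->
  ((rnorm (nu B))%:E <= \int[k]_(t in B) (rnorm (h t))%:E)%E.
Proof.
move=> mB; have := is_bochner_integral_dist hmu muk kmu (weightedP mB) (is_bochner_integral0 muk kmu _).
rewrite subr0 => /le_trans; apply.
rewrite [leRHS]integral_mkcond; rewrite le_eqVlt; apply/orP; left; apply/eqP.
by apply: eq_integral => t _; rewrite subr0 /restrict/= /patch; case: ifP; rewrite ?rnorm0.
Qed.

Lemma weighted_complex_measure : complex_measure nu.
Proof.
move=> F mF tF; have mB := bigcup_measurable (P := setT) (fun i _ => mF i).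
have mnh := cmeasurable_rnorm mh.
(* By disjointness at most one summand is nonzero at each point, so the partial sums take only the
   values [h t] and 0, and [|h|] dominates the distances. *)
have sumE n t : \sum_(0 <= i < n) (if t \in F i then h t else 0) =
    if [exists i : 'I_n, t \in F i] then h t else 0.
  elim: n => [|n ih]; first by rewrite big_nil; case: fintype.existsP => // -[[]].
  rewrite big_nat_recr//= ih; case: ifPn => [/fintype.existsP[i ti]|ne].
    rewrite ifF ?addr0; last first.
      apply/negP => tn; have /trivIsetP /(_ i n Logic.I Logic.I) := tF.
      rewrite ltn_eqF// => /(_ isT)/seteqP[+ _] => /(_ t); apply.
      by split; exact: set_mem.
    by rewrite ifT//; apply/fintype.existsP; exists (widen_ord (leqnSn n) i).
  rewrite add0r; case: ifPn => tn; first by rewrite ifT//; apply/fintype.existsP; exists ord_max.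
  rewrite ifF//; apply/negbTE/fintype.existsPn => i; apply/negP => ti; case: (ltnP i n) => iin.
    by move/negP: ne; apply; apply/fintype.existsP; exists (Ordinal iin).
  have : i = n :> nat by apply/eqP; rewrite eqn_leq iin -ltnS ltn_ord.
  by move=> e; rewrite e (negbTE tn) in ti.
apply: (@is_bochner_integral_cvg _ (fun n t => \sum_(0 <= i < n) (if t \in F i then h t else 0))
  (fun s => if s \in \bigcup_i F i then h s else 0) _ _ (fun t => rnorm (h t))) => //.
- move=> n; apply: (is_bochner_integral_sum hmu muk kmu) => i; exact: weightedP.
- exact: weightedP.
- move=> t; case: ifPn => tF'.
    have [i _ ti] := set_mem tF'.
    apply: cvg_near_cst; near=> n.
    rewrite sumE ifT//; apply/fintype.existsP.
    have iin : (i < n)%N by near: n; exact: nbhs_infty_gt.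
    by exists (Ordinal iin); exact: mem_set.
  apply: cvg_near_cst; apply: nearW => n.
  rewrite sumE ifF//; apply/negbTE/fintype.existsPn => i; apply/negP => ti; move/negP: tF'; apply.
  by apply: mem_set; exists i => //; exact: set_mem.
- move=> n t; rewrite sumE; case: ifPn => tF'; case: ifPn => // e.
  + by rewrite subrr rnorm0 rnorm_ge0.
  + by rewrite subr0.
  + by rewrite sub0r rnormN.
  + by rewrite subrr rnorm0 rnorm_ge0.
Unshelve. all: by end_near. Qed.

Lemma weighted_simple (g : T -> R[i]^o) : is_simple g ->
  is_bochner_integral mu (fun t => g t * h t : R[i]^o) (simple_integral nu g).
Proof.
move=> [fg mg]; rewrite /simple_integral fsbig_finite//.
have -> : (fun t => g t * h t) = (fun t => \sum_(v <- fset_set (range g))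
    v *: ((if t \in g @^-1` [set v] then h t else 0) : R[i]^o)).
  apply/funext => t; rewrite (bigD1_seq (g t)) ?fset_uniq//=; last first.
    by rewrite in_fset_set// inE; exists t.
  rewrite ifT ?inE// big1 ?addr0// => v /negbTE vg.
  by rewrite ifF ?scaler0//; apply/negP; rewrite inE/= => e; rewrite e eqxx in vg.
apply: (is_bochner_integral_sum hmu muk kmu) => v.
have := is_bochner_integral_lin hmu muk kmu v 0 (weightedP (mg v)) (weightedP (mg v)).
rewrite scale0r addr0; under eq_fun do rewrite scale0r addr0.
by rewrite [in X in _ -> is_bochner_integral _ _ X]/GRing.scale/= mulrC.
Qed.

(** The density rule [d nu = h d mu]. Boundedness of [f] makes its roundings uniformly close, hence
    convergent in mean for a measure [k2] dominating [nu]; on the side of [mu] their products with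
    [h] are controlled by a multiple of [|h|]. *)
Lemma weighted_bochner (f : T -> R[i]^o) (K : R) (y : R[i]^o) : cmeasurable f ->
  (forall t, rnorm (f t) <= K) ->
  is_bochner_integral mu (fun t => f t * h t : R[i]^o) y ->
  bochner nu f = y.
Proof.
move=> mf fK fy; have hnu := weighted_complex_measure.
have [k2 [nuk knu]] := dominating_measure_ex hnu.
apply: (bochnerE hnu nuk knu); apply/(is_bochner_integralP nuk knu).
have [m1 m2] := mf; pose g := simple_approx f.
have gs n : is_simple (g n) by exact: is_simple_approx.
exists g; split => //.
- by move=> t; exact: (@simple_approx_cvg d T R f t).
- have gn n : (`|K| <= n%:R) -> (\int[k2]_t (rnorm (f t - g n t))%:E <= (2 / n.+1%:R)%:E * k2 setT)%E.
    move=> Kn; rewrite -integral_cst//; apply: ge0_le_integral => //.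
    + by move=> t _; rewrite lee_fin rnorm_ge0.
    + apply: measurable_dist; first exact: cmeasurable_strongly.
      exact: is_simple_strongly_measurable.
    + move=> t _; rewrite lee_fin; apply: simple_approx_close.
      by apply: (le_trans (fK t)); apply: le_trans Kn; exact: ler_norm.
  apply: (@squeeze_cvge _ _ _ _ (cst 0%E) _ (fun n => (2 / n.+1%:R)%:E * k2 setT)%E).
  + near=> n; apply/andP; split.
      by apply: integral_ge0 => t _; rewrite lee_fin rnorm_ge0.
    by apply: gn; near: n; exact: nbhs_infty_ger.
  + exact: cvg_cst.
  + have := @fin_num_measure _ _ _ k2 setT measurableT => /fineK <-.
    under eq_fun do rewrite -EFinM; apply/cvgE.
    rewrite -[X in _ --> X](mul0r (fine (k2 setT))); apply: cvgM; last exact: cvg_cst.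
    rewrite -[X in _ --> X](mulr0 2); apply: cvgM; first exact: cvg_cst.
    exact: cvg_harmonic.
- apply: (@is_bochner_integral_cvg R[i]^o (fun n t => g n t * h t) (fun t => f t * h t)
    (fun n => simple_integral nu (g n)) y (fun t => (2 + 2 * `|K|) * rnorm (h t))).
  + by move=> n; exact: weighted_simple.
  + exact: fy.
  + move=> t; apply/cvg_rnormP.
    have /cvg_rnormP c := @simple_approx_cvg d T R f t.
    have c' : (fun n => rnorm (f t - g n t)) @ \oo --> (0 : R) := c.
    suff s : (fun n => rnorm (f t * h t - g n t * h t)) @ \oo --> (0 : R) by exact: s.
    rewrite (_ : (fun n => _) = (fun n => rnorm (f t - g n t) * rnorm (h t))); last first.
      by apply/funext => n; rewrite -mulrBl rnormM.
    by rewrite -[X in _ --> X](mul0r (rnorm (h t))); apply: cvgM; [exact: c'|exact: cvg_cst].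
  + move=> n t; rewrite -mulrBl rnormM ler_wpM2r ?rnorm_ge0//.
    apply: (le_trans (@simple_approx_dist d T R f n t)).
    by rewrite lerD2l ler_pM2l//; apply: (le_trans (fK t)); exact: ler_norm.
  + by apply: measurable_funM => //; exact: cmeasurable_rnorm.
  + under eq_integral do rewrite EFinM.
    rewrite ge0_integralZl_EFin ?addr_ge0 ?mulr_ge0//.
    * by rewrite lte_mul_pinfty ?lee_fin ?addr_ge0 ?mulr_ge0.
    * by move=> t _; rewrite lee_fin rnorm_ge0.
    * by apply/measurable_EFinP; exact: cmeasurable_rnorm.
Unshelve. all: by end_near. Qed.

End weighted_measure.

Lemma cmeasurable_real d (T : measurableType d) (R : realType) (f : T -> R) :
  measurable_fun setT f -> cmeasurable (fun s => (f s)%:C).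
Proof. by move=> mf; split => //=; exact: measurable_cst. Qed.

Section exponential_moment.
Context (R : realType) (omega : R).
Hypothesis omega0 : 0 <= omega.

Lemma measurable_cosh : measurable_fun setT (fun s : R => cosh (omega * s)).
Proof.
have mo : measurable_fun setT (fun s : R => omega * s) by exact: measurable_funM.
apply: measurable_funM => //; apply: measurable_funD.
  by apply: measurableT_comp => //; exact: measurable_expR.
by apply: measurableT_comp; [exact: measurable_expR|exact: measurableT_comp].
Qed.

Let decay (s : R) : R[i]^o := (expR (- (omega * `|s|)))%:C.

Let decay_le1 s : rnorm (decay s) <= 1.
Proof.
rewrite rnormR ger0_norm ?expR_ge0// expR_le1 oppr_le0.
by rewrite mulr_ge0.
Qed.

Let mdecay : cmeasurable decay.
Proof.
apply: cmeasurable_real; apply: measurableT_comp; first exact: measurable_expR.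
apply: measurableT_comp => //; apply: measurable_funM => //; exact: normr_measurable.
Qed.

(** For [n <= |s| < n + 1] the decay is at most [exp (- omega n)] and [cosh] at most
    [exp (omega (n + 1))]; their product is at most [exp omega], uniformly in [n]. *)
Let shell (n : nat) : set R := [set s | Num.floor `|s| = n%:Z].

Let shellE n s : shell n s -> n%:R <= `|s| < n.+1%:R.
Proof.
rewrite /shell/= => fs; have := floor_itv `|s|; rewrite fs.
by rewrite intrD -!pmulrn natr1.
Qed.

Let measurable_shell n : measurable (shell n).
Proof.
have -> : shell n = (fun s => `|s|) @^-1` `[n%:R, n.+1%:R[.
  apply/seteqP; split => s /=; rewrite in_itv/=; first exact: shellE.
  move=> h; apply/eqP; rewrite floor_eq.
  by rewrite intrD -!pmulrn natr1.
rewrite -[X in measurable X]setTI; exact: normr_measurable.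
Qed.

Let trivIset_shell : trivIset setT shell.
Proof. by move=> i j _ _ [s [/= h1 h2]]; move: h1; rewrite /shell/= h2 => -[]. Qed.

Let bigcup_shell : \bigcup_n shell n = setT.
Proof.
apply/seteqP; split => // s _; exists `|Num.floor `|s| |%N => //.
by rewrite /shell/= gez0_abs// floor_ge0.
Qed.

(** [mu] is tied to [nu] only through values on sets, so the comparison is made on each shell, from
    [kn'] to the total variation of [mu] and then to [k]. The sum over shells is controlled by the
    finite mass of [kn']. *)
Lemma exponential_moment (mu : set R -> R[i]^o) (k : {finite_measure set R -> \bar R}) :
  in_M_omega omega mu ->
  (forall A, measurable A -> (k A <= 4%:E * total_variation mu A)%E) ->
  (\int[k]_s (cosh (omega * s))%:E < +oo)%E.
Proof.
move=> [hmu [nu hnu munu]] kmu.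
have [kn' [nuk knu]] := dominating_measure_ex hnu.
have fin : (\int[kn']_s (rnorm (decay s))%:E < +oo)%E.
  apply: (@le_lt_trans _ _ (\int[kn']_s (1%:E))%E).
    apply: ge0_le_integral => //.
    - by move=> s _; rewrite lee_fin rnorm_ge0.
    - by apply/measurable_EFinP; exact: cmeasurable_rnorm.
    - by move=> s _; rewrite lee_fin.
  rewrite integral_cst// mul1e.
  by rewrite -ge0_fin_numE// fin_num_measure.
have mule B : measurable B -> ((rnorm (mu B))%:E <= \int[kn']_(t in B) (rnorm (decay t))%:E)%E.
  by move=> mB; rewrite munu//; exact: (weighted_le hnu nuk knu mdecay fin mB).
have ksh n : (k (shell n) <= (4 * expR (- (omega * n%:R)))%:E * kn' (shell n))%E.
  apply: (le_trans (kmu _ (measurable_shell n))); rewrite EFinM -muleA.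
  rewrite lee_wpmul2l//.
  pose r : {nonneg R} := NngNum (expR_ge0 (- (omega * n%:R))).
  have -> : ((expR (- (omega * n%:R)))%:E * kn' (shell n) = mscale r kn' (shell n))%E by [].
  apply: (total_variation_le (measurable_shell n)) => B mB Bn.
  apply: (le_trans (mule B mB)).
  apply: (@le_trans _ _ ((expR (- (omega * n%:R)))%:E * kn' B)%E); last exact: lexx.
  rewrite -integral_cst//.
  apply: ge0_le_integral => //.
  - by move=> s _; rewrite lee_fin rnorm_ge0.
  - apply/measurable_EFinP; apply: measurable_funS (cmeasurable_rnorm mdecay) => //.
  move=> s Bs; rewrite lee_fin rnormR ger0_norm ?expR_ge0// ler_expR lerN2.
  by rewrite ler_wpM2l//; have /andP[] := shellE (Bn _ Bs).
rewrite -bigcup_shell ge0_integral_bigcup//; last 2 first.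
- apply/measurable_EFinP; rewrite bigcup_shell; exact: measurable_cosh.
- by move=> s _; rewrite lee_fin ltW// cosh_gt0.
apply: (@le_lt_trans _ _ (\sum_(n <oo) ((4 * expR omega)%:E * kn' (shell n)))%E).
  apply: lee_nneseries => [n _ _|n _].
    by apply: integral_ge0 => s _; rewrite lee_fin ltW// cosh_gt0.
  apply: (@le_trans _ _ (\int[k]_(s in shell n) (cst (expR (omega * n.+1%:R))%:E) s)%E).
    apply: ge0_le_integral => //.
    - by move=> s _; rewrite lee_fin ltW// cosh_gt0.
    - apply/measurable_EFinP; apply: measurable_funS measurable_cosh => //.
    move=> s sn; rewrite lee_fin; apply: (le_trans (cosh_le_expR _)).
    rewrite ler_expR normrM (ger0_norm omega0) ler_wpM2l//.
    by have /andP[_ /ltW] := shellE sn.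
  rewrite integral_cst//.
  apply: (le_trans (lee_wpmul2l _ (ksh n))); first by rewrite lee_fin expR_ge0.
  rewrite muleA -EFinM lee_wpmul2r// lee_fin mulrCA -expRD.
  rewrite ler_pM2l// ler_expR -natr1; lra.
rewrite nneseriesZl//.
rewrite -measure_semi_bigcup//; last by rewrite bigcup_shell.
rewrite bigcup_shell lte_mul_pinfty ?lee_fin ?mulr_ge0 ?expR_ge0//.
by rewrite -ge0_fin_numE// fin_num_measure.
Qed.

End exponential_moment.

Lemma measurable_cos (R : realType) : measurable_fun setT (@cos R).
Proof. by apply: continuous_measurable_fun; exact: continuous_cos. Qed.

Lemma measurable_sin (R : realType) : measurable_fun setT (@sin R).
Proof. by apply: continuous_measurable_fun; exact: continuous_sin. Qed.

Lemma cmeasurable_cis d (T : measurableType d) (R : realType) (f : T -> R) :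
  measurable_fun setT f -> cmeasurable (fun s => cis (f s)).
Proof.
move=> mf; split => /=; apply: measurableT_comp => //.
  exact: measurable_cos.
exact: measurable_sin.
Qed.

Lemma cvg_le_ereal (R : realType) (u : R^nat) (l : R) (N : \bar R) :
  u @ \oo --> l -> (forall n, ((u n)%:E <= N)%E) -> (l%:E <= N)%E.
Proof.
move=> ul; case: N => [r| |] uN.
- by rewrite lee_fin; apply: (ler_cvg_to ul (cvg_cst r)); apply: nearW => n; exact: uN.
- exact: leey.
- by have := uN 0%N; rewrite leNgt ltNyr.
Qed.

(* A null set contains no interval. *)
Lemma continuous_ae_le (R : realType) (f : R -> R) (N : \bar R) :
  (forall u : R^nat, forall z, u @ \oo --> z -> f \o u @ \oo --> f z) ->
  (\forall x \ae (@lebesgue_measure R), ((f x)%:E <= N)%E) -> forall z, ((f z)%:E <= N)%E.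
Proof.
move=> fc fN z.
have ex n : exists x, `|z - x| < n.+1%:R^-1 /\ ((f x)%:E <= N)%E.
  apply: contrapT => ne; have [B [mB B0 nB]] := fN.
  have n0 : 0 < (n.+1%:R : R)^-1 by rewrite invr_gt0.
  pose I : set R := `]z - n.+1%:R^-1, z + n.+1%:R^-1[%classic.
  have IB : I `<=` B.
    move=> x; rewrite /I/= in_itv/= => /andP[x1 x2]; apply: nB => /= fx.
    by apply: ne; exists x; split => //; rewrite distrC ltr_distl x1 x2.
  have mI : (@lebesgue_measure R I = (n.+1%:R^-1 + n.+1%:R^-1)%:E)%E.
    have := lebesgue_measure_itv `]z - n.+1%:R^-1, z + n.+1%:R^-1[%R; rewrite -/I => ->.
    rewrite /= lte_fin ltrD2l gtrN// -EFinB; congr (_%:E); ring.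
  have h : (@lebesgue_measure R I <= lebesgue_measure (B : set R))%E.
    by apply: le_measure; rewrite ?inE//; exact: measurable_itv.
  have : (0 < @lebesgue_measure R I)%E by rewrite mI lte_fin addr_gt0.
  by rewrite ltNge; apply/negP/negPn; apply: (le_trans h); rewrite [leLHS]B0.
pose u n := projT1 (cid (ex n)).
have u1 n : `|z - u n| < n.+1%:R^-1 by rewrite /u; case: cid => x [].
have u2 n : ((f (u n))%:E <= N)%E by rewrite /u; case: cid => x [].
have uz : u @ \oo --> z.
  apply/cvgrPdist_lt => e e0; near=> n; apply: (lt_trans (u1 n)).
  rewrite invf_plt ?posrE//; apply: lt_trans (_ : n%:R < n.+1%:R); last by rewrite ltr_nat.
  by near: n; exact: nbhs_infty_gtr.
exact: (cvg_le_ereal (fc _ _ uz) u2).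
Unshelve. all: by end_near. Qed.

Section weighted_fourier.
Context (R : realType).
Variables (mu : set R -> R[i]^o) (hmu : complex_measure mu).
Variable k : {finite_measure set R -> \bar R}.
Hypothesis muk : forall A, measurable A -> ((rnorm (mu A))%:E <= k A)%E.
Hypothesis kmu : forall A, measurable A -> (k A <= 4%:E * total_variation mu A)%E.
Variables (omega : R).
Hypothesis kcosh : (\int[k]_s (cosh (omega * s))%:E < +oo)%E.

Definition cosh_weight (s : R) : R[i]^o := (cosh (omega * s))%:C.

Lemma rnorm_cosh_weight s : rnorm (cosh_weight s) = cosh (omega * s).
Proof. by rewrite rnormR gtr0_norm// cosh_gt0. Qed.

Lemma cmeasurable_cosh_weight : cmeasurable cosh_weight.
Proof. by apply: cmeasurable_real; exact: measurable_cosh. Qed.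

Let kh : (\int[k]_s (rnorm (cosh_weight s))%:E < +oo)%E.
Proof. by under eq_integral do rewrite rnorm_cosh_weight. Qed.

Definition weighted_integral (f : R -> R[i]^o) : R[i]^o :=
  bochner mu (fun s => f s * cosh_weight s).

Lemma weighted_integralP (f : R -> R[i]^o) (K : R) : cmeasurable f ->
  (forall s, rnorm (f s) <= K) ->
  is_bochner_integral mu (fun s => f s * cosh_weight s : R[i]^o) (weighted_integral f).
Proof.
move=> mf fK.
have [c hc] : exists c, is_bochner_integral mu (fun s => f s * cosh_weight s : R[i]^o) c.
  apply: (is_bochner_integral_dominated hmu muk kmu cmeasurable_cosh_weight kh (K := K)).
    by apply: cmeasurableM => //; exact: cmeasurable_cosh_weight.
  by move=> t; rewrite rnormM ler_wpM2r ?rnorm_ge0.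
by rewrite /weighted_integral (bochnerE hmu muk kmu hc).
Qed.

Lemma fourier_mu_weight z :
  fourier (mu_weight omega mu) z = weighted_integral (fun s => cis (- (z * s))).
Proof.
have mf : cmeasurable (fun s : R => cis (- (z * s)) : R[i]^o).
  by apply: cmeasurable_cis; apply: measurableT_comp => //; exact: measurable_funM.
have f1 s : rnorm (cis (- (z * s)) : R[i]^o) <= 1 by rewrite rnorm_cis.
rewrite /fourier /mu_weight.
have -> : (fun s : R => cos (z * s) +i* - sin (z * s) : R[i]^o) =
    (fun s => cis (- (z * s)) : R[i]^o).
  by apply/funext => s; rewrite /cis cosN sinN.
apply: (weighted_bochner hmu muk kmu cmeasurable_cosh_weight kh mf f1).
exact: (weighted_integralP mf f1).
Qed.

Lemma fourier_mu_weight_cvg (u : R^nat) (z : R) : u @ \oo --> z ->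
  (fun n => rnorm (fourier (mu_weight omega mu) (u n))) @ \oo -->
  rnorm (fourier (mu_weight omega mu) z).
Proof.
move=> uz; apply: cvg_rnorm.
rewrite fourier_mu_weight (_ : (fun n => _) = (fun n => weighted_integral (fun s => cis (- (u n * s))))); last first.
  by apply/funext => n; rewrite fourier_mu_weight.
have mf y : cmeasurable (fun s : R => cis (- (y * s)) : R[i]^o).
  by apply: cmeasurable_cis; apply: measurableT_comp => //; exact: measurable_funM.
have f1 y s : rnorm (cis (- (y * s)) : R[i]^o) <= 1 by rewrite rnorm_cis.
apply: (is_bochner_integral_cvg hmu muk kmu (g := fun s => 2 * cosh (omega * s))).
- by move=> n; exact: (weighted_integralP (mf _) (f1 _)).
- exact: (weighted_integralP (mf _) (f1 _)).
- move=> t; apply/cvg_complexP.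
  have c : - (u n * t) @[n --> \oo] --> - (z * t).
    by apply: cvgN; apply: cvgM => //; exact: cvg_cst.
  have cc : cos (- (u n * t)) @[n --> \oo] --> cos (- (z * t)).
    by apply: continuous_cvg => //; exact: continuous_cos.
  have cs : sin (- (u n * t)) @[n --> \oo] --> sin (- (z * t)).
    by apply: continuous_cvg => //; exact: continuous_sin.
  split => /=.
    rewrite !mulr0 !subr0 (_ : (fun n => _) = (fun n => cos (- (u n * t)) * cosh (omega * t))); last first.
      by apply/funext => n; rewrite /= mulr0 subr0.
    by apply: cvgM => //; exact: cvg_cst.
  rewrite !mulr0 !add0r (_ : (fun n => _) = (fun n => sin (- (u n * t)) * cosh (omega * t))); last first.
    by apply/funext => n; rewrite /= mulr0 add0r.
  by apply: cvgM => //; exact: cvg_cst.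
- move=> n t; rewrite -mulrBl rnormM rnorm_cosh_weight ler_wpM2r ?(ltW (cosh_gt0 _))//.
  by apply: (le_trans (rnormB _ _)); rewrite !rnorm_cis.
- by apply: measurable_funM => //; exact: measurable_cosh.
- under eq_integral do rewrite EFinM.
  rewrite ge0_integralZl_EFin//.
  + by rewrite lte_mul_pinfty.
  + by move=> s _; rewrite lee_fin ltW// cosh_gt0.
  + by apply/measurable_EFinP; exact: measurable_cosh.
Qed.

(** [Lnorm] at [+oo] is the essential supremum only on a space of positive measure. *)
Let lebT : (0 < @lebesgue_measure R setT)%E.
Proof.
rewrite (_ : setT = [set` `]-oo, +oo[%R]); last by rewrite set_itvE.
rewrite lebesgue_measure_itv/=.
by rewrite ltry.
Qed.

(** The discretisation samples the Fourier transform at single points; by continuity the essential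
    supremum bounds it at every point. *)
Lemma fourier_le_Linfty z :
  ((rnorm (fourier (mu_weight omega mu) z))%:E <= Linfty_norm (fourier (mu_weight omega mu)))%E.
Proof.
apply: (@continuous_ae_le R (fun z => rnorm (fourier (mu_weight omega mu) z))) => [u y uy|].
  exact: fourier_mu_weight_cvg.
rewrite /Linfty_norm unlock lebT.
have := @ess_sup_ge _ _ _ (@lebesgue_measure R)
  (abse \o (fun z => (rnorm (fourier (mu_weight omega mu) z))%:E)).
by apply: filterS => x /=; rewrite ger0_norm// rnorm_ge0.
Qed.

Lemma fourier_Linfty_fin : Linfty_norm (fourier (mu_weight omega mu)) \is a fin_num.
Proof.
rewrite ge0_fin_numE; last first.
  by apply: le_trans (fourier_le_Linfty 0); rewrite lee_fin rnorm_ge0.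
apply: le_lt_trans kcosh; rewrite /Linfty_norm unlock lebT.
apply/ess_supP; apply: aeW => z /=; rewrite ger0_norm ?rnorm_ge0// fourier_mu_weight.
have mf : cmeasurable (fun s : R => cis (- (z * s)) : R[i]^o).
  by apply: cmeasurable_cis; apply: measurableT_comp => //; exact: measurable_funM.
have f1 s : rnorm (cis (- (z * s)) : R[i]^o) <= 1 by rewrite rnorm_cis.
have := is_bochner_integral_dist hmu muk kmu (weighted_integralP mf f1)
  (is_bochner_integral0 muk kmu _).
rewrite subr0 => /le_trans; apply; rewrite le_eqVlt; apply/orP; left; apply/eqP.
by apply: eq_integral => s _; rewrite subr0 rnormM rnorm_cosh_weight rnorm_cis mul1r.
Qed.

End weighted_fourier.

(** * Discretisation of the integral *)

Section positive_definite_interpolation.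
Context {R : realType}.
Variables (nu : nat) (xi : R).
Hypothesis xi_pi : `|xi| <= pi.

Let n := (nu + nu).+1.
Let nR : n%:R != 0 :> R. Proof. by rewrite pnatr_eq0. Qed.
Let n0 : 0 < n%:R :> R. Proof. by rewrite ltr0n. Qed.

(** All [n] frequencies are congruent to [xi] modulo [2 pi]. The range is centred so that, divided
    by [n], they stay in [[-pi, pi]], where cosine is monotone in the modulus. *)
Definition frequency (j : 'I_n) : R := xi + 2 * pi * (j%:R - nu%:R).

Let S (j : 'I_n) : R[i] := \sum_(i < n) cis (frequency j * i%:R / n%:R).

(** A discrete Fejer kernel: the squared modulus of a normalised geometric sum, with total mass 1
    over [j]. *)
Definition frequency_weight (j : 'I_n) : R := rnorm (S j : R[i]^o) ^+ 2 / n%:R ^+ 2.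

Local Notation z := frequency.
Local Notation q := frequency_weight.

Lemma frequency_weight_ge0 j : 0 <= q j.
Proof. by rewrite divr_ge0 ?sqr_ge0. Qed.

Lemma frequency_le j : `|z j| <= pi * n%:R.
Proof.
have jn := ltn_ord j; have p0 := pi_ge0 R.
have h1 : `|(j%:R - nu%:R : R)| <= nu%:R.
  rewrite ler_norml; apply/andP; split; first by rewrite lerBrDl subrr.
  by rewrite lerBlDr -natrD ler_nat -ltnS.
apply: (le_trans (ler_normD _ _)); rewrite normrM ger0_norm ?mulr_ge0//.
have : 2 * pi * `|(j%:R - nu%:R : R)| <= 2 * pi * nu%:R by rewrite ler_wpM2l ?mulr_ge0.
have -> : pi * n%:R = pi + 2 * pi * nu%:R :> R by rewrite /n -addn1 natrD natrD; ring.
exact: lerD.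
Qed.

Let mulconj (w : R[i]) : ((rnorm (w : R[i]^o)) ^+ 2)%:C = w * w^*%C.
Proof.
rewrite rnormCE sqr_sqrtr ?addr_ge0 ?sqr_ge0//; case: w => a b /=.
by apply/eqP; rewrite eq_complex/=; apply/andP; split; apply/eqP; ring.
Qed.

Let q_complex j : (q j)%:C = (n%:R ^- 2)%:C *
  \sum_(i' < n) \sum_(i < n) cis (z j * (i%:R - i'%:R) / n%:R).
Proof.
rewrite /q mulrC rmorphM/= mulconj; congr (_ * _).
rewrite /S (raddf_sum (@conjc R)) mulrC mulr_suml; apply: eq_bigr => i' _.
rewrite mulr_sumr; apply: eq_bigr => i _.
transitivity (cis (- (z j * i'%:R / n%:R)) * cis (z j * i%:R / n%:R)); first by rewrite cisN.
by rewrite -cisD; congr cis; field.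
Qed.

(** A convex combination of characters, hence positive definite. On the grid [1/n] it is the linear
    interpolation of [m |-> exp (- i xi m)] between integers. *)
Definition interpolation (u : R) : R[i] := \sum_(j < n) (q j)%:C * cis (- (z j * u)).

(** Expand the square in [q] and sum over [j] first: only the pairs with [i] congruent to [i' + r]
    modulo [n] remain, and the quotient of [i' + r] by [n] becomes the exponent of
    [exp (- i xi)]. *)
Lemma interpolation_grid (r : int) : interpolation (r%:~R / n%:R) =
  (n%:R^-1)%:C * \sum_(i < n) cis (- (xi * ((i%:Z + r) %/ n%:Z)%Z%:~R)).
Proof.
transitivity (\sum_(i' < n) \sum_(i < n) (n%:R ^- 2)%:C *
    (cis ((xi - 2 * pi * nu%:R) * (i%:Z - i'%:Z - r)%:~R / n%:R) *
     \sum_(j < n) cis (2 * pi * (i%:Z - i'%:Z - r)%:~R * j%:R / n%:R))).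
  rewrite /interpolation.
  under eq_bigr do rewrite q_complex -mulrA mulr_suml mulr_sumr.
  rewrite exchange_big/=; apply: eq_bigr => i' _.
  under eq_bigr do rewrite mulr_suml mulr_sumr.
  rewrite exchange_big/=; apply: eq_bigr => i _.
  rewrite !mulr_sumr; apply: eq_bigr => j _; rewrite -!cisD; congr (_ * cis _).
  by rewrite /z !intrD !intrN -!pmulrn; field.
rewrite mulr_sumr; apply: eq_bigr => i' _.
pose m := ((i'%:Z + r) %% n%:Z)%Z; pose d := ((i'%:Z + r) %/ n%:Z)%Z.
have md : i'%:Z + r = d * n%:Z + m := divz_eq _ _.
have m0 : (0 <= m)%R by rewrite modz_ge0.
have mn : (m < n%:Z)%R by apply: ltz_pmod.
have mm : (`|m| < n)%N by lia.
rewrite (bigD1 (Ordinal mm))//= [X in _ + X]big1 ?addr0 => [|i im]; last first.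
  rewrite character_sum// ifF ?mulr0//; apply/negbTE/negP => /dvdzP[t it].
  move/negP: im; apply; apply/eqP/val_inj => /=; have il := ltn_ord i.
  have e : i%:Z - m = (t + d) * n%:Z by rewrite mulrDl -it; move: md; lia.
  have [t0|[t0|t0]] : t + d = 0 \/ (1 <= t + d)%R \/ (t + d <= -1)%R by lia.
  - by move: e; rewrite t0; lia.
  - by nia.
  - by nia.
have iE : `|m|%N%:Z - i'%:Z - r = - d * n%:Z by rewrite gez0_abs//; move: md; lia.
rewrite character_sum// iE ifT; last by apply/dvdzP; exists (- d).
have -> : cis ((xi - 2 * pi * nu%:R) * (- d * n%:Z)%:~R / n%:R) = cis (- (xi * d%:~R)) :> R[i].
  have -> : (xi - 2 * pi * nu%:R) * (- d * n%:Z)%:~R / n%:R =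
      - (xi * d%:~R) + 2 * pi *~ (nu%:Z * d) :> R.
    by rewrite -[2 * pi *~ _]mulrzr !intrM intrN -!pmulrn; field.
  by rewrite cisD cis_2pi_int mulr1.
rewrite mulrCA mulrC; congr (_ * _).
rewrite -(rmorph_nat (real_complex R)) -rmorphM/=; congr (_%:C).
by field.
Qed.

Lemma sum_frequency_weight : \sum_(j < n) q j = 1.
Proof.
apply: (@complexI R); have := interpolation_grid 0; rewrite mul0r /interpolation.
under eq_bigr do rewrite mulr0 oppr0 cis0 mulr1.
rewrite -rmorph_sum => -> /=.
have -> : \sum_(i < n) cis (- (xi * ((i%:Z + 0) %/ n%:Z)%Z%:~R)) = n%:R%:C.
  rewrite rmorph_nat -[X in X%:R]card_ord -sumr_const; apply: eq_bigr => i _.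
  have -> : ((i%:Z + 0) %/ n%:Z)%Z = 0 by rewrite addr0 divz_small// lez_nat ltz_nat ltn_ord.
  by rewrite mulr0 oppr0 cis0.
by rewrite -rmorphM/= mulVf.
Qed.

(* The left-hand side is the real part of [1 - interpolation (1 / n)]. *)
Lemma sum_one_minus_cos : \sum_(j < n) q j * (1 - cos (z j / n%:R)) <= 2 / n%:R.
Proof.
have -> : \sum_(j < n) q j * (1 - cos (z j / n%:R)) = 1 - complex.Re (interpolation (1%:~R / n%:R)).
  rewrite /interpolation Re_sum -[X in _ = X - _]sum_frequency_weight -sumrB; apply: eq_bigr => j _ /=.
  by rewrite cosN mul0r subr0 mulrBr mulr1 mulrA mulr1.
rewrite interpolation_grid big_ord_recr/=.
(* For [r = 1] the quotient is 0 for every [i] but the last, so a single term differs from 1. *)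
have -> : \sum_(i < nu + nu) cis (- (xi * ((i%:Z + 1) %/ n%:Z)%Z%:~R)) = (nu + nu)%:R%:C.
  rewrite rmorph_nat -[X in X%:R]card_ord -sumr_const; apply: eq_bigr => i _.
  rewrite divz_small ?mulr0z ?mulr0 ?oppr0 ?cis0//.
  by have := ltn_ord i; rewrite /n; lia.
have -> : (((nu + nu)%N%:Z + 1) %/ n%:Z)%Z = 1.
  by rewrite -PoszD addn1 divzz.
have c := cos_geN1 (- (xi * 1%:~R)).
rewrite /cis; move: c; set cx := cos _ => c.
have -> : complex.Re (n%:R^-1%:C * ((nu + nu)%:R%:C + (cx +i* sin (- (xi * 1%:~R))))) =
    n%:R^-1 * ((nu + nu)%:R + cx).
  by rewrite /=; ring.
have e : n%:R = (nu + nu)%:R + 1 :> R by rewrite /n -addn1 natrD.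
rewrite lerBlDr.
have -> : (2 / n%:R + n%:R^-1 * ((nu + nu)%:R + cx)) = (2 + (nu + nu)%:R + cx) / n%:R by field.
by rewrite ler_pdivlMr// e; lra.
Qed.

(* As [interpolation] is positive definite, its oscillation at scale [1 / n] is
   controlled by its value at [1 / n]; Cauchy-Schwarz is used in the form
   [2 * delta * t <= delta ^+ 2 + t ^+ 2]. *)
Lemma interpolation_modulus (u v delta : R) : 0 < delta -> 4 / n%:R <= delta ^+ 2 ->
  `|v| <= n%:R^-1 -> rnorm (interpolation u - interpolation (u + v) : R[i]^o) <= delta.
Proof.
move=> d0 dn vn.
have -> : interpolation u - interpolation (u + v) =
    \sum_(j < n) (q j)%:C * (cis (- (z j * u)) * (1 - cis (- (z j * v)))).
  rewrite /interpolation -sumrB; apply: eq_bigr => j _.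
  by rewrite -mulrBr; congr (_ * _); rewrite mulrDr opprD cisD mulrBr mulr1.
apply: (le_trans (@rnorm_sum R R[i]^o _ _ _ _)).
apply: (@le_trans _ _ (\sum_(j < n) (q j * (delta / 2) + q j * (1 - cos (z j / n%:R)) / delta))).
  apply: ler_sum => j _; rewrite !(@rnormM R) rnormR ger0_norm ?frequency_weight_ge0//.
  rewrite rnorm_cis mul1r -mulrA -mulrDr ler_wpM2l ?frequency_weight_ge0//.
  set t := rnorm _; have t0 : 0 <= t by exact: rnorm_ge0.
  have t2 : t ^+ 2 = 2 * (1 - cos (z j * v)).
    rewrite /t rnormCE sqr_sqrtr ?addr_ge0 ?sqr_ge0//= cosN sinN.
    by have := cos2Dsin2 (z j * v); move: (cos _) (sin _) => a b h; lra.
  (* [|z j| / n] is at most [pi] and cosine decreases on [[0, pi]], so [|v| = 1/n] is the worst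
     case. *)
  have cm : cos (z j / n%:R) <= cos (z j * v).
    have ca (y : R) : cos y = cos `|y| by case: (ger0P y); rewrite ?cosN.
    rewrite (ca (z j / _)) (ca (z j * v)) !normrM normfV normr_nat.
    have l1 : `|z j| * `|v| <= `|z j| / n%:R by rewrite ler_wpM2l.
    have l2 : `|z j| / n%:R <= pi by rewrite ler_pdivrMr// frequency_le.
    have [->//|ne] := eqVneq (`|z j| * `|v|) (`|z j| / n%:R).
    rewrite ltW// ltr_cos ?lt_neqAle ?ne ?l1//.
    - by rewrite in_itv/= mulr_ge0//= (le_trans l1).
    - by rewrite in_itv/= divr_ge0.
  rewrite -(@ler_pM2r _ (2 * delta)) ?mulr_gt0//.
  have -> : (delta / 2 + (1 - cos (z j / n%:R)) / delta) * (2 * delta) =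
      delta ^+ 2 + 2 * (1 - cos (z j / n%:R)) by field; rewrite gt_eqF.
  by have := sqr_ge0 (t - delta); nra.
rewrite big_split/=.
have -> : \sum_(j < n) q j * (delta / 2) = delta / 2.
  by rewrite -mulr_suml sum_frequency_weight mul1r.
rewrite -mulr_suml.
have : (\sum_(j < n) q j * (1 - cos (z j / n%:R))) / delta <= delta / 2.
  rewrite ler_pdivrMr//; have := sum_one_minus_cos.
  move=> /le_trans; apply; have : 4 / n%:R = 2 * (2 / n%:R) :> R by field.
  by move: dn => /[swap] ->; move: (2 / _) => y; lra.
lra.
Qed.

End positive_definite_interpolation.

(** The symbol depends on [xi] only modulo [2 pi], while [frequency_le] requires [|xi| <= pi]. *)
Lemma cis_reduction (R : realType) (xi : R) : exists2 xi' : R, `|xi'| <= pi &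
  forall m : int, cis (- (xi * m%:~R)) = cis (- (xi' * m%:~R)).
Proof.
have p0 := pi_gt0 R.
pose l := Num.floor ((xi + pi) / (2 * pi)).
exists (xi - 2 * pi * l%:~R) => [|m].
  have := floor_itv ((xi + pi) / (2 * pi)); rewrite -/l => /andP[h1 h2].
  move: h1 h2; rewrite ler_pdivlMr ?mulr_gt0// ltr_pdivrMr ?mulr_gt0// intrD => h1 h2.
  by rewrite ler_norml; apply/andP; split; lra.
have -> : - ((xi - 2 * pi * l%:~R) * m%:~R) = - (xi * m%:~R) + 2 * pi *~ (l * m).
  by rewrite -[2 * pi *~ _]mulrzr intrM; ring.
by rewrite cisD cis_2pi_int mulr1.
Qed.

Section rounding_steps.
Context {R : realType}.
Variables (nu : nat) (h : R).
Hypothesis h0 : 0 < h.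
Local Notation n := (nu + nu).+1.

(* The point [s / h] shifted by [i / n] and rounded down.  Averaging over [i < n]
   makes the symbol of the discretisation positive definite. *)
Definition round_step (i : nat) (s : R) : int :=
  ((i%:Z + Num.floor (s * n%:R / h)) %/ n%:Z)%Z.

Let n0 : 0 < n%:R :> R. Proof. by rewrite ltr0n. Qed.

(** Rounding down twice, to the grid [1/n] and then to the integers, is the same as rounding
    [(i + s n / h) / n] down once. *)
Let step_bounds i s :
  (round_step i s)%:~R * n%:R <= i%:R + s * n%:R / h < (round_step i s)%:~R * n%:R + n%:R.
Proof.
set t := s * n%:R / h; have /andP[f1 f2] := floor_itv t.
set l := Num.floor t in f1 f2 *; rewrite /round_step -/t -/l.
set m := (_ %/ _)%Z.
have md := divz_eq (i%:Z + l) n%:Z; rewrite -/m in md.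
have m0 : (0 <= (i%:Z + l) %% n%:Z)%Z by rewrite modz_ge0.
have mn : ((i%:Z + l) %% n%:Z < n%:Z)%Z by apply: ltz_pmod.
have h1 : (m * n%:Z <= i%:Z + l)%R by rewrite [leRHS]md lerDl.
have h2 : (i%:Z + l + 1 <= m * n%:Z + n%:Z)%R by rewrite {1}md -addrA lerD2l lezD1.
have {}h1 : (m * n%:Z)%:~R <= (i%:Z + l)%:~R :> R by rewrite ler_int.
have {}h2 : (i%:Z + l + 1)%:~R <= (m * n%:Z + n%:Z)%:~R :> R by rewrite ler_int.
rewrite !intrD !intrM -!pmulrn in h1 h2 f2.
by apply/andP; split; lra.
Qed.

Lemma round_step_close i s : (i < n)%N -> `|(round_step i s)%:~R * h - s| <= 2 * h.
Proof.
move=> iltn; have /andP[b1 b2] := step_bounds i s.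
set m := (round_step i s)%:~R in b1 b2 *.
have i1 : i%:R <= n%:R :> R by rewrite ler_nat ltnW.
have i2 : 0 <= i%:R :> R by [].
have hn : 0 < h / n%:R by rewrite divr_gt0.
have e : s * n%:R / h * (h / n%:R) = s by field; rewrite !gt_eqF.
have e2 : m * n%:R * (h / n%:R) = m * h by field; rewrite !gt_eqF.
have e3 : n%:R * (h / n%:R) = h by field; rewrite !gt_eqF.
have c1 : m * n%:R * (h / n%:R) <= (n%:R + s * n%:R / h) * (h / n%:R).
  by rewrite ler_pM2r//; lra.
have c2 : s * n%:R / h * (h / n%:R) <= (m * n%:R + n%:R) * (h / n%:R).
  by rewrite ler_pM2r//; lra.
rewrite !mulrDl e e2 e3 in c1 c2.
by rewrite ler_norml; apply/andP; split; have := h0; lra.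
Qed.

Lemma measurable_round_step i (m : int) :
  measurable_fun setT (fun s : R => (round_step i s == m)%:R : R).
Proof.
pose a : R := (m%:~R * n%:R - i%:R) * h / n%:R.
pose b : R := (m%:~R * n%:R + n%:R - i%:R) * h / n%:R.
have -> : (fun s : R => (round_step i s == m)%:R : R) =
    (fun s => if (a <= s) && (s < b) then 1 else 0).
  apply/funext => s.
  have hn : 0 < h / n%:R by rewrite divr_gt0.
  have aE : (a <= s) = (m%:~R * n%:R <= i%:R + s * n%:R / h).
    rewrite /a -mulrA -ler_pdivlMr// -[in RHS]lerBlDl.
    by congr (_ <= _); field; rewrite !gt_eqF.
  have bE : (s < b) = (i%:R + s * n%:R / h < m%:~R * n%:R + n%:R).
    rewrite /b -mulrA -ltr_pdivrMr// -[in RHS]ltrBrDl.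
    by congr (_ < _); field; rewrite !gt_eqF.
  rewrite aE bE; have /andP[b1 b2] := step_bounds i s.
  case: eqVneq => [<-|ne]; first by rewrite b1 b2.
  rewrite ifF//; apply/negbTE/negP => /andP[c1 c2]; move/negP: ne; apply; apply/eqP.
  set k := round_step i s in b1 b2 *.
  have l1 : k%:~R < (m + 1)%:~R :> R.
    by rewrite -(ltr_pM2r n0) intrD mulrDl mul1r; lra.
  have l2 : m%:~R < (k + 1)%:~R :> R.
    by rewrite -(ltr_pM2r n0) intrD mulrDl mul1r; lra.
  by rewrite !ltr_int in l1 l2; lia.
apply: measurable_fun_ifT => //.
by apply: measurable_and; [exact: measurable_fun_ler|exact: measurable_fun_ltr].
Qed.

(** A piecewise constant tent function around [m h]; these functions form a partition of unity over
    [m]. *)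
Definition hat (m : int) (s : R) : R := n%:R^-1 * \sum_(i < n) (round_step i s == m)%:R.

Lemma hat_ge0 m s : 0 <= hat m s.
Proof. by rewrite mulr_ge0 ?invr_ge0// sumr_ge0. Qed.

Lemma hat_le1 m s : hat m s <= 1.
Proof.
rewrite /hat mulrC ler_pdivrMr// mul1r -[X in _ <= X%:R]card_ord -sumr_const.
by apply: ler_sum => i _; case: (_ == _).
Qed.

Lemma measurable_hat m : measurable_fun setT (hat m).
Proof.
apply: measurable_funM => //; apply: measurable_sum => i; exact: measurable_round_step.
Qed.

Lemma sum_hat (X : lmodType R[i]) (ms : seq int) (G : int -> X) s : uniq ms ->
  (forall i, (i < n)%N -> round_step i s \in ms) ->
  \sum_(m <- ms) (hat m s)%:C *: G m = (n%:R^-1)%:C *: \sum_(i < n) G (round_step i s).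
Proof.
move=> ums sms.
have -> : \sum_(m <- ms) (hat m s)%:C *: G m =
    (n%:R^-1)%:C *: \sum_(m <- ms) \sum_(i < n) (round_step i s == m)%:R *: G m.
  rewrite scaler_sumr; apply: eq_bigr => m _.
  rewrite /hat rmorphM/= -scalerA -scaler_suml; congr (_ *: (_ *: _)).
  by rewrite rmorph_sum; apply: eq_bigr => i _; case: (_ == _).
congr (_ *: _); rewrite exchange_big/=; apply: eq_bigr => i _.
rewrite (bigD1_seq (round_step i s)) ?sms//= eqxx scale1r big1 ?addr0// => m ne.
by rewrite eq_sym (negbTE ne) scale0r.
Qed.

End rounding_steps.

Section discretisation.
Context (R : realType).
Variables (mu : set R -> R[i]^o) (hmu : complex_measure mu).
Variable k : {finite_measure set R -> \bar R}.
Hypothesis muk : forall A, measurable A -> ((rnorm (mu A))%:E <= k A)%E.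
Hypothesis kmu : forall A, measurable A -> (k A <= 4%:E * total_variation mu A)%E.
Variables (omega : R).
Hypothesis kcosh : (\int[k]_s (cosh (omega * s))%:E < +oo)%E.
Variables (nu : nat) (h L : R) (Lam : nat).
Hypotheses (h0 : 0 < h) (hLam : L / h + 2 <= Lam%:R).
Local Notation n := (nu + nu).+1.
Local Notation cw := (cosh_weight omega).

Definition cut_hat (m : int) (s : R) : R[i]^o := if `|s| <= L then (hat nu h m s)%:C else 0.

Definition int_range : seq int := [seq i%:Z - Lam%:Z | i <- iota 0 (Lam + Lam).+1].

Definition discretisation : seq (int * R[i]) :=
  [seq (m, weighted_integral mu omega (cut_hat m) : R[i]) | m <- int_range].

Lemma int_range_uniq : uniq int_range.
Proof. by rewrite map_inj_uniq ?iota_uniq// => i j; lia. Qed.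

(** [round_step] moves a point by at most [2 h], which accounts for the 2 in the hypothesis on
    [Lam]. *)
Lemma round_step_range s i : `|s| <= L -> (i < n)%N -> round_step nu h i s \in int_range.
Proof.
move=> sL iltn; have := round_step_close h0 s iltn.
set m := round_step nu h i s => c.
have ml : `|m|%:~R <= Lam%:R :> R.
  rewrite intr_norm; apply: le_trans hLam; rewrite -(ler_pM2r h0) mulrDl divfK ?gt_eqF//.
  rewrite -{1}(gtr0_norm h0) -normrM.
  have : `|m%:~R * h| <= `|m%:~R * h - s| + `|s| by rewrite -{1}(subrK s (_ * h)) ler_normD.
  lra.
rewrite -[Lam%:R]/(Lam%:Z%:~R) ler_int in ml.
apply/mapP; exists `|(m + Lam%:Z)%R|%N; last by lia.
by rewrite mem_iota; lia.
Qed.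

Lemma cmeasurable_cut_hat m : cmeasurable (cut_hat m).
Proof.
have := cmeasurable_if (B := [set s : R | `|s| <= L]) (f := fun s => (hat nu h m s)%:C).
have mB : measurable [set s : R | `|s| <= L].
  rewrite (_ : [set s | _] = (fun s : R => `|s| <= L) @^-1` [set true]).
    have mle : measurable_fun setT (fun s : R => `|s| <= L).
      by apply: measurable_fun_ler => //; exact: normr_measurable.
    by rewrite -[X in measurable X]setTI; exact: (mle measurableT [set true]).
  by apply/seteqP; split.
move=> /(_ mB); rewrite (_ : (fun t => if _ then _ else _) = cut_hat m).
  apply; apply: cmeasurable_real; exact: measurable_hat.
by apply/funext => s; rewrite /cut_hat mem_setE.
Qed.

Lemma cut_hat_le1 m s : rnorm (cut_hat m s) <= 1.
Proof.
rewrite /cut_hat; case: ifP => _; last by rewrite rnorm0.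
by rewrite rnormR ger0_norm ?hat_ge0// hat_le1.
Qed.

(** Discretising the measure amounts to averaging step functions of the integrand. The identity is
    used for the symbol, with [G] a character, and for the orbit, with [G] its normalised values on
    the grid. *)
Lemma discretisation_integral (X : normedModType R[i]) (G : int -> X) :
  is_bochner_integral mu (fun s => (if `|s| <= L then cw s else 0 : R[i]) *:
      ((n%:R^-1)%:C *: \sum_(i < n) G (round_step nu h i s)))
    (\sum_(e <- discretisation) e.2 *: G e.1).
Proof.
rewrite /discretisation big_map /=.
have -> : (fun s => (if `|s| <= L then cw s else 0 : R[i]) *:
      ((n%:R^-1)%:C *: \sum_(i < n) G (round_step nu h i s))) =
    (fun s => \sum_(m <- int_range) (cut_hat m s * cw s) *: G m).
  apply/funext => s; rewrite /cut_hat; case: ifPn => sL; last first.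
    by rewrite scale0r big1// => m _; rewrite mul0r scale0r.
  rewrite -(sum_hat G int_range_uniq) => [|i iltn]; last exact: round_step_range.
  by rewrite scaler_sumr; apply: eq_bigr => m _; rewrite scalerA mulrC.
apply: (is_bochner_integral_sum hmu muk kmu) => m.
apply: (is_bochner_integralZr hmu muk kmu).
exact: (weighted_integralP hmu muk kmu kcosh (cmeasurable_cut_hat m) (cut_hat_le1 m)).
Qed.

Variables (N delta : R).
Hypothesis FN : forall z, rnorm (fourier (mu_weight omega mu) z) <= N.
Hypotheses (d0 : 0 < delta) (dn : 4 / n%:R <= delta ^+ 2).

Definition discretisation_error (s : R) : R :=
  (delta + (if `|s| <= L then 0 else 1)) * cosh (omega * s).

(** The integral of [interpolation (s / h) * cosh (omega s)] is a convex combination of Fourier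
    values at [z j / h], hence at most [N] in modulus, with no constant lost. Its integrand differs
    from that of the symbol by at most [discretisation_error]. *)
Lemma symbol_discretisation xi :
  ((rnorm (symbol discretisation xi : R[i]^o))%:E <=
    N%:E + \int[k]_s (discretisation_error s)%:E)%E.
Proof.
have [xi' xi'pi xiE] := cis_reduction xi.
have -> : symbol discretisation xi = \sum_(e <- discretisation) e.2 *: (cis (- (xi' * e.1%:~R)) : R[i]^o).
  by apply: eq_bigr => e _; rewrite xiE.
have I1 := discretisation_integral (fun m => cis (- (xi' * m%:~R)) : R[i]^o).
set D := \sum_(e <- _) _ in I1 *.
pose q := @frequency_weight R nu xi'; pose z := @frequency R nu xi'.
have mf y : cmeasurable (fun s : R => cis (- (y * s)) : R[i]^o).
  by apply: cmeasurable_cis; apply: measurableT_comp => //; exact: measurable_funM.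
have f1 y s : rnorm (cis (- (y * s)) : R[i]^o) <= 1 by rewrite rnorm_cis.
have I2 : is_bochner_integral mu (fun s => interpolation nu xi' (s / h) * cw s : R[i]^o)
    (\sum_(j < n) (q j)%:C *: fourier (mu_weight omega mu) (z j / h)).
  have -> : (fun s => interpolation nu xi' (s / h) * cw s : R[i]^o) =
      (fun s => \sum_(j < n) (q j)%:C *: (cis (- (z j / h * s)) * cw s : R[i]^o)).
    apply/funext => s; rewrite /interpolation mulr_suml; apply: eq_bigr => j _.
    rewrite -mulrA; congr (_ * (cis _ * _)).
    by rewrite mulrA mulrAC.
  apply: (is_bochner_integral_sum hmu muk kmu) => j.
  rewrite (fourier_mu_weight hmu muk kmu kcosh).
  have := weighted_integralP hmu muk kmu kcosh (mf (z j / h)) (f1 _).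
  set w := weighted_integral _ _ _ => Iw.
  have := is_bochner_integral_lin hmu muk kmu (q j)%:C 0 Iw Iw.
  by rewrite scale0r addr0; under eq_fun do rewrite scale0r addr0.
have q0 j : 0 <= q j by exact: frequency_weight_ge0.
have q1 : \sum_(j < n) q j = 1 by exact: sum_frequency_weight.
set E := \sum_(j < n) _ in I2.
have EN : rnorm E <= N.
  apply: (le_trans (rnorm_sum _ _ _)).
  apply: (@le_trans _ _ (\sum_(j < n) q j * N)); last by rewrite -mulr_suml q1 mul1r.
  by apply: ler_sum => j _; rewrite rnorm_real ger0_norm// ler_wpM2l.
have : ((rnorm (D - E))%:E <= \int[k]_s (discretisation_error s)%:E)%E.
  apply: (le_trans (is_bochner_integral_dist hmu muk kmu I1 I2)).
  apply: ge0_le_integral => //.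
  - by move=> s _; rewrite lee_fin rnorm_ge0.
  - apply: measurable_dist; [exact: is_bochner_strongly_measurable I1|].
    exact: is_bochner_strongly_measurable I2.
  - apply/measurable_EFinP; apply: measurable_funM; last exact: measurable_cosh.
    apply: measurable_funD => //; apply: measurable_fun_ifT => //.
    by apply: measurable_fun_ler => //; exact: normr_measurable.
  move=> s _; rewrite lee_fin /discretisation_error.
  have gridE : (n%:R^-1)%:C *: (\sum_(i < n) (cis (- (xi' * (round_step nu h i s)%:~R)) : R[i]^o)) =
      interpolation nu xi' ((Num.floor (s * n%:R / h))%:~R / n%:R).
    by rewrite interpolation_grid.
  rewrite gridE; set r := Num.floor _.
  case: ifPn => sL.
    rewrite addr0.
    have -> : cw s *: (interpolation nu xi' (r%:~R / n%:R) : R[i]^o) - interpolation nu xi' (s / h) * cw s =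
        (interpolation nu xi' (r%:~R / n%:R) - interpolation nu xi' (s / h)) * cw s.
      by rewrite mulrBl [X in X - _]mulrC.
    rewrite (@rnormM R) rnorm_cosh_weight ler_wpM2r ?(ltW (cosh_gt0 _))//.
    have -> : s / h = r%:~R / n%:R + (s / h - r%:~R / n%:R) by rewrite addrC subrK.
    apply: (interpolation_modulus xi'pi) => //.
    have n0 : 0 < n%:R :> R by rewrite ltr0n.
    have /andP[f1' f2'] := floor_itv (s * n%:R / h); rewrite -/r intrD in f1' f2'.
    have e : s / h = s * n%:R / h / n%:R by field; rewrite !gt_eqF.
    rewrite e -mulrBl normrM (@ger0_norm _ n%:R^-1) ?invr_ge0//.
    rewrite ler_pdivrMr// mulVf ?gt_eqF// ler_norml; apply/andP; split; lra.
  rewrite scale0r sub0r rnormN (@rnormM R) rnorm_cosh_weight ler_wpM2r ?(ltW (cosh_gt0 _))//.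
  apply: (@le_trans _ _ 1); last by rewrite lerDr ltW.
  rewrite /interpolation; apply: (le_trans (@rnorm_sum R R[i]^o _ _ _ _)).
  rewrite -q1; apply: ler_sum => j _.
  by rewrite (@rnormM R) rnorm_cis mulr1 rnormR ger0_norm.
move=> DE; apply: (@le_trans _ _ ((rnorm E)%:E + (rnorm (D - E))%:E)%E).
  by rewrite -EFinD lee_fin -{1}(subrKC E D) rnormD.
by rewrite leeD// lee_fin.
Qed.

End discretisation.

Section limit.
Context (R : realType) (d : measure_display) (Om : measurableType d).
Variables (P : probability Om R) (gam : nat -> Om -> R[i]).
Hypothesis hgam : standard_complex_gaussians P gam.
Variables (X : normedModType R[i]) (U : R -> {linear X -> X}).
Hypothesis UD : forall s t x, U (s + t) x = U s (U t x).
Hypothesis Uc : forall x, continuous (fun s => U s x).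
Variables (omega omega0 p q t c M : R).
Hypotheses (homega0 : 0 <= omega0) (homega : omega0 < omega).
Hypothesis UM : forall s x, rnorm (U s x) <= M * cosh (omega0 * s) * rnorm x.
Hypotheses (hp : 1 <= p) (hq : 1 < q) (c0 : 0 <= c) (t0 : 0 <= t) (M1 : 1 <= M).
Hypotheses (ht : type_bound P gam X p t) (hc : cotype_bound P gam X q c).
Variables (DA : set X) (A : X -> X).
Hypothesis UA : generates DA (fun x => (- 'i) *: A x) U.
Variables (mu : set R -> R[i]^o) (hmu : complex_measure mu).
Variable k : {finite_measure set R -> \bar R}.
Hypothesis muk : forall A, measurable A -> ((rnorm (mu A))%:E <= k A)%E.
Hypothesis kmu : forall A, measurable A -> (k A <= 4%:E * total_variation mu A)%E.
Hypothesis kcosh : (\int[k]_s (cosh (omega * s))%:E < +oo)%E.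
Variables (x : X) (N S : R).
Hypothesis FN : forall z, rnorm (fourier (mu_weight omega mu) z) <= N.
Hypothesis S_ge : forall J, \sum_(j < J.+1) (2^-1 ^+ j) `^ (- (p^-1 - q^-1)) *
  K_functional DA A (2^-1 ^+ j) x <= S.

Let M0 : 0 <= M. Proof. exact: le_trans M1. Qed.
Let omega_gt0 : 0 < omega. Proof. exact: le_lt_trans homega. Qed.
Local Notation cw := (cosh_weight omega).

(** The normalised orbit: it is bounded because [omega > omega0], and multiplication by
    [cosh_weight] restores [U s x]. *)
Let W (s : R) : X := (weight omega s)%:C *: U s x.

Let W_le s : rnorm (W s) <= M * rnorm x.
Proof.
rewrite /W rnorm_real gtr0_norm ?weight_gt0//.
have w1 : weight omega s * cosh (omega0 * s) <= 1.
  rewrite /weight mulrC ler_pdivrMr ?cosh_gt0// mul1r ler_cosh_norm// !normrM.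
  by rewrite (ger0_norm homega0) (gtr0_norm omega_gt0) ler_wpM2r// ltW.
apply: (@le_trans _ _ (weight omega s * (M * cosh (omega0 * s) * rnorm x))).
  by rewrite ler_wpM2l ?(ltW (weight_gt0 _ _)).
have -> : weight omega s * (M * cosh (omega0 * s) * rnorm x) =
    (weight omega s * cosh (omega0 * s)) * (M * rnorm x) by ring.
by rewrite ler_piMl ?mulr_ge0 ?rnorm_ge0.
Qed.

Let cwW s : cw s *: W s = U s x.
Proof.
by rewrite /W scalerA /cosh_weight /weight -rmorphM/= divff ?scale1r// gt_eqF// cosh_gt0.
Qed.

Let W_continuous s (e : R) : 0 < e ->
  exists2 eta : R, 0 < eta & forall r, `|r - s| < eta -> rnorm (W r - W s) < e.
Proof.
move=> e0; have Ue : (fun r => rnorm (U s x - U r x)) @ s --> (0 : R).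
  have Us : (fun r => U r x) @ s --> U s x := @Uc x s.
  have FF : Filter ((fun r => U r x) @ s) by exact: fmap_filter.
  exact: (@cvg_rnormP R X ((fun r => U r x) @ s) FF (U s x)).1 Us.
have e20 : 0 < e / 2 by rewrite divr_gt0.
have /cvgrPdist_lt /(_ _ e20) /nbhs_ballP[/= e1 e10 h1] := Ue.
pose K := 2 * omega * (rnorm (U s x) + 1).
have K0 : 0 < K by rewrite !mulr_gt0// ltr_wpDl ?rnorm_ge0.
exists (Num.min e1 (e / 2 / K)) => [|r]; first by rewrite lt_min e10 divr_gt0.
rewrite lt_min => /andP[r1 r2].
have h1r : rnorm (U s x - U r x) < e / 2.
  have sr : ball s e1 r by rewrite /ball/= distrC.
  by have := h1 _ sr; rewrite sub0r normrN ger0_norm ?rnorm_ge0.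
have -> : W r - W s = (weight omega r)%:C *: (U r x - U s x) +
    (weight omega r - weight omega s)%:C *: U s x.
  by rewrite /W scalerBr rmorphB/= scalerBl addrA subrK.
apply: (le_lt_trans (rnormD _ _)); rewrite !rnorm_real gtr0_norm ?weight_gt0//.
have h2 : weight omega r * rnorm (U r x - U s x) < e / 2.
  apply: le_lt_trans h1r; rewrite rdistC ler_piMl ?rnorm_ge0//.
  exact: weight_le1.
have h3 : `|weight omega r - weight omega s| * rnorm (U s x) <= e / 2.
  apply: (@le_trans _ _ (2 * (omega * `|r - s|) * (rnorm (U s x) + 1))).
    by rewrite ler_pM ?rnorm_ge0 ?weight_dist// lerDl.
  have -> : 2 * (omega * `|r - s|) * (rnorm (U s x) + 1) = `|r - s| * K by rewrite /K; ring.
  by rewrite -ler_pdivlMr// ltW.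
lra.
Qed.

(** At level [J] the step is [2^-J], the cut-off radius [J] and the tolerance [1 / (J + 1)]. [nuJ]
    gives [n >= 4 (J + 1)^2], as [interpolation_modulus] requires, and [LamJ] equals [L / h + 2]. *)
Let hJ J : R := 2^-1 ^+ J.
Let nuJ (J : nat) := (2 * J.+1 ^ 2)%N.
Let nJ J := (nuJ J + nuJ J).+1.
Let LJ (J : nat) : R := J%:R.
Let LamJ J := (J * 2 ^ J + 2)%N.
Let deltaJ J : R := J.+1%:R^-1.

Let hJ_gt0 J : 0 < hJ J. Proof. exact: exprn_gt0. Qed.

Let LamJ_ge J : LJ J / hJ J + 2 <= (LamJ J)%:R.
Proof. by rewrite /LJ /hJ /LamJ exprVn invrK natrD natrM natrX. Qed.

Let deltaJ_gt0 J : 0 < deltaJ J. Proof. by rewrite invr_gt0. Qed.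

Let deltaJ_ge J : 4 / (nJ J)%:R <= deltaJ J ^+ 2.
Proof.
rewrite /deltaJ exprVn ler_pdivrMr// mulrC ler_pdivlMr ?exprn_gt0// -natrX -natrM ler_nat.
by rewrite /nJ /nuJ; lia.
Qed.

Let DJ J := discretisation mu omega (nuJ J) (hJ J) (LJ J) (LamJ J).

Let fJ J (s : R) : X := (if `|s| <= LJ J then cw s else 0 : R[i]) *:
  (((nJ J)%:R^-1)%:C *: \sum_(i < nJ J) W ((round_step (nuJ J) (hJ J) i s)%:~R * hJ J)).

Let mean_le (n : nat) (F : 'I_n.+1 -> X) (C : R) : (forall i, rnorm (F i) <= C) ->
  rnorm ((n.+1%:R^-1)%:C *: \sum_(i < n.+1) F i) <= C.
Proof.
move=> FC; rewrite rnorm_real ger0_norm ?invr_ge0// mulrC ler_pdivrMr//.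
apply: (le_trans (rnorm_sum _ _ _)).
rewrite mulr_natr -[X in _ *+ X]card_ord -sumr_const; exact: ler_sum.
Qed.

Let fJ_integral J : is_bochner_integral mu (fJ J) (weighted_orbit_sum U omega (hJ J) (DJ J) x).
Proof.
have := discretisation_integral hmu muk kmu kcosh (nuJ J) (hJ_gt0 J) (LamJ_ge J)
  (fun m => W (m%:~R * hJ J)).
congr (is_bochner_integral _ _ _).
by apply: eq_bigr => e _; rewrite /W scalerA.
Qed.

Let fJ_le J s : rnorm (U s x - fJ J s) <= 2 * (M * rnorm x) * cosh (omega * s).
Proof.
apply: (le_trans (rnormB _ _)).
have Mx : 0 <= M * rnorm x by rewrite mulr_ge0 ?rnorm_ge0.
have h1 : rnorm (U s x) <= M * rnorm x * cosh (omega * s).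
  rewrite -cwW rnormZ rnorm_cosh_weight mulrC ler_wpM2r ?W_le//.
  exact/ltW/cosh_gt0.
have h2 : rnorm (fJ J s) <= M * rnorm x * cosh (omega * s).
  rewrite /fJ; case: ifP => _; last first.
    by rewrite scale0r rnorm0 mulr_ge0// ltW// cosh_gt0.
  rewrite rnormZ rnorm_cosh_weight mulrC ler_wpM2r ?(ltW (cosh_gt0 _))//.
  by apply: mean_le => i; exact: W_le.
lra.
Qed.

Let hJ_cvg0 : hJ @ \oo --> (0 : R).
Proof. by apply: cvg_expr; rewrite ger0_norm// invf_lt1// ltr1n. Qed.

Let fJ_cvg s : (fJ J s) @[J --> \oo] --> U s x.
Proof.
apply/cvg_rnormP.
suff : (fun J => rnorm (U s x - fJ J s)) @ \oo --> (0 : R) by exact.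
apply/cvgrPdist_lt => e e0.
have C0 : 0 < cosh (omega * s) by exact: cosh_gt0.
have e'0 : 0 < e / 2 / cosh (omega * s) by rewrite divr_gt0// divr_gt0.
have [eta eta0 h] := W_continuous s e'0.
near=> J.
rewrite sub0r normrN ger0_norm ?rnorm_ge0//.
have sJ : `|s| <= LJ J by near: J; exact: nbhs_infty_ger.
rewrite /fJ sJ -cwW -scalerBr rnormZ rnorm_cosh_weight.
have -> : W s - ((nJ J)%:R^-1)%:C *: \sum_(i < nJ J) W ((round_step (nuJ J) (hJ J) i s)%:~R * hJ J) =
  ((nJ J)%:R^-1)%:C *: \sum_(i < nJ J) (W s - W ((round_step (nuJ J) (hJ J) i s)%:~R * hJ J)).
  rewrite sumrB scalerBr sumr_const card_ord -[W s *+ _]scaler_nat scalerA.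
  by rewrite -(rmorph_nat (real_complex R)) -rmorphM/= mulVf ?scale1r// pnatr_eq0.
apply: (@le_lt_trans _ _ (cosh (omega * s) * (e / 2 / cosh (omega * s)))).
  rewrite ler_pM2l//; apply: mean_le => i; rewrite rdistC; apply/ltW/h.
  apply: (le_lt_trans (round_step_close (hJ_gt0 J) s (ltn_ord i))).
  rewrite mulrC -ltr_pdivlMr//.
  near: J; have /cvgrPdist_lt := hJ_cvg0.
  have eta2 : 0 < eta / 2 by rewrite divr_gt0.
  by move=> /(_ _ eta2); apply: filterS => J; rewrite sub0r normrN gtr0_norm.
rewrite mulrC divfK ?gt_eqF// ltr_pdivrMr// ltr_pMr// ltr1n.
Unshelve. all: by end_near. Qed.

Let errorJ J := (\int[k]_s (discretisation_error omega (LJ J) (deltaJ J) s)%:E)%E.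

Let measurable_error J : measurable_fun setT (discretisation_error omega (LJ J) (deltaJ J)).
Proof.
apply: measurable_funM; last exact: measurable_cosh.
apply: measurable_funD => //; apply: measurable_fun_ifT => //.
by apply: measurable_fun_ler => //; exact: normr_measurable.
Qed.

Let error_ge0 J s : 0 <= discretisation_error omega (LJ J) (deltaJ J) s.
Proof.
rewrite /discretisation_error mulr_ge0 ?(ltW (cosh_gt0 _))// addr_ge0 ?(ltW (deltaJ_gt0 _))//.
by case: ifP.
Qed.

Let error_le J s : discretisation_error omega (LJ J) (deltaJ J) s <= 2 * cosh (omega * s).
Proof.
rewrite /discretisation_error ler_wpM2r ?(ltW (cosh_gt0 _))//.
have : deltaJ J <= 1 by rewrite /deltaJ invf_le1// ler1n.
by case: ifP => _; lra.
Qed.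

Let error_cvg0 : errorJ @ \oo --> (0 : \bar R)%E.
Proof.
have p1 : {ae k, forall s, setT s -> (discretisation_error omega (LJ J) (deltaJ J) s)%:E @[J --> \oo] --> cst 0%E s}.
  apply: aeW => s _; apply/cvgE.
  have c1 : (fun J => deltaJ J * cosh (omega * s)) @ \oo --> (0 : R).
    by rewrite -(mul0r (cosh (omega * s))); apply: cvgM; [exact: cvg_harmonic|exact: cvg_cst].
  apply: cvg_trans c1; apply: near_eq_cvg; near=> J.
  rewrite /discretisation_error ifT ?addr0//.
  by near: J; exact: nbhs_infty_ger.
have p2 : k.-integrable setT (fun s => (2 * cosh (omega * s))%:E).
  apply/integrableP; split.
    by apply/measurable_EFinP; apply: measurable_funM => //; exact: measurable_cosh.
  under eq_integral do rewrite /= ger0_norm ?mulr_ge0 ?(ltW (cosh_gt0 _))// EFinM.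
  rewrite ge0_integralZl_EFin//.
  + by rewrite lte_mul_pinfty.
  + by move=> s _; rewrite lee_fin ltW// cosh_gt0.
  + by apply/measurable_EFinP; exact: measurable_cosh.
have p3 : {ae k, forall s J, setT s ->
    `|(discretisation_error omega (LJ J) (deltaJ J) s)%:E| <= (2 * cosh (omega * s))%:E}%E.
  by apply: aeW => s J _; rewrite gee0_abs ?lee_fin.
have mf J : measurable_fun setT (fun s => (discretisation_error omega (LJ J) (deltaJ J) s)%:E).
  exact/measurable_EFinP.
have [_ _] := dominated_convergence measurableT mf (measurable_cst _) p1 p2 p3.
by rewrite integral0.
Unshelve. all: by end_near. Qed.

(** The orbit sums tend to [y], their symbols are at most [N] plus an error tending to 0, and [S]
    bounds the dyadic sums of all levels at once. *)
Lemma bochner_orbit_le (y : X) : is_bochner_integral mu (fun s => U s x) y ->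
  rnorm y <= dyadic_const omega omega0 p q * (c * t * M ^+ 2 * N) * S.
Proof.
move=> Iy.
have cy : (fun J => weighted_orbit_sum U omega (hJ J) (DJ J) x) @ \oo --> y.
  apply: (is_bochner_integral_cvg hmu muk kmu fJ_integral Iy (g := fun s => 2 * (M * rnorm x) * cosh (omega * s))).
  - exact: fJ_cvg.
  - by move=> J s; exact: fJ_le.
  - by apply: measurable_funM => //; exact: measurable_cosh.
  - under eq_integral do rewrite EFinM.
    rewrite ge0_integralZl_EFin ?mulr_ge0 ?rnorm_ge0//.
    + by rewrite lte_mul_pinfty ?lee_fin ?mulr_ge0 ?rnorm_ge0.
    + by move=> s _; rewrite lee_fin ltW// cosh_gt0.
    + by apply/measurable_EFinP; exact: measurable_cosh.
have /cvg_rnorm cy' := cy.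
have N0 : 0 <= N by apply: le_trans (FN 0); exact: rnorm_ge0.
pose K := dyadic_const omega omega0 p q * (c * t * M ^+ 2).
have K0 : 0 <= K.
  have o1 : 0 <= 1 + omega by rewrite addr_ge0// ltW.
  rewrite /K /dyadic_const /transference_const; apply: mulr_ge0.
    by rewrite !mulr_ge0 ?expR_ge0 ?powR_ge0 ?exprn_ge0.
  by apply: mulr_ge0; [exact: mulr_ge0|exact: exprn_ge0].
have Kf_ge0 h : 0 <= h -> 0 <= K_functional DA A h x.
  move=> h0; rewrite -[leRHS]mul1r; apply: (K_functional_ge UA) => // a b _ _.
  by rewrite mul1r !addr_ge0 ?mulr_ge0 ?addr_ge0 ?rnorm_ge0.
have S0 : 0 <= S.
  apply: le_trans (S_ge 0); rewrite big_ord1 mulr_ge0 ?powR_ge0//.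
  by apply: Kf_ge0; rewrite exprn_ge0.
have leJ : \forall J' \near \oo, rnorm (weighted_orbit_sum U omega (hJ J') (DJ J') x) <=
    K * (N + fine (errorJ J')) * S.
  near=> J'.
  have efin : errorJ J' \is a fin_num.
    near: J'; have /fine_cvgP[h _] := error_cvg0; exact: h.
  have e0 : 0 <= fine (errorJ J').
    by apply: fine_ge0; apply: integral_ge0 => s _; rewrite lee_fin.
  have DN xi : rnorm (symbol (DJ J') xi : R[i]^o) <= N + fine (errorJ J').
    rewrite -lee_fin EFinD fineK//.
    exact: (symbol_discretisation hmu muk kmu kcosh (hJ_gt0 _) (LamJ_ge _) FN (deltaJ_gt0 _) (deltaJ_ge _)).
  have := @weighted_orbit_sum_le R d Om P gam hgam X U UD omega omega0 p q t c M homega0 homega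
    UM hp hq c0 t0 M1 ht hc DA A UA J' (DJ J') (N + fine (errorJ J')) x (addr_ge0 N0 e0) DN.
  move=> /le_trans; apply.
  have -> : dyadic_const omega omega0 p q * (c * t * M ^+ 2 * (N + fine (errorJ J'))) =
    K * (N + fine (errorJ J')) by rewrite /K !mulrA.
  by apply: ler_wpM2l; [exact: mulr_ge0 K0 (addr_ge0 N0 e0)|exact: S_ge].
have ce : (fun J => K * (N + fine (errorJ J)) * S) @ \oo --> K * N * S.
  have /fine_cvgP[_ ef] := error_cvg0.
  apply: cvgM; last exact: cvg_cst.
  apply: cvgM; first exact: cvg_cst.
  by rewrite -[X in _ --> X]addr0; apply: cvgD; [exact: cvg_cst|exact: ef].
have -> : dyadic_const omega omega0 p q * (c * t * M ^+ 2 * N) = K * N by rewrite /K !mulrA.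
exact: (ler_cvg_to cy' ce leJ).
Unshelve. all: by end_near. Qed.

End limit.

(** * Real interpolation and the theorem *)

Section interpolation_sum.
Context (R : realType) (X : normedModType R[i]).
Variables (DA : set X) (A : X -> X) (theta : R) (x : X).
Hypothesis D0 : DA 0.
Hypothesis theta01 : 0 <= theta <= 1.

Local Notation K := (K_functional DA A).

Let members (h : R) : set R := [set rnorm ab.1 + h * graph_norm A ab.2 | ab in
        [set ab : X * X | DA ab.2 /\ x = ab.1 + ab.2]].

Let members_nonempty h : nonempty (members h).
Proof.
exists (rnorm x + h * graph_norm A 0); exists (x, 0) => //=.
by split => //; rewrite addr0.
Qed.

Let graph_norm_ge0 b : 0 <= graph_norm A b.
Proof. by rewrite addr_ge0 ?rnorm_ge0. Qed.

Let members_lb h : 0 <= h -> lbound (members h) 0.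
Proof. by move=> h0 _ [[a b] _ <-] /=; rewrite addr_ge0 ?rnorm_ge0 ?mulr_ge0. Qed.

Lemma K_functional_ge0 h : 0 <= h -> 0 <= K h x.
Proof. by move=> h0; apply: lb_le_inf; [exact: members_nonempty|exact: members_lb]. Qed.

Lemma K_functional_nondecreasing h h' : 0 <= h -> h <= h' -> K h x <= K h' x.
Proof.
move=> h0 hh'; apply: lb_le_inf; first exact: members_nonempty.
move=> _ [[a b] /= [Db xab] <-].
apply: (@le_trans _ _ (rnorm a + h * graph_norm A b)); last by rewrite lerD2l ler_wpM2r.
apply: ge_inf; first by exists 0; exact: members_lb.
by exists (a, b).
Qed.

Let f (t : R) : \bar R := ((t `^ (- theta) * K t x) `^ 1 / t)%:E.

Let f_ge0 t : 0 <= t -> (0 <= f t)%E.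
Proof. by move=> t0; rewrite lee_fin divr_ge0 ?powR_ge0. Qed.

Let mf : measurable_fun (`]0, +oo[%classic : set R) f.
Proof.
(* Replacing [t] by [max t 0] extends the K-functional to a monotone function on the whole line,
   which is then measurable. *)
have mK : measurable_fun setT (fun t : R => K (Num.max t 0) x).
  apply: nondecreasing_measurable => // s t st.
  apply: K_functional_nondecreasing; first by rewrite le_max lexx orbT.
  by rewrite ge_max !le_max st lexx !orbT.
apply/measurable_EFinP.
apply: (@eq_measurable_fun _ _ _ _ _ (fun t : R => (t `^ (- theta) * K (Num.max t 0) x) `^ 1 * t `^ (-1))).
  by move=> t; rewrite inE/= in_itv/= andbT => t0; rewrite max_l ?(ltW t0)// powR_inv1 ?(ltW t0).
apply: measurable_funS (_ : measurable_fun setT _) => //.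
apply: measurable_funM; last exact: measurable_powR.
apply: (measurableT_comp (measurable_powR 1)).
by apply: measurable_funM => //; exact: measurable_powR.
Qed.

Let a (j : nat) : R := 2^-1 ^+ j.
Let itv (b c : R) : set R := `[b, c[%classic.
Let mitv b c : measurable (itv b c). Proof. exact: measurable_itv. Qed.
Let a0 j : 0 < a j. Proof. exact: exprn_gt0. Qed.

Let itv_sub j (b : R) : itv (a j) b `<=` (`]0, +oo[%classic : set R).
Proof.
by move=> t; rewrite /itv/= !in_itv/= andbT => /andP[t1 _]; exact: lt_le_trans t1.
Qed.

(** On [[a j, 2 a j[] the K-functional only grows, [t ^ (- theta)] loses at most a factor 2 because
    [theta <= 1], and [1 / t] another 2. The length of the interval is [a j], which leaves the 4. *)
Let step_le j : (((a j) `^ (- theta) * K (a j) x / 4)%:E <= \int[@lebesgue_measure R]_(t in itv (a j) (2 * a j)) f t)%E.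
Proof.
have /andP[th0 th1] := theta01.
have K0 := K_functional_ge0 (ltW (a0 j)).
have -> : ((a j) `^ (- theta) * K (a j) x / 4)%:E =
    (\int[@lebesgue_measure R]_(t in itv (a j) (2 * a j)) cst ((a j) `^ (- theta) * K (a j) x / (4 * a j))%:E t)%E.
  have aI : (@lebesgue_measure R (itv (a j) (2 * a j)) = (a j)%:E)%E.
    have := lebesgue_measure_itv `[a j, 2 * a j[%R; rewrite -/(itv _ _) => ->.
    rewrite /= lte_fin ltr_pMl// ltr1n -EFinB; congr (_%:E); ring.
  transitivity ((a j `^ (- theta) * K (a j) x / (4 * a j))%:E * (a j)%:E)%E.
    by rewrite -EFinM; congr (_%:E); field; rewrite gt_eqF.
  by rewrite integral_cst; [rewrite [X in (_ = _ * X)%E]aI|exact: mitv].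
apply: ge0_le_integral => //.
- exact: mitv.
- by move=> t _; rewrite lee_fin divr_ge0 ?mulr_ge0 ?powR_ge0// ltW.
- by apply: measurable_funS mf => //; exact: itv_sub.
move=> t; rewrite /itv/= in_itv/= => /andP[at_ ta]; rewrite lee_fin.
have t0 : 0 < t by exact: lt_le_trans at_.
have Kt := K_functional_nondecreasing (ltW (a0 j)) at_.
rewrite powRr1 ?mulr_ge0 ?powR_ge0 ?(K_functional_ge0 (ltW t0))//.
have tth : (a j) `^ (- theta) / 2 <= t `^ (- theta).
  rewrite !powRN -invfM lef_pV2 ?posrE ?mulr_gt0 ?powR_gt0//.
  apply: (@le_trans _ _ ((2 * a j) `^ theta)).
    by rewrite ge0_ler_powR ?nnegrE ?mulr_ge0 ?(ltW t0) ?(ltW (a0 j)) ?(ltW ta).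
  rewrite powRM ?(ltW (a0 j))// mulrC ler_wpM2l ?powR_ge0//.
  by rewrite -[leRHS]powRr1// ler_powR// ler1n.
have -> : (a j) `^ (- theta) * K (a j) x / (4 * a j) =
   ((a j) `^ (- theta) / 2 * K (a j) x) * (2 * a j)^-1 by field; rewrite gt_eqF.
apply: ler_pM.
- by rewrite !mulr_ge0 ?powR_ge0.
- by rewrite invr_ge0 mulr_ge0 ?ltW.
- by apply: ler_pM => //; rewrite divr_ge0 ?powR_ge0.
- by rewrite lef_pV2 ?posrE ?mulr_gt0// ltW.
Qed.

Let sum_le J : ((\sum_(j < J.+1) (a j) `^ (- theta) * K (a j) x / 4)%:E <=
  \int[@lebesgue_measure R]_(t in itv (a J) 2) f t)%E.
Proof.
elim: J => [|J ih].
  by rewrite big_ord1; have := step_le 0; rewrite /a expr0 mulr1.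
have aJ : 2 * a J.+1 = a J by rewrite /a exprS mulrA divff ?mul1r.
have a1 : a J <= 2.
  by apply: (@le_trans _ _ 1); rewrite ?ler1n// exprn_ile1// invf_le1// ler1n.
have -> : itv (a J.+1) 2 = itv (a J.+1) (a J) `|` itv (a J) 2.
  apply/seteqP; split => t; rewrite /itv/= !in_itv/=.
    by move=> /andP[t1 t2]; have [tJ|tJ] := ltP t (a J); [left; rewrite t1|right; rewrite t2].
  move=> [/andP[t1 t2]|/andP[t1 t2]].
    by rewrite t1 (lt_le_trans t2).
  rewrite t2 andbT; apply: le_trans t1; rewrite -aJ ler_peMl ?ler1n//.
  exact: ltW.
rewrite ge0_integral_setU//.
- by rewrite big_ord_recr/= EFinD addeC leeD//; have := step_le J.+1; rewrite aJ.
- exact: mitv.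
- exact: mitv.
- by apply: measurable_funS mf => // t [/itv_sub|/itv_sub].
- by move=> t [/itv_sub|/itv_sub] /=; rewrite in_itv/= andbT => /ltW; exact: f_ge0.
- apply/disj_set2P; apply/seteqP; split => // t []; rewrite /itv/= !in_itv/=.
  by move=> /andP[_ t1] /andP[t2 _]; move: (lt_le_trans t1 t2); rewrite ltxx.
Qed.

Lemma sum_K_functional_le J : ((\sum_(j < J.+1) (2^-1 ^+ j) `^ (- theta) * K (2^-1 ^+ j) x)%:E <=
  4%:E * interp_norm DA A theta 1 x)%E.
Proof.
have i0 : (0 <= \int[@lebesgue_measure R]_(t in `]0%R, +oo[) f t)%E.
  by apply: integral_ge0 => t /=; rewrite in_itv/= andbT => /ltW; exact: f_ge0.
rewrite /interp_norm invr1 poweRe1//.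
apply: (@le_trans _ _ (4%:E * \int[@lebesgue_measure R]_(t in itv (a J) 2) f t)%E).
  apply: (@le_trans _ _ (4%:E * (\sum_(j < J.+1) (a j) `^ (- theta) * K (a j) x / 4)%:E)%E).
    by rewrite -EFinM lee_fin -mulr_suml mulrC divfK.
  by apply: lee_wpmul2l => //; exact: sum_le.
rewrite lee_wpmul2l//; apply: ge0_subset_integral => //.
- exact: mitv.
- by move=> t /=; rewrite in_itv/= andbT => /ltW; exact: f_ge0.
Qed.

End interpolation_sum.

Section operator_norm.
Context (R : realType) (X : normedModType R[i]) (T : {linear X -> X}).
Hypothesis Tc : continuous T.

(** A supremum is informative only for a set bounded above; continuity at 0 provides the bound
    [2 / e]. *)
Lemma rnorm_opnorm y : rnorm (T y) <= opnorm T * rnorm y.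
Proof.
have [e e0 he] : exists2 e : R, 0 < e & forall z, rnorm z < e -> rnorm (T z) < 1.
  have T0 : T @ (0 : X) --> (0 : X) by rewrite -[X in _ --> X](linear0 T); exact: Tc.
  have FF : Filter (T @ (0 : X)) by exact: fmap_filter.
  have := (@cvg_rnormP R X (T @ (0 : X)) FF 0).1 T0.
  move=> /cvgrPdist_lt /(_ _ ltr01) /nbhs_ballP[/= e e0 he].
  have eR : e = (complex.Re e)%:C.
    by move: e0; case: (e) => a b; rewrite ltcE/= => /andP[/eqP -> _].
  exists (complex.Re e); first by rewrite -ltcR -eR.
  move=> z ze; have bz : ball (0 : X) e z.
    by rewrite -ball_normE/= sub0r normrN normE eR ltcR.
  by have := he _ bz; rewrite /= !sub0r !normrN ger0_norm ?rnorm_ge0// rnormN.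
pose E := [set rnorm (T z) | z in [set z : X | rnorm z <= 1]].
have Eb : has_ubound E.
  exists (2 / e) => _ [z /= z1 <-].
  have := he ((e / 2)%:C *: z); rewrite linearZ/= !rnorm_real ger0_norm ?divr_ge0 ?(ltW e0)//.
  have ez : e / 2 * rnorm z < e.
    apply: (@le_lt_trans _ _ (e / 2 * 1)); first by rewrite ler_wpM2l// divr_ge0// ltW.
    by rewrite mulr1 ltr_pdivrMr// ltr_pMr// ltr1n.
  move=> /(_ ez) /ltW h; rewrite -(@ler_pM2l _ (e / 2)) ?divr_gt0//.
  by apply: (le_trans h); rewrite mulrA divfK// divff// gt_eqF.
have [->|y0] := eqVneq y 0; first by rewrite linear0 !rnorm0 mulr0.
have ry : 0 < rnorm y by rewrite lt0r rnorm_eq0 y0 rnorm_ge0.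
have : E (rnorm (T ((rnorm y)^-1%:C *: y))).
  exists ((rnorm y)^-1%:C *: y) => //=.
  by rewrite rnorm_real ger0_norm ?invr_ge0 ?(ltW ry)// mulVf// gt_eqF.
move=> /(ub_le_sup Eb); rewrite linearZ/= rnorm_real ger0_norm ?invr_ge0 ?(ltW ry)//.
by rewrite ler_pdivrMl// mulrC.
Qed.

End operator_norm.

Section optimal_constants.
Context (R : realType) (d : measure_display) (Om : measurableType d).
Variables (P : probability Om R) (gam : nat -> Om -> R[i]) (X : normedModType R[i]).
Variables (p q : R).
Hypotheses (p0 : 0 < p) (q0 : 0 < q).
Hypothesis Xnz : exists x : X, x != 0.
Hypotheses (hp : has_type P gam X p) (hq : has_cotype P gam X q).

Let lp_norm_pos r : 0 < r -> exists2 x : 'I_1 -> X, 0 < lp_norm r x & True.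
Proof.
move=> r0; have [x x0] := Xnz; exists (fun=> x) => //.
by rewrite /lp_norm big_ord1 !powR_gt0// lt0r rnorm_eq0 x0 rnorm_ge0.
Qed.

(** A nonzero vector has positive [lp_norm], which rules out negative constants, so the infimum is
    over a set bounded below. *)
Let type_bound_ge0 C : type_bound P gam X p C -> 0 <= C.
Proof.
move=> hC; have [x x0 _] := lp_norm_pos p0.
have := le_trans _ (hC _ x); rewrite /gauss_norm => /(_ 0%E (poweR_ge0 _ _)).
by rewrite lee_fin pmulr_lge0.
Qed.

Let cotype_bound_ge0 C : cotype_bound P gam X q C -> 0 <= C.
Proof.
move=> hC; have [x x0 _] := lp_norm_pos q0.
rewrite leNgt; apply/negP => C0; have := hC _ x; rewrite leNgt => /negP; apply.
apply: (@le_lt_trans _ _ 0%E); last by rewrite lte_fin.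
by apply: mule_le0_ge0; [rewrite lee_fin ltW|exact: poweR_ge0].
Qed.

Lemma type_const_ge0 : 0 <= type_const P gam X p.
Proof.
by apply: lb_le_inf; [exact: hp|move=> C; exact: type_bound_ge0].
Qed.

Lemma cotype_const_ge0 : 0 <= cotype_const P gam X q.
Proof.
by apply: lb_le_inf; [exact: hq|move=> C; exact: cotype_bound_ge0].
Qed.

(** Type makes the Gaussian norm finite; this is also what allows the cotype inequality to be
    divided by it. *)
Let gauss_norm_real n (x : 'I_n -> X) : exists2 g : R, 0 <= g & gauss_norm P gam x = g%:E.
Proof.
have [C hC] := hp; have g0 : (0 <= gauss_norm P gam x)%E by exact: poweR_ge0.
have gf : gauss_norm P gam x \is a fin_num.
  by rewrite ge0_fin_numE//; apply: (le_lt_trans (hC _ x)); exact: ltry.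
by exists (fine (gauss_norm P gam x)); [exact: fine_ge0|rewrite fineK].
Qed.

Lemma type_const_bound : type_bound P gam X p (type_const P gam X p).
Proof.
move=> n x; have [g g0 gE] := gauss_norm_real x; rewrite gE lee_fin.
have hC C : type_bound P gam X p C -> g <= C * lp_norm p x.
  by move=> /(_ _ x); rewrite gE lee_fin.
have [l0|ln0] := eqVneq (lp_norm p x) 0.
  by have [C /hC] := hp; rewrite l0 !mulr0.
have lp : 0 < lp_norm p x by rewrite lt0r ln0 lp_norm_ge0.
rewrite -ler_pdivrMr//; apply: lb_le_inf; first exact: hp.
by move=> C /hC; rewrite ler_pdivrMr.
Qed.

Lemma cotype_const_bound : cotype_bound P gam X q (cotype_const P gam X q).
Proof.
move=> n x; have [g g0 gE] := gauss_norm_real x; rewrite gE -EFinM lee_fin.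
have hC C : cotype_bound P gam X q C -> lp_norm q x <= C * g.
  by move=> /(_ _ x); rewrite gE -EFinM lee_fin.
have [g00|gn0] := eqVneq g 0.
  by have [C /hC] := hq; rewrite g00 !mulr0.
have gp : 0 < g by rewrite lt0r gn0.
rewrite -ler_pdivrMr//; apply: lb_le_inf; first exact: hq.
by move=> C /hC; rewrite ler_pdivrMr.
Qed.

End optimal_constants.

Theorem proposition3p1 (R : realType)
    (d : measure_display) (Om : measurableType d) (P : probability Om R)
    (gam : nat -> Om -> R[i]) (hgam : standard_complex_gaussians P gam)
    (omega omega0 p q : R)
    (homega0 : 0 <= omega0) (homega : omega0 < omega)
    (hp : 1 <= p <= 2) (hq : 2 <= q) :
  exists2 C : R, 0 <= C &
    forall (X : completeNormedModType R[i]),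
      (exists x : X, x != 0) ->
      has_type P gam X p ->
      has_cotype P gam X q ->
    forall (DA : set X) (A : X -> X) (U : R -> {linear X -> X}),
      is_C0_group U ->
      generates DA (fun x => (- 'i) *: A x) U ->
    forall M : R,
      1 <= M ->
      (forall s : R, opnorm (U s) <= M * cosh (omega0 * s)) ->
    forall mu : set R -> R[i]^o, in_M_omega omega mu ->
    forall x : X, interp_space DA A (p^-1 - q^-1) 1 x ->
      ((rnorm (bochner mu (fun s : R => U s x)))%:E <=
        (C * type_const P gam X p * cotype_const P gam X q * M ^+ 2)%:E
        * Linfty_norm (fourier (mu_weight omega mu))
        * interp_norm DA A (p^-1 - q^-1) 1 x)%E.
Proof.
have omega_gt0 : 0 < omega by exact: le_lt_trans homega.
have /andP[p1 p2] := hp.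
have p0 : 0 < p by exact: lt_le_trans p1.
have q1 : 1 < q by apply: lt_le_trans hq; rewrite ltr1n.
have q0 : 0 < q by exact: lt_trans q1.
have dc0 : 0 <= dyadic_const omega omega0 p q.
  have o1 : 0 <= 1 + omega by rewrite addr_ge0// ltW.
  by rewrite /dyadic_const /transference_const !mulr_ge0 ?expR_ge0 ?powR_ge0 ?exprn_ge0.
(* The 4 compares the dyadic sum of K-functionals with the interpolation norm. *)
exists (4 * dyadic_const omega omega0 p q); first by rewrite mulr_ge0.
move=> X Xnz ht hc DA A U [Uct U0 UD Uc] UA M M1 UM mu hmuo x xI.
have t0 : 0 <= type_const P gam X p := type_const_ge0 p0 Xnz ht.
have c0 : 0 <= cotype_const P gam X q := cotype_const_ge0 q0 Xnz hc.
set N := Linfty_norm _; set I := interp_norm _ _ _ _ _.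
set t := type_const _ _ _ _ in t0 *; set c := cotype_const _ _ _ _ in c0 *.
have [hmu _] := hmuo.
have [k [muk kmu]] := dominating_measure_ex hmu.
have kcosh := exponential_moment (ltW omega_gt0) hmuo kmu.
have Nfin : N \is a fin_num by exact: (fourier_Linfty_fin hmu muk kmu kcosh).
have FN z : rnorm (fourier (mu_weight omega mu) z) <= fine N.
  by rewrite -lee_fin fineK//; exact: (fourier_le_Linfty hmu muk kmu kcosh).
have N0 : 0 <= fine N by apply: le_trans (FN 0); exact: rnorm_ge0.
have I0 : (0 <= I)%E by exact: poweR_ge0.
have Ifin : I \is a fin_num by rewrite ge0_fin_numE.
have UMx s y : rnorm (U s y) <= M * cosh (omega0 * s) * rnorm y.
  by apply: (le_trans (rnorm_opnorm (Uct s) y)); rewrite ler_wpM2r ?rnorm_ge0.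
have D0 : DA 0 by exact: generator0 UA.
have th : 0 <= p^-1 - q^-1 <= 1.
  apply/andP; split; first by rewrite subr_ge0 lef_pV2 ?posrE//; exact: le_trans hq.
  by rewrite lerBlDr ler_wpDr ?invr_ge0 ?(ltW q0)// invf_le1.
have S_ge J : \sum_(j < J.+1) (2^-1 ^+ j) `^ (- (p^-1 - q^-1)) *
    K_functional DA A (2^-1 ^+ j) x <= 4 * fine I.
  by rewrite -lee_fin EFinM fineK//; exact: sum_K_functional_le.
rewrite -(fineK Nfin) -(fineK Ifin) -!EFinM lee_fin.
have rhs0 : 0 <= 4 * dyadic_const omega omega0 p q * t * c * M ^+ 2 * fine N * fine I.
  have M0 : 0 <= M by exact: le_trans M1.
  apply: mulr_ge0; last exact: fine_ge0.
  apply: mulr_ge0 => //; apply: mulr_ge0; last exact: exprn_ge0.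
  by apply: mulr_ge0 => //; apply: mulr_ge0 => //; exact: mulr_ge0.
(* If no Bochner integral exists, [bochner] takes its default value 0 and nonnegativity of the
   right-hand side suffices. *)
have [[y Iy]|nI] := pselect (exists y, is_bochner_integral mu (fun s => U s x) y); last first.
  rewrite /bochner xgetPN ?rnorm0// => y Iy; apply: nI; by exists y.
rewrite (bochnerE hmu muk kmu Iy).
have := bochner_orbit_le hgam UD Uc homega0 homega UMx p1 q1 c0 t0 M1
  (type_const_bound ht) (cotype_const_bound ht hc) UA hmu muk kmu kcosh FN S_ge Iy.
move=> /le_trans; apply; rewrite le_eqVlt; apply/orP; left; apply/eqP; ring.
Qed.
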